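(* Let $m\ge1$, let $a_1,\dots,a_m$ be pairwise distinct positive real numbers and let $b_{2k}$ ($0\le k\le m$) be defined by $\sum_{k=0}^m b_{2k}\chi^{2k}=\prod_{i=1}^m(\chi^2-a_i^2)$. Let $\Delta=\sum_{k=1}^n\partial_{x_k}^2$ be the Laplacian on $\mathbb{R}^n$, where $n-2=2\nu+1$ with $\nu\in\{0,1,2,\dots\}$, and set $$P(\partial_x,\partial_t):=\sum_{k=0}^m b_{2k}\Delta^{m-k}\frac{\partial^{2k}}{\partial t^{2k}},\qquad x\in\mathbb{R}^n,\ t>0.$$ Let $f\in C^\infty(\mathbb{R}^n\times[0,\infty))$ and $\varphi_r\in C^\infty(\mathbb{R}^n)$ ($0\le r\le 2m-1$). Write $A_j:=\dfrac{a_j^{2m-2}}{\prod_{1\le i\le m,\,i\neq j}(a_j^2-a_i^2)}$. Then the initial value problem $$P(\partial_x,\partial_t)u=f(x,t)\quad(x\in\mathbb{R}^n,\ t>0),\qquad \frac{\partial^r u}{\partial t^r}\Big|_{t=0}=\varphi_r(x)\quad(r=0,1,\dots,2m-1)$$ has the solution $$\begin{aligned}u(x,t)={}&\int_0^t d\tau\int_0^{t-\tau}d\tau'\,\frac{(t-\tau-\tau')^{2m-3}}{(2m-3)!}\sum_{j=1}^m A_j\,\tau'\,\Big(J^\nu\big[(a_j^2\Delta)^\nu M_{a_j\,\cdot}f(\cdot,\tau)(x)\big]\Big)(\tau')\\&+\int_0^t\sum_{j=1}^m A_j\sum_{l=0}^{\nu-1}\frac{a_j^{2l}(t-\tau)^{2l+2m-1}}{(2l+2m-1)!}\Delta^lf(x,\tau)\,d\tau\\&+\sum_{k=0}^m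 b_{2k}\Delta^{m-k}\sum_{r=0}^{2k-1}\frac{\partial^{2k-1-r}}{\partial t^{2k-1-r}}\int_0^t d\tau\,\frac{(t-\tau)^{2m-3}}{(2m-3)!}\sum_{j=1}^mA_j\,\tau\,\Big(J^\nu\big[(a_j^2\Delta)^\nu M_{a_j\,\cdot}\varphi_r(x)\big]\Big)(\tau)\\&+\sum_{k=0}^m b_{2k}\Delta^{m-k}\sum_{r=0}^{2k-1}\sum_{j=1}^mA_j\sum_{l=0}^{\nu-1}\frac{a_j^{2l}\,t^{2l+2m+r-2k}}{(2l+2m+r-2k)!}\Delta^l\varphi_r(x),\end{aligned}$$ where empty sums are $0$ and empty products are $1$.
   Context: For $R>0$ and a function $g$ on $\mathbb{R}^n$, $$M_Rg(x):=\frac{1}{2(2\pi)^{\nu+1}R^{n-1}}\int_{|\xi-x|=R}g(\xi)\,dS(\xi),$$ with $dS$ the surface element of the sphere $\{\xi\in\mathbb{R}^n:\ |\xi-x|=R\}$. The operator $J$ acts on functions of one positive variable by $(Jh)(\tau)=\int_0^\tau h(s)\,s\,ds$; $J^\nu$ is its $\nu$-fold iterate ($J^0=$ identity). The expression $\big(J^\nu[(a^2\Delta)^\nu M_{a\,\cdot}g(x)]\big)(\tau)$ means $J^\nu$ applied to the function $s\mapsto(a^2\Delta)^\nu M_{as}g(x)$, evaluated at $\tau$. The Laplacian $\Delta$ acts in the variable $x$. Convention for $m=1$: $\int_0^s\frac{(s-\tau)^{2m-3}}{(2m-3)!}g(\tau)\,d\tau$ means $g(s)$ (convolution with the inverse Laplace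 transform of $1/s^{2m-2}=1$). *)

(* Defs.v *)
From HB Require Import structures.
From mathcomp Require Import all_boot all_order all_algebra.
From mathcomp Require Import all_classical all_reals all_analysis.
Set Implicit Arguments.
Unset Strict Implicit.
Unset Printing Implicit Defensive.
Import Order.TTheory GRing.Theory Num.Theory.
Import numFieldNormedType.Exports.
Local Open Scope classical_set_scope.
Local Open Scope ring_scope.

Section Calculus.
Variables (R : realType) (n : nat).
Implicit Types (g : 'rV[R]_n -> R) (u : 'rV[R]_n -> R -> R).

Definition laplacian g : 'rV[R]_n -> R :=
  fun x => \sum_(k < n) 'D_(delta_mx 0 k) ('D_(delta_mx 0 k) g) x.

Fixpoint Ck (N : nat) g : Prop :=
  continuous g /\
  if N is N'.+1 then
    forall k : 'I_n, (forall x, derivable g x (delta_mx 0 k)) /\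
                     Ck N' ('D_(delta_mx 0 k) g)
  else True.

Definition smooth g : Prop := forall N, Ck N g.

(* Partial derivatives on R^n x R: [Some k] stands for the k-th space variable,
   [None] for the time variable. *)
Definition pderivable (o : option 'I_n) u (x : 'rV[R]_n) (t : R) : Prop :=
  if o is Some k then derivable (u ^~ t) x (delta_mx 0 k)
  else derivable (u x) t 1.

Definition pderiv (o : option 'I_n) u (x : 'rV[R]_n) (t : R) : R :=
  if o is Some k then 'D_(delta_mx 0 k) (u ^~ t) x else derive1 (u x) t.

(* The class C^N(R^n x [0, +oo[): u is continuous up to the boundary t = 0, and
   its partial derivatives of order at most N exist for t > 0 and extend
   continuously to t >= 0. Values u x t with t < 0 are irrelevant. *)
Fixpoint Ck_half (N : nat) u : Prop :=
  {within [set z : 'rV[R]_n * R | 0 <= z.2], continuous (fun z => u z.1 z.2)} /\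
  if N is N'.+1 then
    forall o : option 'I_n,
      (forall x t, 0 < t -> pderivable o u x t) /\
      exists2 v, (forall x t, 0 < t -> v x t = pderiv o u x t) & Ck_half N' v
  else True.

Definition smooth_half u : Prop := forall N, Ck_half N u.

End Calculus.

Section SurfaceIntegral.
Variable R : realType.

Fixpoint box_integral (d : nat) :
    'rV[R]_d -> 'rV[R]_d -> ('rV[R]_d -> R) -> R :=
  match d with
  | 0%N => fun _ _ F => F 0
  | d'.+1 => fun lo hi F =>
      \int[lebesgue_measure]_(s in `[lo 0 0, hi 0 0])
        box_integral (col' 0 lo) (col' 0 hi)
          (fun theta : 'rV[R]_d' => F (row_mx (const_mx s : 'rV[R]_1) theta))
  end.

(* Integral of g over the surface parametrised by psi on the box [lo, hi], with
   surface element dS = sqrt (det (D psi . (D psi)^T)) dtheta. With the library's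
   row-vector convention the rows of 'J psi theta are the partial derivatives of
   psi. *)
Definition surface_integral (d n : nat) (lo hi : 'rV[R]_d)
    (psi : 'rV[R]_d -> 'rV[R]_n) (g : 'rV[R]_n -> R) : R :=
  box_integral lo hi (fun theta =>
    g (psi theta) *
      Num.sqrt (\det ('J psi theta *m ('J psi theta)^T))).

(* Hyperspherical coordinates on the unit sphere of R^n, n >= 2:
   (cos t_0, sin t_0 cos t_1, ..., sin t_0 ... sin t_(n-3) cos t_(n-2),
    sin t_0 ... sin t_(n-2)),
   the last angle ranging over [0, 2 pi] and the other ones over [0, pi]. The
   second product has a single factor, or none for the last coordinate. *)
Definition hyperspherical (n : nat) (theta : 'rV[R]_n.-1) : 'rV[R]_n :=
  \row_(k < n) ((\prod_(i < n.-1 | (i < k)%N) sin (theta 0 i)) *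
                (\prod_(i < n.-1 | i == k :> nat) cos (theta 0 i))).

Definition angle_max (n : nat) : 'rV[R]_n.-1 :=
  \row_(i < n.-1) (if i.+1 == n.-1 then 2 * pi else pi).

Definition sphere_integral (n : nat) (x : 'rV[R]_n) (r : R)
    (g : 'rV[R]_n -> R) : R :=
  surface_integral 0 (angle_max n)
    (fun theta => x + r *: hyperspherical theta) g.

Definition sphere_mean (n nu : nat) (r : R) (g : 'rV[R]_n -> R)
    (x : 'rV[R]_n) : R :=
  (2 * (2 * pi) ^+ nu.+1 * r ^+ n.-1)^-1 * sphere_integral x r g.

Definition opJ (h : R -> R) : R -> R :=
  fun tau => \int[lebesgue_measure]_(s in `[0, tau]) (h s * s).

Definition J_mean (n nu : nat) (c : R) (g : 'rV[R]_n -> R) (x : 'rV[R]_n)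
    : R -> R :=
  iter nu opJ (fun s =>
    iter nu (fun (h : 'rV[R]_n -> R) y => c ^+ 2 * laplacian h y)
      (sphere_mean nu (c * s) g) x).

(* Convolution of h with s^(2m-3)/(2m-3)!, the inverse Laplace transform of
   s^-(2m-2); for m = 1 this is the Dirac mass at 0. *)
Definition conv_power (m : nat) (h : R -> R) (s : R) : R :=
  if m == 1%N then h s
  else \int[lebesgue_measure]_(tau in `[0, s])
         ((s - tau) ^+ (2 * m - 3) / ((2 * m - 3)`!)%:R * h tau).

End SurfaceIntegral.

Section InitialValueProblem.
Variables (R : realType) (m n : nat).

Definition coefA (a : 'I_m -> R) (j : 'I_m) : R :=
  a j ^+ (2 * m - 2) / \prod_(i < m | i != j) (a j ^+ 2 - a i ^+ 2).

Definition opP (b : nat -> R) (u : 'rV[R]_n -> R -> R) (x : 'rV[R]_n) (t : R)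
    : R :=
  \sum_(0 <= k < m.+1) b (2 * k)%N *
    iter (m - k) (@laplacian R n) (fun y => derive1n (2 * k) (u y) t) x.

(* Classical solutions. For u in C^(2m)(R^n x [0, +oo[) the initial values of the
   time derivatives are their one-sided limits at t = 0. *)
Definition ivp_solution (b : nat -> R) (f : 'rV[R]_n -> R -> R)
    (phi : nat -> 'rV[R]_n -> R) (u : 'rV[R]_n -> R -> R) : Prop :=
  [/\ Ck_half (2 * m) u,
      forall x t, 0 < t -> opP b u x t = f x t &
      forall r x, (r < 2 * m)%N ->
        derive1n r (u x) t @[t --> 0^'+] --> phi r x].

End InitialValueProblem.

(* Main.v *)
Require Import Defs.
From HB Require Import structures.
From mathcomp Require Import all_boot all_order all_algebra.
From mathcomp Require Import all_classical all_reals all_analysis.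
From mathcomp Require Import ring lra zify.
Set Implicit Arguments.
Unset Strict Implicit.
Unset Printing Implicit Defensive.
Import Order.TTheory GRing.Theory Num.Theory.
Import numFieldNormedType.Exports.
Local Open Scope classical_set_scope.
Local Open Scope ring_scope.

(** For c > 0 let W_c[g](x,t) be the solution of w_tt = c^2 Delta w with
    w = 0 and w_t = g at t = 0. Two facts about W_c carry the theorem.

    (1) In dimension n = 2 nu + 3 the operator J^nu[(c^2 Delta)^nu M_{c.}]
    computes W_c up to a polynomial in t. As a function of t the spherical mean
    S = M_{ct} g satisfies Darboux's equation
      t S''[g] + p S'[g] = t c^2 S[Delta g]   with p = n - 1,
    which is the divergence theorem on the sphere ([sphere_div],
    [darboux_mean]). If S satisfies it with some p and S[g](0) = rho g, then
    t S' + (p - 1) S satisfies it with p - 2 ([darboux_step]). The derivative of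
    this new operator is t c^2 S[Delta g], so that it equals
    J[c^2 S[Delta g]] + (p - 1) rho g: one application of J together with
    c^2 Delta lowers p by two, at the price of a multiple of g. After nu steps
    p = 2, and t times a solution with p = 2 solves the wave equation
    ([darboux_wave]); the constant in M_R is the one for which its initial
    velocity is g ([sphere_int_mass]). Adding up the multiples of g gives
    [J_meanE],
      tau J^nu[(c^2 Delta)^nu M_{c.} g](tau)
        = W_c[g](tau) - sum_{l < nu} c^{2l} tau^{2l+1} / (2l+1)! Delta^l g,
    and the second and fourth lines of the formula restore the polynomial that
    is subtracted here.

    (2) Let Y_q be the convolution with t^{q-1}/(q-1)!, that is, q integrations
    from 0, with Y_0 the identity. The operator
      G[g] = sum_j A_j Y_{2m-2} W_{a_j}[g]
    is the fundamental solution of P: P G[g] = 0 for t > 0, and at t = 0 the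
    time derivatives of G[g] of order below 2m - 1 vanish while the one of order
    2m - 1 is g ([green_op_annihilated], [green_op_at0]). Symbolically this is
    the partial fraction decomposition
      1 / prod_i (s^2 - a_i^2 Delta)
        = sum_j A_j s^{-(2m-2)} / (s^2 - a_j^2 Delta).
    The integrated wave Y_{2m-2} W_c[g] satisfies the wave equation up to a
    power of t times g that does not depend on c ([branch_recurrence]);
    Lagrange's identities sum_j A_j a_j^{-2p} = 0 for 0 < p < m cancel these
    defects ([lagrange_power_sum]), and each remaining term vanishes because
    a_j is a root of sum_k b_{2k} chi^{2k} ([char_root]).

    The solution is then the Duhamel integral of G[f(.,tau)](t - tau) plus
      sum_k b_{2k} sum_{r < 2k} (d/dt)^{2k-1-r} G[Delta^{m-k} phi_r],
    in which the term with k = m produces the initial values, while those with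
    k < m cancel what it contributes to time derivatives of higher order
    ([sol_pde], [cauchy_at0]). Substituting (1) into (2) turns it into the announced formula
    ([odd_dim_solution]).

    Differentiation under the integral sign, on intervals and on spheres alike,
    is reduced to one statement about linear functionals that are bounded by a
    supremum over a compact set ([bdd_functional_derive]). All operators
    that occur commute with spatial derivatives ([regular_op]), so that
    derivatives of the solution are solutions for differentiated data; thus
    regularity of every order follows from continuity and first derivatives. *)

(** * Derivatives under bounded functionals *)

Section Functionals.
Variable R : realType.

(** The closure rules for continuity and derivatives are stated for pointwise
    expressions (fun x => f x + g x), the form in which functions occur below, so
    that a derivative is computed by applying rules and adjusting the result with
    [drv_eq]. *)
Lemma cont_cst (T : topologicalType) (V : topologicalType) (c : V) :
  continuous (fun _ : T => c).
Proof. by move=> x; exact: cvg_cst. Qed.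

Lemma contD (T : topologicalType) (f g : T -> R) :
  continuous f -> continuous g -> continuous (fun x => f x + g x).
Proof. by move=> cf cg x; apply: cvgD; [exact: cf|exact: cg]. Qed.

Lemma contM (T : topologicalType) (f g : T -> R) :
  continuous f -> continuous g -> continuous (fun x => f x * g x).
Proof. by move=> cf cg x; apply: cvgM; [exact: cf|exact: cg]. Qed.

Lemma contN (T : topologicalType) (f : T -> R) :
  continuous f -> continuous (fun x => - f x).
Proof. by move=> cf x; apply: cvgN; exact: cf. Qed.

Lemma contX (T : topologicalType) (f : T -> R) n :
  continuous f -> continuous (fun x => f x ^+ n).
Proof.
move=> cf; elim: n => [|n IH]; first exact: cont_cst.
rewrite (_ : (fun _ => _) = (fun x => f x * f x ^+ n)); first exact: contM.
by apply/funext => x; rewrite exprS.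
Qed.

Lemma cont_sum (T : topologicalType) (I : Type) (r : seq I) (P : pred I)
    (f : I -> T -> R) :
  (forall i, P i -> continuous (f i)) ->
  continuous (fun x => \sum_(i <- r | P i) f i x).
Proof.
move=> cf; elim: r => [|i r IH].
  have -> : (fun x => \sum_(i <- [::] | P i) f i x) = (fun=> 0).
    by apply/funext => x; rewrite big_nil.
  exact: cont_cst.
have -> : (fun x => \sum_(i <- i :: r | P i) f i x) =
    (fun x => (if P i then f i x else 0) + \sum_(i <- r | P i) f i x).
  by apply/funext => x; rewrite big_cons; case: ifP => //; rewrite add0r.
by apply: contD => //; case: (P i) (cf i) => [cfi|_]; [exact: cfi|exact: cont_cst].
Qed.

Lemma cont_comp (S T U : topologicalType) (f : S -> T) (g : T -> U) :
  continuous g -> continuous f -> continuous (fun x => g (f x)).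
Proof. by move=> cg cf x; apply: continuous_comp; [exact: cf|exact: cg]. Qed.

Lemma cont_pair (S T U : topologicalType) (f : S -> T) (g : S -> U) :
  continuous f -> continuous g -> continuous (fun x => (f x, g x)).
Proof. by move=> cf cg x; apply: cvg_pair; [exact: cf|exact: cg]. Qed.

Lemma cont_fst (S T : topologicalType) : continuous (@fst S T).
Proof. by move=> x; exact: cvg_fst. Qed.

Lemma cont_snd (S T : topologicalType) : continuous (@snd S T).
Proof. by move=> x; exact: cvg_snd. Qed.

Lemma cont_comp2 (X S T U : topologicalType) (K : S -> T -> U) (f : X -> S)
    (g : X -> T) :
  continuous (fun p : S * T => K p.1 p.2) -> continuous f -> continuous g ->
  continuous (fun x => K (f x) (g x)).
Proof.
move=> cK cf cg; apply: (@cont_comp _ _ _ (fun x => (f x, g x))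
  (fun p : S * T => K p.1 p.2) cK); exact: cont_pair.
Qed.

Lemma cont_id (T : topologicalType) : continuous (fun x : T => x).
Proof. by move=> x; exact: cvg_id. Qed.

Section LambdaDerivatives.
Variables (V : normedModType R) (x v : V).
Implicit Types f g : V -> R.

Lemma drv_eq f d d' : is_derive x v f d -> d = d' -> is_derive x v f d'.
Proof. by move=> df <-. Qed.

Lemma drvD f g df dg : is_derive x v f df -> is_derive x v g dg ->
  is_derive x v (fun y => f y + g y) (df + dg).
Proof. by move=> hf hg; exact: is_deriveD. Qed.

Lemma drvM f g df dg : is_derive x v f df -> is_derive x v g dg ->
  is_derive x v (fun y => f y * g y) (df * g x + f x * dg).
Proof.
move=> hf hg; apply: (@drv_eq (fun y => f y * g y) _ _ (is_deriveM hf hg)).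
by rewrite /GRing.scale /= addrC; congr (_ + _); rewrite mulrC.
Qed.

Lemma drvc (c : R) : is_derive x v (fun=> c) 0.
Proof. exact: is_derive_cst. Qed.

Lemma drvN f df : is_derive x v f df -> is_derive x v (fun y => - f y) (- df).
Proof. by move=> hf; exact: is_deriveN. Qed.

Lemma drvB f g df dg : is_derive x v f df -> is_derive x v g dg ->
  is_derive x v (fun y => f y - g y) (df - dg).
Proof. by move=> hf hg; exact: is_deriveB. Qed.

Lemma drvZ (c : R) f df : is_derive x v f df ->
  is_derive x v (fun y => c * f y) (c * df).
Proof.
by move=> hf; apply: drv_eq (drvM (drvc c) hf) _; rewrite mul0r add0r.
Qed.

Lemma drv_sum (I : Type) (r : seq I) (P : pred I) (f : I -> V -> R)
    (df : I -> R) :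
  (forall i, P i -> is_derive x v (f i) (df i)) ->
  is_derive x v (fun y => \sum_(i <- r | P i) f i y) (\sum_(i <- r | P i) df i).
Proof.
move=> H; elim: r => [|i r IH].
  have -> : (fun y => \sum_(i <- [::] | P i) f i y) = (fun=> 0).
    by apply/funext => y; rewrite big_nil.
  by rewrite big_nil; exact: drvc.
have -> : (fun y => \sum_(i <- i :: r | P i) f i y) =
    (fun y => (if P i then f i y else 0) + \sum_(i <- r | P i) f i y).
  by apply/funext => y; rewrite big_cons; case: ifP => //; rewrite add0r.
have -> : \sum_(i <- i :: r | P i) df i =
    (if P i then df i else 0) + \sum_(i <- r | P i) df i.
  by rewrite big_cons; case: ifP => //; rewrite add0r.
by apply: drvD => //; case: (P i) (H i) => [h|_]; [exact: h|exact: drvc].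
Qed.

End LambdaDerivatives.

Lemma drvid (t : R) : is_derive t 1 (fun s : R => s) 1.
Proof. exact: is_derive_id. Qed.

Lemma drvX (t : R) (f : R -> R) n df : is_derive t 1 f df ->
  is_derive t 1 (fun s => f s ^+ n) (n%:R * f t ^+ n.-1 * df).
Proof.
move=> hf; elim: n => [|n IH]; first by rewrite !mul0r; exact: drvc.
have -> : (fun s => f s ^+ n.+1) = (fun s => f s * f s ^+ n).
  by apply/funext => s; rewrite exprS.
apply: (drv_eq (drvM hf IH)); case: n {IH} => [|n] /=; first by ring.
by rewrite -[n.+2%:R]natr1 exprS; ring.
Qed.

Lemma drv_comp (f g : R -> R) (t a b : R) :
  is_derive (g t) 1 f a -> is_derive t 1 g b ->
  is_derive t 1 (fun s => f (g s)) (a * b).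
Proof. by move=> hf hg; exact: is_derive1_comp. Qed.

(** The common features of integration over an interval, over a sphere and of
    their iterates. Boundedness by a supremum over a compact set K, instead of a
    supremum over the whole of U, allows U to be a vector space on which the
    integrands are unbounded. Linearity is asked for continuous functions only,
    since non-integrable functions have junk integrals. *)
Definition bdd_functional (U : topologicalType) (L : (U -> R) -> R) : Prop :=
  exists K : set U, exists C : R,
    [/\ compact K, 0 <= C,
        forall (F G : U -> R) (c : R), continuous F -> continuous G ->
          L (fun u => F u + c * G u) = L F + c * L G &
        forall (F : U -> R) (M : R), continuous F -> 0 <= M -> (forall u, K u -> `|F u| <= M) ->
          `|L F| <= C * M].

(** Tube lemma: joint continuity gives uniform closeness over a compact set. *)
Lemma compact_uniform (T U : topologicalType) (F : T -> U -> R) (K : set U)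
    (t : T) (e : R) :
  continuous (fun p : T * U => F p.1 p.2) -> compact K -> 0 < e ->
  \forall s \near t, forall u, K u -> `|F s u - F t u| < e.
Proof.
move=> cF cK e0.
have /compact_near_coveringP/(_ T (nbhs t)
  (fun s u => `|F s u - F t u| < e) _) := cK.
move=> /(_ _)/filterS; apply => [s Hs u Ku|u Ku]; first exact: Hs.
have e20 : 0 < e / 2 by rewrite divr_gt0.
have := cF (t, u) => /cvgrPdist_lt/(_ _ e20) [[A B] /= [nA nB] AB].
exists (B, A) => //= -[u' s] /= [Bu' As].
have tA : A t by apply: nbhs_singleton.
have /= h1 := AB (s, u') (conj As Bu').
have /= h2 := AB (t, u') (conj tA Bu').
rewrite (splitr e) -(subrKA (F t u)) (le_lt_trans (ler_normD _ _))//.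
by rewrite ltrD// distrC.
Qed.

Lemma cont_slice (T U V : topologicalType) (F : T -> U -> V) (t : T) :
  continuous (fun p : T * U => F p.1 p.2) -> continuous (F t).
Proof.
move=> cF u; apply: (@continuous_comp _ _ _ (fun u => (t, u))
  (fun p : T * U => F p.1 p.2)); last exact: cF.
by apply: cvg_pair; [exact: cvg_cst|exact: cvg_id].
Qed.

Lemma bdd_functional_cont (T U : topologicalType) (L : (U -> R) -> R) (F : T -> U -> R) :
  bdd_functional L -> continuous (fun p : T * U => F p.1 p.2) ->
  continuous (fun t => L (F t)).
Proof.
move=> [K [C [cK C0 lin bnd]]] cF t; apply/cvgrPdist_le => e e0.
have e1 : 0 < e / (C + 1) by rewrite divr_gt0// ltr_wpDl.
near=> s.
have -> : L (F t) - L (F s) = L (fun u => F t u + -1 * F s u).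
  by rewrite lin ?mulN1r//; exact: cont_slice.
apply: (le_trans (bnd _ (e / (C + 1)) _ (ltW e1) _)).
- by apply: contD; [|apply: contM; [exact: cont_cst|]]; exact: cont_slice.
- move=> u Ku; rewrite mulN1r distrC ltW//; move: u Ku; near: s.
  exact: compact_uniform.
- by rewrite mulrA ler_pdivrMr ?ltr_wpDl// mulrC ler_pM2l// lerDl.
Unshelve. all: by end_near. Qed.

(** The order of a and b is left open because increments of either sign occur
    in difference quotients. *)
Lemma MVT_unordered (f df : R -> R) (a b : R) :
  (forall x : R, is_derive x 1 f (df x)) ->
  exists2 c, `|c - a| <= `|b - a| & f b - f a = df c * (b - a).
Proof.
move=> H.
have cf x : {within x, continuous f}.
  apply: continuous_subspaceT => z; apply: differentiable_continuous.
  by apply/derivable1_diffP; case: (H z).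
have [ab|ba] := leP a b.
  have [c + ->] := @MVT_segment R f df a b ab (fun x _ => H x) (cf _).
  rewrite in_itv /= => /andP[ac cb]; exists c => //.
  by rewrite !ger0_norm ?subr_ge0// lerD2r.
have [c + e] := @MVT_segment R f df b a (ltW ba) (fun x _ => H x) (cf _).
rewrite in_itv /= => /andP[bc ca]; exists c; last by rewrite -[LHS]opprB e; ring.
by rewrite distrC (distrC b) !ger0_norm ?subr_ge0 ?lerD2l ?lerN2// ltW.
Qed.

Lemma is_derive1P (f : R -> R) (t d : R) :
  (forall e : R, 0 < e -> \forall h \near 0^', `|h^-1 * (f (t + h) - f t) - d| <= e)
  -> is_derive t 1 f d.
Proof.
move=> H.
have cv : (fun h => h^-1 *: ((f \o shift t) (h *: 1) - f t)) @ 0^' --> d.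
  apply/cvgrPdist_le => e /H; apply: filterS => h.
  by rewrite distrC /= -mulr_algl mulr1 /= scaler1 [h + t]addrC.
by split; [apply/cvg_ex; exists d|exact/cvg_lim].
Qed.

(** By the mean value theorem the difference quotient of F in t is the value of
    F' at an intermediate time, and by [compact_uniform] this is uniformly close to
    F' t on the compact set that controls L. *)
Lemma bdd_functional_derive (U : topologicalType) (L : (U -> R) -> R) (F F' : R -> U -> R)
    (t : R) :
  bdd_functional L -> (forall t, continuous (F t)) ->
  continuous (fun p : R * U => F' p.1 p.2) ->
  (forall (t : R) u, is_derive t 1 (F ^~ u) (F' t u)) ->
  is_derive t 1 (fun t => L (F t)) (L (F' t)).
Proof.
move=> [K [C [cK C0 lin bnd]]] cF cF' dF; apply: is_derive1P => e e0.
have e1 : 0 < e / (C + 1) by rewrite divr_gt0// ltr_wpDl.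
(* C + 1 instead of C avoids a case distinction on C = 0. *)
have := @compact_uniform _ _ F' K t _ cF' cK e1.
move=> -[r /= r0 Hr].
near=> h.
have -> : h^-1 * (L (F (t + h)) - L (F t)) - L (F' t) =
   L (fun u => 0 + h^-1 * ((F (t+h) u + -1 * F t u) + - h * F' t u)).
  have h0 : h != 0 by near: h; exact: nbhs_dnbhs_neq.
  rewrite lin; last 2 first.
  - exact: cont_cst.
  - apply: contD; last by apply: contM; [exact: cont_cst|exact: (@cont_slice _ _ _ F' t cF')].
    by apply: contD => //; apply: contM => //; exact: cont_cst.
  have -> : L (fun _ => 0) = 0.
    have : `|L (fun _ : U => 0)| <= C * 0.
      by apply: bnd => // [|u _]; [exact: cont_cst|rewrite normr0].
    by rewrite mulr0 normr_le0 => /eqP.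
  rewrite lin; last 2 first.
  - by apply: contD => //; apply: contM => //; exact: cont_cst.
  - exact: (@cont_slice _ _ _ F' t cF').
  by rewrite lin; [field|exact: cF|exact: cF].
apply: (le_trans (bnd _ (e / (C + 1)) _ (ltW e1) _)).
- apply: contD; first exact: cont_cst.
  apply: contM; first exact: cont_cst.
  apply: contD; last by apply: contM; [exact: cont_cst|exact: (@cont_slice _ _ _ F' t cF')].
  by apply: contD => //; apply: contM => //; exact: cont_cst.
- move=> u Ku; have h0 : h != 0 by near: h; exact: nbhs_dnbhs_neq.
  have [c hc eq] := @MVT_unordered (F ^~ u) (F' ^~ u) t (t + h) (fun x => dF x u).
  rewrite add0r mulN1r eq (_ : h^-1 * _ = F' c u - F' t u); last by field.
  apply/ltW/Hr => //=.
  rewrite distrC (le_lt_trans hc)// addrAC subrr add0r.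
  by near: h; exact: dnbhs0_lt.
- by rewrite mulrA ler_pdivrMr ?ltr_wpDl// mulrC ler_pM2l// lerDl.
Unshelve. all: by end_near. Qed.
End Functionals.

(** * Integrals over intervals *)

Section Integrals.
Variable R : realType.
Implicit Types (a b t : R) (F G w P : R -> R).

Definition itv_int a b F : R := \int[lebesgue_measure]_(s in `[a, b]) F s.

Lemma itv_int_integrable a b F : continuous F ->
  (@lebesgue_measure R).-integrable `[a, b] (EFin \o F).
Proof.
move=> cF; apply: continuous_compact_integrable; first exact: segment_compact.
exact: continuous_subspaceT.
Qed.

Lemma eq_itv_int a b F G : (forall x, a <= x <= b -> F x = G x) ->
  itv_int a b F = itv_int a b G.
Proof.
by move=> H; apply: eq_Rintegral => x; rewrite inE /= in_itv /= => /H.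
Qed.

Lemma itv_int_lin a b F G (c : R) : continuous F -> continuous G ->
  itv_int a b (fun x => F x + c * G x) = itv_int a b F + c * itv_int a b G.
Proof.
move=> cF cG; rewrite /itv_int RintegralD//=.
- by rewrite RintegralZl//; exact: itv_int_integrable.
- exact: itv_int_integrable.
- by apply: itv_int_integrable; apply: contM => //; exact: cont_cst.
Qed.

Lemma itv_int_cst a b (c : R) : a <= b -> itv_int a b (fun=> c) = c * (b - a).
Proof.
move=> ab; rewrite /itv_int Rintegral_cst//= lebesgue_measure_itv /= lte_fin.
by move: ab; rewrite le_eqVlt => /predU1P[->|->]; rewrite ?ltxx ?subrr.
Qed.

Lemma itv_int_empty a b F : b < a -> itv_int a b F = 0.
Proof.
by move=> ba; rewrite /itv_int set_itv_ge ?Rintegral_set0// bnd_simp -ltNge.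
Qed.

Lemma itv_int_norm_le a b F (M : R) : a <= b -> continuous F ->
  (forall x, a <= x <= b -> `|F x| <= M) -> `|itv_int a b F| <= (b - a) * M.
Proof.
move=> ab cF H.
apply: (le_trans (le_normr_Rintegral _ (itv_int_integrable _ _ cF))) => //.
rewrite mulrC -itv_int_cst//; apply: le_Rintegral => //.
- apply: itv_int_integrable; apply: cont_comp cF; exact: norm_continuous.
- by apply: itv_int_integrable; exact: cont_cst.
Qed.

Lemma itv_int_bounded a b : bdd_functional (itv_int a b).
Proof.
exists `[a, b]%classic, `|b - a|; split => //.
- exact: segment_compact.
- by move=> *; exact: itv_int_lin.
- move=> F M cF M0 H; have [ab|ba] := leP a b.
    rewrite [`|b - a|]ger0_norm ?subr_ge0//; exact: itv_int_norm_le.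
  by rewrite itv_int_empty// normr0 mulr_ge0.
Qed.

Lemma itv_int_FTC a b P w : a <= b -> continuous w ->
  (forall x, a <= x <= b -> is_derive x 1 P (w x)) -> itv_int a b w = P b - P a.
Proof.
rewrite le_eqVlt => /predU1P[->|ab] cw dP.
  by rewrite subrr /itv_int set_itv1 Rintegral_set1.
have cP x : a <= x <= b -> {for x, continuous P}.
  move=> /dP [d _]; apply: differentiable_continuous.
  exact/derivable1_diffP.
rewrite /itv_int /Rintegral (@continuous_FTC2 _ w P)//.
- exact: continuous_subspaceT.
- split.
  + by move=> x; rewrite in_itv /= => /andP[ax xb]; case: (dP x); rewrite ?(ltW ax) ?ltW.
  + by apply: cvg_at_right_filter; apply: cP; rewrite lexx ltW.
  + by apply: cvg_at_left_filter; apply: cP; rewrite lexx ltW.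
- move=> x; rewrite in_itv /= => /andP[ax xb].
  by rewrite derive1E; case: (dP x) => //; rewrite ?(ltW ax) ?ltW.
Qed.

Lemma antiderivative_itv_int a x w : continuous w -> a < x ->
  is_derive x 1 (fun y => itv_int a y w) (w x).
Proof.
move=> cw ax.
have [//||d e] := @continuous_FTC1_closed R w a x (x + 1) _ _ ax (cw x).
- by rewrite ltrDl.
- exact: itv_int_integrable.
split; first exact: d.
by rewrite -derive1E; exact: e.
Qed.

(** The oriented integral of w from 0 to t, rescaled to the fixed interval
    [0, 1]. It makes sense for t of either sign, so that functions of time are
    differentiable at t = 0 in the ordinary two-sided sense, and its joint
    continuity in t and in parameters is that of a bounded functional. *)
Definition or_int t w : R := itv_int 0 1 (fun s => t * w (t * s)).


Lemma drv_scale t s (P : R -> R) (d : R) : is_derive (t * s) 1 P d ->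
  is_derive s 1 (fun s => P (t * s)) (t * d).
Proof.
move=> dP; apply: drv_eq (drv_comp dP (drvZ t (drvid s))) _.
by rewrite mulr1 mulrC.
Qed.

Lemma or_int_FTC t (A : R) P w : continuous w -> `|t| < A ->
  (forall x : R, `|x| < A -> is_derive x 1 P (w x)) -> or_int t w = P t - P 0.
Proof.
move=> cw tA dP; rewrite /or_int.
have := @itv_int_FTC 0 1 (fun s => P (t * s)) (fun s => t * w (t * s)).
rewrite mulr1 mulr0; apply; first exact: ler01.
- apply: contM; first exact: cont_cst.
  apply: (cont_comp cw); apply: contM; first exact: cont_cst.
  by move=> x; exact: cvg_id.
- move=> s /andP[s0 s1]; apply: drv_scale; apply: dP.
  rewrite normrM (ger0_norm s0) (le_lt_trans _ tA)//.
  by rewrite ler_piMr.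
Qed.

Lemma or_intE t (A : R) w : continuous w -> `|t| < A ->
  or_int t w = itv_int (- A) t w - itv_int (- A) 0 w.
Proof.
move=> cw tA; apply: (@or_int_FTC t A (fun y => itv_int (- A) y w)) => // x; rewrite ltr_norml => /andP[Ax _].
exact: antiderivative_itv_int.
Qed.

Lemma or_int_derive t w : continuous w -> is_derive t 1 (fun y => or_int y w) (w t).
Proof.
(* Integrating from - A < t makes a one-sided fundamental theorem available in
   a full neighbourhood of t. *)
move=> cw; pose A := `|t| + 1.
have tA : - A < t by rewrite ltrNl /A (le_lt_trans (ler_norm _))// normrN ltrDl.
have H : is_derive t 1 (fun y => itv_int (- A) y w - itv_int (- A) 0 w) (w t).
  by apply: drv_eq (drvB (antiderivative_itv_int cw tA) (drvc _ _ _)) _; rewrite subr0.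
apply: near_eq_is_derive H; near=> y; symmetry; rewrite (@or_intE y A)//.
by rewrite /A -[y](subKr t) (le_lt_trans (ler_normB _ _))// ltrD2l.
Unshelve. all: by end_near. Qed.

Lemma or_int_at0 w : or_int 0 w = 0.
Proof.
rewrite /or_int (@eq_itv_int _ _ _ (fun=> 0)) ?itv_int_cst ?mul0r//.
by move=> x _; rewrite mul0r.
Qed.

Lemma or_int_itv_int t w : continuous w -> 0 <= t -> or_int t w = itv_int 0 t w.
Proof.
move=> cw t0; have := @itv_int_FTC 0 t (fun y => or_int y w) w t0 cw.
rewrite or_int_at0 subr0 => H; symmetry; apply: H => x _; exact: or_int_derive.
Qed.

(** The tool by which all identities between functions of time are proved below:
    both sides have the same derivative and the same value at 0. *)
Lemma eq_from_deriv (f g d : R -> R) :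
  (forall t : R, is_derive t 1 f (d t)) -> (forall t : R, is_derive t 1 g (d t)) ->
  f 0 = g 0 -> f = g.
Proof.
move=> df dg e0; apply/funext => t; apply/eqP; rewrite -subr_eq0; apply/eqP.
have [c _] := @MVT_unordered R (fun x => f x - g x) (fun x => d x - d x) 0 t
  (fun x => drvB (df x) (dg x)).
by rewrite subrr mul0r e0 subrr subr0.
Qed.

Lemma or_int_lin t F G (c : R) : continuous F -> continuous G ->
  or_int t (fun s => F s + c * G s) = or_int t F + c * or_int t G.
Proof.
move=> cF cG; rewrite /or_int -itv_int_lin.
- by apply: eq_itv_int => s _; ring.
- apply: contM; first exact: cont_cst.
  apply: (cont_comp cF); apply: contM; first exact: cont_cst.
  by move=> x; exact: cvg_id.
- apply: contM; first exact: cont_cst.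
  apply: (cont_comp cG); apply: contM; first exact: cont_cst.
  by move=> x; exact: cvg_id.
Qed.

Lemma or_int_cont (T : topologicalType) (K : T -> R -> R) (y : T -> R) :
  continuous (fun p : T * R => K p.1 p.2) -> continuous y ->
  continuous (fun p : T => or_int (y p) (K p)).
Proof.
move=> cK cy; rewrite /or_int.
apply: (bdd_functional_cont (F := fun p s => y p * K p (y p * s)) (@itv_int_bounded 0 1)).
apply: contM; first by apply: (cont_comp cy); exact: cont_fst.
apply: (cont_comp2 cK); first exact: cont_fst.
apply: contM; last exact: cont_snd.
by apply: (cont_comp cy); exact: cont_fst.
Qed.

Lemma or_int_param_derive t y (K K' : R -> R -> R) :
  (forall t, continuous (K t)) -> continuous (fun p : R * R => K' p.1 p.2) ->
  (forall t s : R, is_derive t 1 (K ^~ s) (K' t s)) ->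
  is_derive t 1 (fun t => or_int y (K t)) (or_int y (K' t)).
Proof.
move=> cK cK' dK; rewrite /or_int.
refine (@bdd_functional_derive R R (itv_int 0 1) (fun p s => y * K p (y * s))
  (fun p s => y * K' p (y * s)) t (@itv_int_bounded 0 1) _ _ _).
- move=> s; apply: contM; first exact: cont_cst.
  apply: (cont_comp (cK _)); apply: contM; first exact: cont_cst.
  by move=> x; exact: cvg_id.
- apply: contM; first exact: cont_cst.
  apply: (cont_comp2 cK'); first exact: cont_fst.
  by apply: contM; [exact: cont_cst|exact: cont_snd].
Qed.
End Integrals.

(** * Directional derivatives *)

Section Directional.
Variables (R : realType) (V : normedModType R).
Implicit Types (x y v w : V) (g p q : V -> R).

Lemma contVD (T : topologicalType) (f g : T -> V) :
  continuous f -> continuous g -> continuous (fun s => f s + g s).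
Proof. by move=> cf cg s; apply: cvgD; [exact: cf|exact: cg]. Qed.

Lemma contVZ (T : topologicalType) (f : T -> R) (g : T -> V) :
  continuous f -> continuous g -> continuous (fun s => f s *: g s).
Proof. by move=> cf cg s; apply: cvgZ; [exact: cf|exact: cg]. Qed.

Lemma is_deriveP g x v (d : R) :
  (forall e : R, 0 < e ->
    \forall h \near 0^', `|h^-1 * (g (x + h *: v) - g x) - d| <= e) ->
  is_derive x v g d.
Proof.
move=> H.
have cv : (fun h => h^-1 *: ((g \o shift x) (h *: v) - g x)) @ 0^' --> d.
  apply/cvgrPdist_le => e /H; apply: filterS => h.
  by rewrite distrC /= [h *: v + x]addrC.
by split; [apply/cvg_ex; exists d|exact/cvg_lim].
Qed.

Lemma drv_line g x v (s d : R) :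
  is_derive (x + s *: v) v g d <-> is_derive s 1 (fun s : R => g (x + s *: v)) d.
Proof.
have e : (fun h : R => h^-1 *: ((g \o shift (x + s *: v)) (h *: v) - g (x + s *: v)))
  = (fun h => h^-1 *: (((fun s => g (x + s *: v)) \o shift s) (h *: 1) - g (x + s *: v))).
  apply/funext => h /=; congr (_ *: (g _ - _)).
  by rewrite scaler1 scalerDl addrCA.
have e1 : derivable g (x + s *: v) v = derivable (fun s : R => g (x + s *: v)) s 1.
  by rewrite /derivable e.
have e2 : 'D_v g (x + s *: v) = 'D_1 (fun s : R => g (x + s *: v)) s.
  by rewrite /derive e.
split=> -[d1 d2]; split.
- by rewrite -e1.
- by rewrite -e2.
- by rewrite e1.
- by rewrite e2.
Qed.

Lemma drv_line0 g x v (d : R) :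
  is_derive (0 : R) 1 (fun s : R => g (x + s *: v)) d -> is_derive x v g d.
Proof. by move=> /(@drv_line g x v 0 d).2; rewrite scale0r addr0. Qed.

Lemma drv_lineE g p v x (s : R) : (forall y, is_derive y v g (p y)) ->
  is_derive s 1 (fun s : R => g (x + s *: v)) (p (x + s *: v)).
Proof. by move=> H; apply/drv_line; exact: H. Qed.

(** Directional derivatives are additive in the direction once they are
    continuous; this replaces the passage through total differentiability. The
    increment along v + w is split into an increment along v followed by one along
    w, and the mean value theorem is applied to each. *)
Lemma drv_dirsum g p q v w x :
  (forall y, is_derive y v g (p y)) -> (forall y, is_derive y w g (q y)) ->
  continuous p -> continuous q -> is_derive x (v + w) g (p x + q x).
Proof.
move=> dp dq cp cq; apply: is_deriveP => e e0.
have e2 : 0 < e / 2 by rewrite divr_gt0.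
pose pp (z : R * R) := p (x + z.1 *: v).
pose qq (z : R * R) := q (x + z.1 *: v + z.2 *: w).
have cpp : continuous pp.
  apply: (cont_comp cp); apply: contVD; first exact: cont_cst.
  by apply: contVZ; [exact: cont_fst|exact: cont_cst].
have cqq : continuous qq.
  apply: (cont_comp cq); apply: contVD.
    by apply: contVD; [exact: cont_cst|apply: contVZ; [exact: cont_fst|exact: cont_cst]].
  by apply: contVZ; [exact: cont_snd|exact: cont_cst].
have /cvgrPdist_lt/(_ _ e2) := cpp (0, 0).
have /cvgrPdist_lt/(_ _ e2) := cqq (0, 0).
move=> /= [[A B] /= [/nbhs_ballP[r /= r0 rA] /nbhs_ballP[r' /= r'0 rB]] AB].
move=> /= [[C D] /= [/nbhs_ballP[s /= s0 sC] /nbhs_ballP[s' /= s'0 sD]] CD].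
near=> h.
have h0 : h != 0 by near: h; exact: nbhs_dnbhs_neq.
have hr : `|h| < r by near: h; exact: dnbhs0_lt.
have hr' : `|h| < r' by near: h; exact: dnbhs0_lt.
have hs : `|h| < s by near: h; exact: dnbhs0_lt.
(* c and c' are the intermediate points on the two legs from x to
   x + h v and from there to x + h v + h w. *)
have [c hc ec] := @MVT_unordered R _ _ 0 h (fun t => drv_lineE x t dp).
have [c' hc' ec'] := @MVT_unordered R _ _ 0 h (fun t => drv_lineE (x + h *: v) t dq).
move: ec ec' hc hc'; rewrite !scale0r !addr0 !subr0 => ec ec' hc hc'.
rewrite scalerDr addrA.
have -> : h^-1 * (g (x + h *: v + h *: w) - g x) - (p x + q x)
  = (q (x + h *: v + c' *: w) - q x) + (p (x + c *: v) - p x).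
  have -> : g (x + h *: v + h *: w) - g x =
    q (x + h *: v + c' *: w) * h + p (x + c *: v) * h by rewrite -ec -ec'; ring.
  by field.
rewrite (le_trans (ler_normD _ _))// (splitr e) lerD//.
  have := AB (h, c'); rewrite /qq /= !scale0r !addr0 => H.
  rewrite distrC ltW// H//; split; [apply: rA|apply: rB]; rewrite /ball /= sub0r normrN//.
  exact: le_lt_trans hr'.
have := CD (c, 0); rewrite /pp /= !scale0r !addr0 => H.
rewrite distrC ltW// H//; split; last by apply: sD; exact: ballxx.
by apply: sC; rewrite /ball /= sub0r normrN; exact: le_lt_trans hs.
Unshelve. all: by end_near. Qed.

End Directional.

Section Leibniz.
Variable R : realType.

(** The derivative along the diagonal of (u, t) |-> or_int t (K u), by additivity
    in the direction. *)
Lemma or_int_leibniz (t : R) (K K' : R -> R -> R) :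
  continuous (fun p : R * R => K p.1 p.2) ->
  continuous (fun p : R * R => K' p.1 p.2) ->
  (forall t s : R, is_derive t 1 (K ^~ s) (K' t s)) ->
  is_derive t 1 (fun t => or_int t (K t)) (K t t + or_int t (K' t)).
Proof.
move=> cK cK' dK.
have sK u : continuous (K u) by exact: (@cont_slice _ _ _ K u cK).
pose H (z : R * R) := or_int z.2 (K z.1).
have pe1 (a b s : R) : (a, b) + s *: (1, 0) = (a + s, b) :> R * R.
  by apply/eqP; rewrite xpair_eqE /= [s *: (1 : R)]mulr1 [s *: (0 : R)]mulr0 addr0 !eqxx.
have pe2 (a b s : R) : (a, b) + s *: (0, 1) = (a, b + s) :> R * R.
  by apply/eqP; rewrite xpair_eqE /= [s *: (1 : R)]mulr1 [s *: (0 : R)]mulr0 addr0 !eqxx.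
have d1 (z : R * R) : is_derive z (1, 0) H (or_int z.2 (K' z.1)).
  case: z => a b; have -> : (a, b) = (0, b) + a *: (1, 0) by rewrite pe1 add0r.
  apply/drv_line; rewrite pe1 add0r /=.
  have -> : (fun s : R => H ((0, b) + s *: (1, 0))) = (fun s => or_int b (K s)).
    by apply/funext => s; rewrite pe1 /H /= add0r.
  exact: or_int_param_derive.
have d2 (z : R * R) : is_derive z (0, 1) H (K z.1 z.2).
  case: z => a b; have -> : (a, b) = (a, 0) + b *: (0, 1) by rewrite pe2 add0r.
  apply/drv_line; rewrite pe2 add0r /=.
  have -> : (fun s : R => H ((a, 0) + s *: (0, 1))) = (fun s => or_int s (K a)).
    by apply/funext => s; rewrite pe2 /H /= add0r.
  exact: or_int_derive.
have cH1 : continuous (fun z : R * R => or_int z.2 (K' z.1)).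
  apply: or_int_cont; last exact: cont_snd.
  apply: (cont_comp2 cK'); last exact: cont_snd.
  by apply: (cont_comp (@cont_fst _ _)); exact: cont_fst.
have e11 : (0, 1) + (1, 0) = (1, 1) :> R * R.
  by apply/eqP; rewrite xpair_eqE /= add0r addr0 !eqxx.
have ett (s : R) : 0 + s *: (1, 1) = (s, s) :> R * R.
  by rewrite add0r; apply/eqP; rewrite xpair_eqE /= [s *: _]mulr1 !eqxx.
have := @drv_dirsum R _ H _ _ (0, 1) (1, 0) (0 + t *: (1, 1)) d2 d1 cK cH1.
rewrite e11 => /drv_line; rewrite ett /=.
rewrite [X in is_derive _ _ X _ -> _](_ : _ = fun t => or_int t (K t))//.
by apply/funext => s; rewrite ett.
Qed.
End Leibniz.

(** * Smooth functions and smooth families *)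

Section XSmooth.
Variables (R : realType) (n : nat).
Implicit Types (g h : 'rV[R]_n -> R) (F : R -> 'rV[R]_n -> R) (k l : 'I_n).

Definition partial k g : 'rV[R]_n -> R := 'D_(delta_mx 0 k) g.

Definition iter_partial (s : seq 'I_n) g := foldr partial g s.

(** Only derivatives in x are taken; the dependence on tau is merely continuous,
    jointly with x and for every x-derivative. This is what Duhamel's integral
    needs from f(., tau), and it survives the continuation to tau < 0. *)
Definition smooth_family F := forall s,
  continuous (fun p : R * 'rV[R]_n => iter_partial s (F p.1) p.2) /\
  forall k tau x, derivable (iter_partial s (F tau)) x (delta_mx 0 k).

Definition smooth_fun g := smooth_family (fun _ => g).

Lemma iter_partial_rcons s k g : iter_partial s (partial k g) = iter_partial (rcons s k) g.
Proof. by rewrite /iter_partial foldr_rcons. Qed.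

Lemma smooth_family_partial F k : smooth_family F -> smooth_family (fun tau => partial k (F tau)).
Proof.
move=> H s; have [c d] := H (rcons s k); split.
  have -> : (fun p : R * 'rV[R]_n => iter_partial s (partial k (F p.1)) p.2) =
    (fun p => iter_partial (rcons s k) (F p.1) p.2) by apply/funext => p; rewrite iter_partial_rcons.
  exact: c.
by move=> l tau x; rewrite iter_partial_rcons; exact: d.
Qed.

Lemma smooth_family_cont F : smooth_family F -> continuous (fun p : R * 'rV[R]_n => F p.1 p.2).
Proof. by move=> /(_ [::]) []. Qed.

Lemma smooth_family_drv F k tau x : smooth_family F ->
  is_derive x (delta_mx 0 k) (F tau) (partial k (F tau) x).
Proof. by move=> /(_ [::]) [_ /(_ k tau x)] /derivableP. Qed.

(** Coinduction: smoothness holds on any class of continuous, differentiable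
    families that is closed under partial derivatives. *)
Lemma smooth_family_coind (P : (R -> 'rV[R]_n -> R) -> Prop) :
  (forall F, P F -> [/\ continuous (fun p : R * 'rV[R]_n => F p.1 p.2),
     (forall k tau x, derivable (F tau) x (delta_mx 0 k)) &
     forall k, P (fun tau => partial k (F tau))]) ->
  forall F, P F -> smooth_family F.
Proof.
move=> HP F PF s; elim/last_ind: s F PF => [|s k IH] F /HP[c d PF].
  by split.
have [c1 d1] := IH _ (PF k); split.
  have -> : (fun p : R * 'rV[R]_n => iter_partial (rcons s k) (F p.1) p.2) =
    (fun p => iter_partial s (partial k (F p.1)) p.2) by apply/funext => p; rewrite iter_partial_rcons.
  exact: c1.
by move=> l tau x; rewrite -iter_partial_rcons; exact: d1.
Qed.

Lemma smooth_family_slice F tau : smooth_family F -> smooth_fun (F tau).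
Proof.
move=> H s; have [c d] := H s; split => [|k _ x]; last exact: d.
apply: (cont_comp2 (K := fun t => iter_partial s (F t)) c); first exact: cont_cst.
exact: cont_snd.
Qed.

Lemma smooth_drv g k x : smooth_fun g -> is_derive x (delta_mx 0 k) g (partial k g x).
Proof. by move=> H; exact: (smooth_family_drv k 0 x H). Qed.

Lemma smooth_partial g k : smooth_fun g -> smooth_fun (partial k g).
Proof. exact: smooth_family_partial. Qed.

Lemma smooth_cont g : smooth_fun g -> continuous g.
Proof.
move=> /smooth_family_cont c; apply: (@cont_slice R _ _ (fun _ => g) 0); exact: c.
Qed.

Lemma partialE k g (d : 'rV[R]_n -> R) :
  (forall x, is_derive x (delta_mx 0 k) g (d x)) -> partial k g = d.
Proof. by move=> H; apply/funext => x; rewrite /partial; case: (H x). Qed.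

Lemma partial_lin k g h (c : R) : smooth_fun g -> smooth_fun h ->
  partial k (fun x => g x + c * h x) = (fun x => partial k g x + c * partial k h x).
Proof.
by move=> sg sh; apply: partialE => x; apply: drvD; [|apply: drvZ]; exact: smooth_drv.
Qed.

Lemma smooth_family_lin F G (c : R) : smooth_family F -> smooth_family G ->
  smooth_family (fun tau x => F tau x + c * G tau x).
Proof.
move=> sF sG; apply: (@smooth_family_coind (fun H => exists F G, [/\ smooth_family F, smooth_family G &
  H = fun tau x => F tau x + c * G tau x])); last by exists F, G.
move=> _ [F1 [G1 [sF1 sG1 ->]]]; split.
- apply: contD; first exact: smooth_family_cont.
  by apply: contM; [exact: cont_cst|exact: smooth_family_cont].
- move=> k tau x.
  by have [] := drvD (smooth_family_drv k tau x sF1) (drvZ c (smooth_family_drv k tau x sG1)).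
- move=> k; exists (fun tau => partial k (F1 tau)), (fun tau => partial k (G1 tau)).
  split; [exact: smooth_family_partial|exact: smooth_family_partial|].
  by apply/funext => tau; exact: (partial_lin k c (smooth_family_slice tau sF1) (smooth_family_slice tau sG1)).
Qed.

Lemma smooth_family0 : smooth_family (fun _ _ => 0).
Proof.
apply: (@smooth_family_coind (fun H => H = fun _ _ => 0)) => // _ ->; split.
- exact: cont_cst.
- by move=> k tau x; have [] := drvc x (delta_mx 0 k) (0 : R).
- by move=> k; apply/funext => tau; apply: partialE => x; exact: drvc.
Qed.

Lemma smooth_family_sum (I : Type) (r : seq I) (F : I -> R -> 'rV[R]_n -> R) :
  (forall i, smooth_family (F i)) -> smooth_family (fun tau x => \sum_(i <- r) F i tau x).
Proof.
move=> H; elim: r => [|i r IH].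
  have -> : (fun tau x => \sum_(i <- [::]) F i tau x) = (fun _ _ => 0).
    by apply/funext => tau; apply/funext => x; rewrite big_nil.
  exact: smooth_family0.
have -> : (fun tau x => \sum_(i <- i :: r) F i tau x) =
   (fun tau x => F i tau x + 1 * \sum_(i <- r) F i tau x).
  by apply/funext => tau; apply/funext => x; rewrite big_cons mul1r.
exact: (smooth_family_lin 1 (H i) IH).
Qed.

(** The direction v is built up one coordinate at a time with [drv_dirsum]. *)
Lemma drv_along g v x : smooth_fun g ->
  is_derive x v g (\sum_k v 0 k * partial k g x).
Proof.
move=> sg.
have dZ k (c : R) y : is_derive y (c *: delta_mx 0 k) g (c * partial k g y).
  have H : is_derive (0 : R) 1 (fun s => g (y + s *: (c *: delta_mx 0 k)))
      (c * partial k g y).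
    have -> : (fun s : R => g (y + s *: (c *: delta_mx 0 k))) =
      (fun s => g (y + (c * s) *: delta_mx 0 k)).
      by apply/funext => s; rewrite scalerA mulrC.
    apply: (@drv_scale R c 0 (fun u => g (y + u *: delta_mx 0 k))).
    rewrite mulr0; have := drv_lineE y 0 (fun z => smooth_drv k z sg).
    by rewrite scale0r addr0.
  by move/drv_line : H; rewrite scale0r addr0.
rewrite {1}[v]row_sum_delta.
suff H (r : seq 'I_n) y : is_derive y (\sum_(k <- r) v 0 k *: delta_mx 0 k) g
    (\sum_(k <- r) v 0 k * partial k g y) by exact: H.
elim: r y => [|k r IH] y; first by rewrite !big_nil; exact: is_derive0.
rewrite !big_cons; apply: (drv_dirsum (p := fun y => v 0 k * partial k g y)
  (q := fun y => \sum_(k <- r) v 0 k * partial k g y)) => //.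
  by apply: contM; [exact: cont_cst|apply: smooth_cont; exact: smooth_partial].
apply: cont_sum => j _.
by apply: contM; [exact: cont_cst|apply: smooth_cont; exact: smooth_partial].
Qed.

Lemma cont_row (T : topologicalType) (f : T -> 'rV[R]_n) :
  (forall k, continuous (fun x => f x 0 k)) -> continuous f.
Proof.
move=> H x A [P nP sPA].
have : \forall y \near x, forall k, P 0 k (f y 0 k).
  by apply: filter_forall => k; exact: (H k x _ (nP 0 k)).
by apply: filterS => y Hy; apply: sPA => i j; rewrite ord1.
Qed.

Lemma cont_coord (T : topologicalType) (f : T -> 'rV[R]_n) k :
  continuous f -> continuous (fun x => f x 0 k).
Proof.
move=> cf; apply: (@cont_comp _ _ _ f (fun v : 'rV[R]_n => v 0 k) _ cf).
exact: coord_continuous.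
Qed.

(** Schwarz's theorem: g(x + t e_k + b e_l) - g(x + t e_k) is the integral of
    the l-th partial derivative over the segment of length b; differentiating
    first in t under the integral sign and then in b by the fundamental theorem
    gives both orders. *)
Lemma partialC g k l : smooth_fun g -> partial k (partial l g) = partial l (partial k g).
Proof.
move=> sg; apply/funext => x.
set ek : 'rV[R]_n := delta_mx 0 k; set el : 'rV[R]_n := delta_mx 0 l.
pose K (t s : R) := partial l g (x + t *: ek + s *: el).
pose K' (t s : R) := partial k (partial l g) (x + t *: ek + s *: el).
have cpt : continuous (fun p : R * R => x + p.1 *: ek + p.2 *: el).
  apply: contVD; last by apply: contVZ; [exact: cont_snd|exact: cont_cst].
  by apply: contVD; [exact: cont_cst|apply: contVZ; [exact: cont_fst|exact: cont_cst]].
have cK : continuous (fun p : R * R => K p.1 p.2).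
  exact: (cont_comp (smooth_cont (smooth_partial l sg)) cpt).
have cK' : continuous (fun p : R * R => K' p.1 p.2).
  exact: (cont_comp (smooth_cont (smooth_partial k (smooth_partial l sg))) cpt).
have dK (t s : R) : is_derive t 1 (K ^~ s) (K' t s).
  rewrite /K' addrAC; have -> : K ^~ s = fun t => partial l g ((x + s *: el) + t *: ek).
    by apply/funext => u; rewrite /K addrAC.
  by apply: drv_lineE => y; apply: smooth_drv; exact: smooth_partial.
(* First integral: along e_l, by the fundamental theorem. *)
have E t b : or_int b (K t) = g (x + t *: ek + b *: el) - g (x + t *: ek).
  have -> : g (x + t *: ek) = g (x + t *: ek + 0 *: el) by rewrite scale0r addr0.
  apply: (@or_int_FTC _ b (`|b| + 1) (fun b => g (x + t *: ek + b *: el))).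
  - exact: (@cont_slice _ _ _ K t cK).
  - by rewrite ltrDl.
  - by move=> y _; apply: drv_lineE => z; exact: smooth_drv.
(* Differentiation in t at t = 0, under the integral sign and directly. *)
have E' b : or_int b (K' 0) = partial k g (x + b *: el) - partial k g x.
  have H1 : is_derive (0:R) 1 (fun t => or_int b (K t)) (or_int b (K' 0)).
    by apply: or_int_param_derive => // t; exact: (@cont_slice _ _ _ K t cK).
  have H2 : is_derive (0:R) 1 (fun t => or_int b (K t))
      (partial k g (x + b *: el) - partial k g x).
    have -> : (fun t => or_int b (K t)) =
      (fun t => g ((x + b *: el) + t *: ek) - g (x + t *: ek)).
      by apply/funext => t; rewrite E addrAC.
    have dg y := smooth_drv k y sg.
    have := drvB (drv_lineE (x + b *: el) 0 dg) (drv_lineE x 0 dg).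
    by rewrite scale0r !addr0.
  by case: H1 => _ <-; case: H2.
have H1 : is_derive (0:R) 1 (fun b => or_int b (K' 0)) (partial k (partial l g) x).
  have -> : partial k (partial l g) x = K' 0 0 by rewrite /K' !scale0r !addr0.
  by apply: or_int_derive; exact: (@cont_slice _ _ _ K' 0 cK').
have H2 : is_derive (0:R) 1 (fun b => or_int b (K' 0)) (partial l (partial k g) x).
  have -> : (fun b => or_int b (K' 0)) = (fun b => partial k g (x + b *: el) - partial k g x).
    by apply/funext => b; rewrite E'.
  have dg y := smooth_drv l y (smooth_partial k sg).
  have := drvB (drv_lineE x 0 dg) (drvc _ _ (partial k g x)).
  by rewrite scale0r addr0 subr0.
by case: H1 => _ <-; case: H2.
Qed.

Lemma laplacianE g x : laplacian g x = \sum_k partial k (partial k g) x.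
Proof. by []. Qed.

Lemma smooth_family_lap F : smooth_family F -> smooth_family (fun tau => laplacian (F tau)).
Proof. by move=> sF; apply: smooth_family_sum => k; do 2 apply: smooth_family_partial. Qed.

Lemma smooth_fun_lap g : smooth_fun g -> smooth_fun (laplacian g).
Proof. exact: smooth_family_lap. Qed.

Lemma partial_lap g k : smooth_fun g -> partial k (laplacian g) = laplacian (partial k g).
Proof.
move=> sg; apply: partialE => x.
have -> : laplacian (partial k g) x = \sum_l partial k (partial l (partial l g)) x.
  rewrite laplacianE; apply: eq_bigr => l _.
  by rewrite (partialC k l (smooth_partial l sg)) (partialC k l sg).
apply: drv_sum => l _; apply: smooth_drv; by do 2 apply: smooth_partial.
Qed.

Lemma smooth_fun_iter_lap q g : smooth_fun g -> smooth_fun (iter q (@laplacian R n) g).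
Proof. by move=> sg; elim: q => [|q IH]; [exact: sg|exact: smooth_fun_lap IH]. Qed.

Lemma smooth_family_iter_lap q F : smooth_family F ->
  smooth_family (fun tau => iter q (@laplacian R n) (F tau)).
Proof. by move=> sg; elim: q => [|q IH]; [exact: sg|exact: smooth_family_lap IH]. Qed.

Lemma partial_iter_lap q g k : smooth_fun g ->
  partial k (iter q (@laplacian R n) g) = iter q (@laplacian R n) (partial k g).
Proof.
move=> sg; elim: q => [//|q IH]; rewrite 2!iterS -IH.
exact: (partial_lap k (smooth_fun_iter_lap q sg)).
Qed.

End XSmooth.

(** * Chain rule along curves and data on the half space *)

Section HalfSpace.
Variables (R : realType) (n : nat).
Implicit Types (g h : 'rV[R]_n -> R) (u v : 'rV[R]_n -> R -> R).

Lemma is_derive_cvg (V W : normedModType R) (f : V -> W) (x v : V) (d : W) :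
  is_derive x v f d ->
  (fun h : R => h^-1 *: (f (x + h *: v) - f x)) @ 0^' --> d.
Proof.
move=> [df <-].
have : (fun h : R => h^-1 *: ((f \o shift x) (h *: v) - f x)) @ 0^' --> 'D_v f x.
  by exact: df.
have -> : (fun h : R => h^-1 *: ((f \o shift x) (h *: v) - f x)) =
  (fun h : R => h^-1 *: (f (x + h *: v) - f x)) by apply/funext => s /=; rewrite [s *: v + x]addrC.
by [].
Qed.

(** The curve need only be differentiable: the increment of g between c t and
    c (t + h) is, by the mean value theorem on the chord, a value of the jointly
    continuous function (v, z) |-> sum_k v_k (partial k g)(c t + z). *)
Lemma drv_curve g (c : R -> 'rV[R]_n) (c' : 'rV[R]_n) (t : R) : smooth_fun g ->
  (forall k, is_derive t 1 (fun s => c s 0 k) (c' 0 k)) ->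
  is_derive t 1 (fun s => g (c s)) (\sum_k c' 0 k * partial k g (c t)).
Proof.
move=> sg dc.
have dcv : is_derive t 1 c c'.
  have dd : derivable c t 1.
    by apply/derivable_mxP => i j; rewrite ord1; case: (dc j).
  split => //; rewrite derive_mx//; apply/rowP => j; rewrite mxE.
  by case: (dc j).
have cc : {for t, continuous c}.
  by apply: differentiable_continuous; apply/derivable1_diffP; case: dcv.
pose Psi (p : 'rV[R]_n * 'rV[R]_n) := \sum_k p.1 0 k * partial k g (c t + p.2).
have cPsi : continuous Psi.
  apply: cont_sum => k _; apply: contM; first by apply: cont_coord; exact: cont_fst.
  have cp : continuous (partial k g) by apply: smooth_cont; exact: smooth_partial.
  by apply: (cont_comp cp); apply: contVD; [exact: cont_cst|exact: cont_snd].
apply: is_derive1P => e e0.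
have /cvgrPdist_lt/(_ _ e0) := cPsi (c', 0).
move=> /= [[A B] /= [nA /nbhs_ballP[r /= r0 rB]] AB].
have nA' : \forall s \near (0 : R)^', A (s^-1 *: (c (t + s) - c t)).
  have H : (0 : R)^' (fun s => A (s^-1 *: (c (t + s *: 1) - c t))) :=
    is_derive_cvg dcv nA.
  by apply: filterS H => s; rewrite [s *: 1]mulr1.
have /cvgrPdist_lt/(_ _ r0)/nbhs_ballP[d /= d0 cd] := cc.
near=> h.
have h0 : h != 0 by near: h; exact: nbhs_dnbhs_neq.
have Ah : A (h^-1 *: (c (t + h) - c t)).
  by near: h.
have hr : `|c (t + h) - c t| < r.
  rewrite distrC; apply: cd; rewrite /ball /= opprD addNKr normrN.
  by near: h; exact: dnbhs0_lt.
have [s hs es] := @MVT_unordered R _ _ 0 1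
  (fun s => drv_lineE (c t) s (fun y => drv_along (c (t + h) - c t) y sg)).
move: es hs; rewrite scale0r scale1r addr0 !subr0 mulr1 normr1 [c t + (c (t + h) - c t)]addrC subrK => es hs.
rewrite es mulr_sumr ltW// distrC.
have := AB (h^-1 *: (c (t + h) - c t), s *: (c (t + h) - c t)).
rewrite /Psi /= addr0 => H.
rewrite [X in `|_ - X|](_ : _ = \sum_k (h^-1 *: (c (t + h) - c t)) 0 k *
    partial k g (c t + s *: (c (t + h) - c t))); last first.
  by apply: eq_bigr => k _; rewrite !mxE mulrA.
apply: H; split => //; apply: rB.
rewrite -ball_normE /ball_ /= sub0r normrN normrZ (le_lt_trans _ hr)//.
by rewrite ler_piMl.
Unshelve. all: by end_near. Qed.

Lemma smooth_smooth_fun g : smooth g -> smooth_fun g.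
Proof.
move=> sg; apply: (@smooth_family_coind _ _ (fun F => exists2 g, smooth g & F = fun _ => g));
  last by exists g.
move=> _ [h sh ->]; split.
- by have [ch _] := sh 0%N; apply: (cont_comp ch); exact: cont_snd.
- by move=> k _ x; have [_ /(_ k)[]] := sh 1%N.
- move=> k; exists (partial k h) => //.
  by move=> N; have [_ /(_ k)[]] := sh N.+1.
Qed.

Lemma Ck_half_ext N u v : (forall x (t : R), 0 <= t -> u x t = v x t) ->
  Ck_half N u -> Ck_half N v.
Proof.
elim: N u v => [|N IH] u v uv /= [cu Hu]; split => //.
- have e : {in [set z : 'rV[R]_n * R | 0 <= z.2],
     (fun z => u z.1 z.2) =1 (fun z => v z.1 z.2)}.
    by move=> z; rewrite inE => /= z0; exact: uv.
  exact: (subspace_eq_continuous e).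
- have e : {in [set z : 'rV[R]_n * R | 0 <= z.2],
     (fun z => u z.1 z.2) =1 (fun z => v z.1 z.2)}.
    by move=> z; rewrite inE => /= z0; exact: uv.
  exact: (subspace_eq_continuous e).
move=> o; have [d [w w1 w2]] := Hu o.
have uvt (t : R) : 0 < t -> u ^~ t = v ^~ t.
  by move=> t0; apply/funext => y; apply: uv; exact: ltW.
have nuv x (t : R) : 0 < t -> \near t, u x t = v x t.
  move=> t0; near=> s; apply: uv; apply: ltW; near: s; exact: lt_nbhsr.
have pe x (t : R) : 0 < t -> pderiv o u x t = pderiv o v x t.
  move=> t0; case: (o) => [k|] /=.
    by rewrite (uvt t t0).
  by rewrite !derive1E; exact: (near_eq_derive _ (nuv x t t0)).
split; last by exists w => // x t t0; rewrite w1// pe.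
move=> x t t0; have := d x t t0; case: (o) => [k|] /=.
  by rewrite (uvt t t0).
exact: (near_eq_derivable (nuv x t t0)).
Unshelve. all: by end_near. Qed.


Lemma within_comp (T : topologicalType) (u : 'rV[R]_n -> R -> R)
    (y : T -> 'rV[R]_n) (t : T -> R) :
  {within [set z : 'rV[R]_n * R | 0 <= z.2], continuous (fun z => u z.1 z.2)} ->
  continuous y -> continuous t -> (forall p, 0 <= t p) ->
  continuous (fun p => u (y p) (t p)).
Proof.
move=> /subspace_continuousP cu cy ct t0 p W nW.
have H : nbhs (y p, t p) [set z | 0 <= z.2 -> W (u z.1 z.2)] :=
  cu (y p, t p) (t0 p) W nW.
have cyt : continuous (fun p => (y p, t p)) by exact: cont_pair.
have H' : nbhs p (fun q => 0 <= t q -> W (u (y q) (t q))) := cyt p _ H.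
by apply: filterS H' => q; apply; exact: t0.
Qed.

Lemma le_at_boundary (f : R -> R) (e r : R) : continuous f -> 0 < r ->
  (forall s, 0 < s < r -> f s <= e) -> f 0 <= e.
Proof.
move=> cf r0 H; rewrite leNgt; apply/negP => ef.
have /cvgrPdist_lt/(_ (f 0 - e)) := cf 0.
rewrite subr_gt0 => /(_ ef) /nbhs_ballP[d /= d0 Hd].
pose s := Num.min (r / 2) (d / 2).
have s0 : 0 < s by rewrite lt_min !divr_gt0.
have sr : s < r by rewrite gt_min ltr_pdivrMr// ltr_pMr// ltr1n.
have sd : s < d by rewrite gt_min [X in _ || X]ltr_pdivrMr// ltr_pMr// ltr1n orbT.
have := H s; rewrite s0 sr => /(_ isT) fs.
have := Hd s; rewrite /ball /= sub0r normrN gtr0_norm// => /(_ sd).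
by rewrite ltNge => /negP; apply; rewrite (le_trans _ (ler_norm _))// lerD2l lerN2.
Qed.

Lemma eq_at_boundary (f g : R -> R) : continuous f -> continuous g ->
  (forall s, 0 < s -> f s = g s) -> f 0 = g 0.
Proof.
move=> cf cg H; apply/eqP; rewrite eq_le -subr_le0 -[X in _ && X]subr_le0.
have cfg : continuous (fun s => f s - g s) by apply: contD => //; exact: contN.
have cgf : continuous (fun s => g s - f s) by apply: contD => //; exact: contN.
rewrite (@le_at_boundary _ 0 1 cfg ltr01) ?(@le_at_boundary _ 0 1 cgf ltr01)// => s /andP[s0 _].
  by rewrite H// subrr.
by rewrite H// subrr.
Qed.

Lemma cont_max0 : continuous (fun s : R => Num.max s 0).
Proof. by move=> s; apply: continuous_max; [exact: cvg_id|exact: cvg_cst]. Qed.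

Lemma max0_ge (s : R) : 0 <= Num.max s 0.
Proof. by rewrite le_max lexx orbT. Qed.

Lemma half_space_cont u : Ck_half 0 u ->
  continuous (fun p : R * 'rV[R]_n => u p.2 (Num.max p.1 0)).
Proof.
move=> [cu _]; apply: (within_comp cu); first exact: cont_snd.
  by apply: (cont_comp cont_max0); exact: cont_fst.
by move=> p; exact: max0_ge.
Qed.

Lemma Ck_half0 N u : Ck_half N u -> Ck_half 0 u.
Proof. by case: N => [//|N] [c _]; split. Qed.

Lemma half_space_boundary_eq u v : Ck_half 0 u -> Ck_half 0 v ->
  (forall x (t : R), 0 < t -> u x t = v x t) ->
  forall x (t : R), 0 <= t -> u x t = v x t.
Proof.
move=> cu cv uv x t; rewrite le_eqVlt => /predU1P[<-|]; last exact: uv.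
have slice w : Ck_half 0 w -> continuous (fun s : R => w x (Num.max s 0)).
  move=> cw; apply: (@cont_comp _ _ _ (fun s : R => (s, x)) _ (half_space_cont cw)).
  by apply: cont_pair; [exact: cont_id|exact: cont_cst].
have := @eq_at_boundary _ _ (slice u cu) (slice v cv).
by rewrite maxxx; apply => s s0; rewrite (max_l (ltW s0)); exact: uv.
Qed.

(** Where u and its x-derivative extend continuously to t = 0, the extension of
    the derivative is the derivative of the extension: the mean value theorem at
    times s > 0 bounds the difference quotients uniformly as s tends to 0. *)
Lemma half_space_boundary_drv u v k x : Ck_half 0 u -> Ck_half 0 v ->
  (forall x (t : R), 0 < t -> is_derive x (delta_mx 0 k) (u ^~ t) (v x t)) ->
  is_derive x (delta_mx 0 k) (u ^~ 0) (v x 0).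
Proof.
move=> cu cv duv; apply: is_deriveP => e e0.
set ek : 'rV[R]_n := delta_mx 0 k.
have cv' := half_space_cont cv.
have cvl : continuous (fun p : R * R => v (x + p.2 *: ek) (Num.max p.1 0)).
  apply: (@cont_comp _ _ _ (fun p : R * R => (p.1, x + p.2 *: ek)) _ cv').
  apply: cont_pair; first exact: cont_fst.
  by apply: contVD; [exact: cont_cst|apply: contVZ; [exact: cont_snd|exact: cont_cst]].
have /cvgrPdist_lt/(_ _ e0) := cvl (0, 0).
move=> /= [[A B] /= [/nbhs_ballP[r /= r0 rA] /nbhs_ballP[d /= d0 dB]] AB].
near=> h.
have h0 : h != 0 by near: h; exact: nbhs_dnbhs_neq.
have hd : `|h| < d by near: h; exact: dnbhs0_lt.
have cul y : continuous (fun s : R => u y (Num.max s 0)).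
  apply: (@cont_comp _ _ _ (fun s : R => (s, y)) _ (half_space_cont cu)).
  by apply: cont_pair; [exact: cont_id|exact: cont_cst].
pose Q s := `|h^-1 * (u (x + h *: ek) (Num.max s 0) - u x (Num.max s 0)) - v x 0|.
have cQ : continuous Q.
  apply: (@cont_comp _ _ _ _ (fun y : R => `|y|) (@norm_continuous _ _)).
  apply: contD; last exact: cont_cst.
  by apply: contM; [exact: cont_cst|apply: contD => //; exact: contN].
have := @le_at_boundary Q e r cQ r0; rewrite /Q maxxx; apply => s /andP[s0 sr].
rewrite (max_l (ltW s0)).
have [c hc ec] := @MVT_unordered R _ _ 0 h
  (fun t => @drv_lineE _ _ (u ^~ s) (v ^~ s) ek x t (fun y => duv y s s0)).
move: ec hc; rewrite !scale0r !addr0 !subr0 => -> hc.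
rewrite mulrCA mulVf// mulr1 distrC.
have := AB (s, c); rewrite /= !scale0r !addr0 maxxx (max_l (ltW s0)) => H.
apply/ltW/H; split.
  by apply: rA; rewrite /ball /= sub0r normrN gtr0_norm.
by apply: dB; rewrite /ball /= sub0r normrN (le_lt_trans hc).
Unshelve. all: by end_near. Qed.

(** Data on t >= 0 are continued to negative times by their boundary values. This
    destroys the time derivatives, but keeps all x-derivatives jointly continuous,
    which is what the formula for the solution involves. *)
Lemma smooth_family_half_space u : smooth_half u -> smooth_family (fun tau x => u x (Num.max tau 0)).
Proof.
move=> su; apply: (@smooth_family_coind _ _ (fun F => exists2 u, smooth_half u &
  F = fun tau x => u x (Num.max tau 0))); last by exists u.
move=> _ [{su}u su ->].
have step k : exists2 v, smooth_half v &
    forall x (t : R), 0 <= t -> is_derive x (delta_mx 0 k) (u ^~ t) (v x t).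
  have [_ /(_ (Some k)) [d [v vE cv]]] := su 1%N.
  (* The continuous extension v of the derivative is itself smooth: it agrees
     for t > 0, hence for t >= 0, with the witnesses of every order. *)
  exists v.
    move=> N; have [_ /(_ (Some k)) [_ [w wE cw]]] := su N.+1.
    apply: (Ck_half_ext _ cw); apply: half_space_boundary_eq => //; first exact: Ck_half0 cw.
    by move=> x t t0; rewrite wE// vE.
  have dp x (t : R) : 0 < t -> is_derive x (delta_mx 0 k) (u ^~ t) (v x t).
    by move=> t0; rewrite vE//; apply: derivableP; exact: (d x t t0).
  move=> x t; rewrite le_eqVlt => /predU1P[<-|]; last exact: dp.
  by apply: half_space_boundary_drv => //; exact: su.
split.
- exact: half_space_cont (su 0%N).
- move=> k tau x; have [v _ dv] := step k.
  by have [] := dv x (Num.max tau 0) (max0_ge tau).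
- move=> k; have [v sv dv] := step k; exists v => //.
  apply/funext => tau; apply: partialE => x; exact: dv (max0_ge tau).
Qed.
End HalfSpace.

(** * Iterated bounded functionals *)

Section FunctionalOps.
Variable R : realType.

Lemma bdd_functional_lin (U : topologicalType) (L : (U -> R) -> R) (F G : U -> R) c :
  bdd_functional L -> continuous F -> continuous G ->
  L (fun u => F u + c * G u) = L F + c * L G.
Proof. by move=> [K [C [_ _ lin _]]] cF cG; exact: lin. Qed.

Lemma bdd_functional0 (U : topologicalType) (L : (U -> R) -> R) :
  bdd_functional L -> L (fun=> 0) = 0.
Proof.
move=> bL; have := @bdd_functional_lin U L (fun=> 0) (fun=> 0) 1 bL (@cont_cst _ _ _) (@cont_cst _ _ _).
rewrite (_ : (fun u : U => 0 + 1 * 0) = fun=> 0); last first.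
  by apply/funext => u; rewrite mul1r addr0.
by move=> /eqP; rewrite mul1r -subr_eq0 opprD addNKr oppr_eq0 => /eqP.
Qed.

Lemma bdd_functionalZ (U : topologicalType) (L : (U -> R) -> R) (F : U -> R) c :
  bdd_functional L -> continuous F -> L (fun u => c * F u) = c * L F.
Proof.
move=> bL cF; rewrite -[RHS]add0r -(bdd_functional0 bL) -(bdd_functional_lin _ bL (@cont_cst _ _ _) cF).
by congr L; apply/funext => u; rewrite add0r.
Qed.

Lemma bdd_functionalD (U : topologicalType) (L : (U -> R) -> R) (F G : U -> R) :
  bdd_functional L -> continuous F -> continuous G ->
  L (fun u => F u + G u) = L F + L G.
Proof.
move=> bL cF cG; rewrite -[L G]mul1r -(bdd_functional_lin _ bL cF cG).
by congr L; apply/funext => u; rewrite mul1r.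
Qed.

Lemma bdd_functional_sum (U : topologicalType) (L : (U -> R) -> R) (I : Type) (r : seq I)
    (F : I -> U -> R) :
  bdd_functional L -> (forall i, continuous (F i)) ->
  L (fun u => \sum_(i <- r) F i u) = \sum_(i <- r) L (F i).
Proof.
move=> bL cF; elim: r => [|i r IH].
  rewrite big_nil -[RHS](bdd_functional0 bL); congr L.
  by apply/funext => u; rewrite big_nil.
rewrite big_cons -IH -(bdd_functionalD bL (cF i)); last by apply: cont_sum => j _; exact: cF.
by congr L; apply/funext => u; rewrite big_cons.
Qed.

Lemma bdd_functional_pushforward (T V : topologicalType) (L : (T -> R) -> R) (f : T -> V) :
  bdd_functional L -> continuous f -> bdd_functional (fun F : V -> R => L (fun t => F (f t))).
Proof.
move=> bL cf; have [K [C [cK C0 lin bnd]]] := bL.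
exists (f @` K), C; split => //.
- by apply: continuous_compact => //; exact: continuous_subspaceT.
- by move=> F G c cF cG; apply: bdd_functional_lin => //; exact: cont_comp cf.
- move=> F M cF M0 H; apply: bnd => //; first exact: cont_comp cf.
  by move=> u Ku; apply: H; exists u.
Qed.

(** The recursion step for sphere integrals. The compact set controlling the
    iterated functional is the image of the product of the two given ones. *)
Lemma bdd_functional_iterated (T U V : topologicalType) (L : (T -> R) -> R)
    (L' : (U -> R) -> R) (f : T -> U -> V) (w : T -> R) :
  bdd_functional L -> bdd_functional L' -> continuous (fun p : T * U => f p.1 p.2) ->
  continuous w -> (forall t, `|w t| <= 1) ->
  bdd_functional (fun F : V -> R => L (fun t => w t * L' (fun u => F (f t u)))).
Proof.
move=> bL bL' cf cw w1.
have cfF (F : V -> R) : continuous F ->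
    continuous (fun p : T * U => F (f p.1 p.2)).
  by move=> cF; exact: (cont_comp cF cf).
have cL' (F : V -> R) : continuous F ->
    continuous (fun t => L' (fun u => F (f t u))).
  by move=> cF; apply: (bdd_functional_cont (F := fun t u => F (f t u)) bL'); exact: cfF.
have cs (F : V -> R) t : continuous F -> continuous (fun u => F (f t u)).
  by move=> cF; apply: (@cont_slice _ _ _ (fun t u => F (f t u)) t); exact: cfF.
have [K [C [cK C0 lin bnd]]] := bL.
have [K' [C' [cK' C'0 lin' bnd']]] := bL'.
exists ((fun p : T * U => f p.1 p.2) @` (K `*` K')), (C * C'); split => //.
- by apply: continuous_compact; [exact: continuous_subspaceT|exact: compact_setX].
- exact: mulr_ge0.
- move=> F G c cF cG; rewrite -bdd_functional_lin//.
  + congr L; apply/funext => t; rewrite (bdd_functional_lin _ bL' (cs F t cF) (cs G t cG)).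
    by ring.
  + by apply: contM => //; exact: cL'.
  + by apply: contM => //; exact: cL'.
- move=> F M cF M0 H; rewrite -mulrA; apply: bnd.
  + by apply: contM => //; exact: cL'.
  + exact: mulr_ge0.
  + move=> t Kt; rewrite normrM -[leRHS]mul1r ler_pM//.
    by apply: bnd' => //; [exact: cs|move=> u Ku; apply: H; exists (t, u)].
Qed.

End FunctionalOps.

(** * Integration over spheres in polar form *)

Section Sphere.
Variable R : realType.

Definition cons_row d (c : R) (y : 'rV[R]_d) : 'rV[R]_d.+1 :=
  row_mx (const_mx c : 'rV[R]_1) y.

Lemma cons_row0 d c (y : 'rV[R]_d) : cons_row c y 0 ord0 = c.
Proof.
have -> : (ord0 : 'I_d.+1) = lshift d (ord0 : 'I_1) by apply/val_inj.
exact: etrans (row_mxEl (const_mx c : 'rV[R]_1) y 0 ord0) (mxE _ _ _ _).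
Qed.

Lemma cons_rowS d c (y : 'rV[R]_d) j : cons_row c y 0 (lift ord0 j) = y 0 j.
Proof.
have -> : lift ord0 j = rshift 1 j :> 'I_d.+1 by apply/val_inj.
exact: (row_mxEr (const_mx c : 'rV[R]_1) y 0 j).
Qed.

Lemma cont_cons_row (T : topologicalType) d (c : T -> R) (y : T -> 'rV[R]_d) :
  continuous c -> continuous y -> continuous (fun t => cons_row (c t) (y t)).
Proof.
move=> cc cy; apply: cont_row => k; case: (unliftP ord0 k) => [j ->|->].
  rewrite (_ : (fun t => _) = (fun t => y t 0 j)); first exact: cont_coord.
  by apply/funext => t; rewrite cons_rowS.
rewrite (_ : (fun t => _) = c) //.
by apply/funext => t; rewrite cons_row0.
Qed.

(** The unit sphere of R^(d+2) is swept by the points (cos th, sin th y) with y on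
    the unit sphere of one dimension less, the area element being
    sin^e th dth dS(y) where e is the dimension of the smaller sphere. *)
Fixpoint sphere_int d : ('rV[R]_d.+2 -> R) -> R :=
  match d with
  | 0%N => fun F => itv_int 0 (2 * pi) (fun th => F (cons_row (cos th) (const_mx (sin th))))
  | d'.+1 => fun F => itv_int 0 pi (fun th =>
      sin th ^+ d'.+1 * sphere_int (fun y => F (cons_row (cos th) (sin th *: y))))
  end.

Lemma cont_sin (T : topologicalType) (f : T -> R) :
  continuous f -> continuous (fun t => sin (f t)).
Proof. by move=> cf; apply: (cont_comp _ cf); exact: continuous_sin. Qed.

Lemma cont_cos (T : topologicalType) (f : T -> R) :
  continuous f -> continuous (fun t => cos (f t)).
Proof. by move=> cf; apply: (cont_comp _ cf); exact: continuous_cos. Qed.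

Lemma cont_polar2 d : continuous (fun p : R * 'rV[R]_d => cons_row (cos p.1) (sin p.1 *: p.2)).
Proof.
apply: cont_cons_row; first by apply: cont_cos; exact: cont_fst.
by apply: contVZ; [apply: cont_sin; exact: cont_fst|exact: cont_snd].
Qed.

Lemma sphere_int_bounded d : bdd_functional (@sphere_int d).
Proof.
elim: d => [|d IH].
  apply: (bdd_functional_pushforward (f := fun th => cons_row (cos th) (const_mx (sin th)))).
    exact: itv_int_bounded.
  apply: cont_cons_row; first by apply: cont_cos; exact: cont_id.
  apply: cont_row => k; rewrite (_ : (fun t => _) = @sin R); first exact: continuous_sin.
  by apply/funext => t; rewrite mxE.
apply: (bdd_functional_iterated (f := fun th (y : 'rV[R]_d.+2) => cons_row (cos th) (sin th *: y))
  (w := fun th => sin th ^+ d.+1) (@itv_int_bounded R 0 pi) IH).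
- exact: cont_polar2.
- by apply: contX; apply: cont_sin; exact: cont_id.
- move=> t; rewrite normrX exprn_ile1//.
  by rewrite ler_norml sin_geN1 sin_le1.
Qed.

End Sphere.

Section Substitution.
Variables (R : realType) (m n : nat).

(** The hypothesis says that f is affine and maps the k-th coordinate direction
    to s times the idx k-th one. Translations with dilations and the inclusion of
    a scaled sphere of lower dimension are of this kind. *)
Lemma drv_affine_subst (f : 'rV[R]_m -> 'rV[R]_n) (idx : 'I_m -> 'I_n) (s : R)
    (g : 'rV[R]_n -> R) k y :
  (forall y k (t : R), f (y + t *: delta_mx 0 k) = f y + (s * t) *: delta_mx 0 (idx k)) ->
  smooth_fun g -> is_derive y (delta_mx 0 k) (fun y => g (f y)) (s * partial (idx k) g (f y)).
Proof.
move=> fl sg.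
apply: drv_line0; rewrite (_ : (fun t => g (f (y + t *: delta_mx 0 k))) =
    (fun t => g (f y + (s * t) *: delta_mx 0 (idx k)))); last first.
  by apply/funext => t; rewrite fl.
apply: (@drv_scale R s 0 (fun u => g (f y + u *: delta_mx 0 (idx k)))).
rewrite mulr0; have := drv_lineE (f y) 0 (fun z => smooth_drv (idx k) z sg).
by rewrite scale0r addr0.
Qed.

Lemma smooth_fun_affine_subst (f : 'rV[R]_m -> 'rV[R]_n) (idx : 'I_m -> 'I_n) (s : R)
    (g : 'rV[R]_n -> R) :
  (forall y k (t : R), f (y + t *: delta_mx 0 k) = f y + (s * t) *: delta_mx 0 (idx k)) ->
  continuous f -> smooth_fun g -> smooth_fun (fun y => g (f y)).
Proof.
move=> fl cf sg; apply: (@smooth_family_coind _ _ (fun F => exists g (a : R), smooth_fun g /\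
  F = fun _ y => a * g (f y))); last first.
  exists g, 1; split => //.
  by apply/funext => t; apply/funext => y; rewrite mul1r.
move=> _ [h [a [sh ->]]]; split.
- apply: contM; first exact: cont_cst.
  by apply: (cont_comp (smooth_cont sh)); apply: (cont_comp cf); exact: cont_snd.
- by move=> k _ y; have [] := drvZ a (drv_affine_subst k y fl sh).
- move=> k; exists (partial (idx k) h), (a * s); split; first exact: smooth_partial.
  apply/funext => _; apply: partialE => y; rewrite -mulrA.
  exact: (drvZ a (drv_affine_subst k y fl sh)).
Qed.

End Substitution.

(** * The divergence theorem and the area of the sphere *)

Section SphereDivergence.
Variable R : realType.

(** Polynomial identities in cos t and sin t hold modulo cos^2 + sin^2 - 1; the
    cofactor K certifies the membership in the ideal. *)
Lemma trig_eq (t K a b : R) :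
  a - b = K * (cos t ^+ 2 + sin t ^+ 2 - 1) -> a = b.
Proof. by rewrite cos2Dsin2 subrr mulr0 => /eqP; rewrite subr_eq0 => /eqP. Qed.

Lemma cons_row_line d (c s : R) (y : 'rV[R]_d) k (t : R) :
  cons_row c (s *: (y + t *: delta_mx 0 k)) =
  cons_row c (s *: y) + (s * t) *: delta_mx 0 (lift ord0 k).
Proof.
apply/rowP => j; rewrite [X in _ = X]mxE [X in _ = _ + X]mxE.
case: (unliftP ord0 j) => [i ->|->]; last first.
  by rewrite !cons_row0 mxE /= mulr0 addr0.
rewrite !cons_rowS !mxE /= mulrDr mulrA.
by rewrite (inj_eq (@lift_inj _ ord0)).
Qed.

Lemma cont_polar d (c s : R) : continuous (fun y : 'rV[R]_d => cons_row c (s *: y)).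
Proof.
by apply: cont_cons_row; [exact: cont_cst|apply: contVZ; [exact: cont_cst|exact: cont_id]].
Qed.

Lemma drv_polar d (g : 'rV[R]_d.+1 -> R) (y : 'rV[R]_d) (th : R) : smooth_fun g ->
  is_derive th 1 (fun th => g (cons_row (cos th) (sin th *: y)))
    (- sin th * partial ord0 g (cons_row (cos th) (sin th *: y)) +
     cos th * \sum_i y 0 i * partial (lift ord0 i) g (cons_row (cos th) (sin th *: y))).
Proof.
move=> sg.
have := @drv_curve R _ g (fun th => cons_row (cos th) (sin th *: y))
  (cons_row (- sin th) (cos th *: y)) th sg.
rewrite big_ord_recl cons_row0 mulr_sumr.
rewrite (eq_bigr (fun i => cos th * (y 0 i * partial (lift ord0 i) g
  (cons_row (cos th) (sin th *: y))))); last by move=> i _; rewrite cons_rowS mxE mulrA.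
apply=> k; case: (unliftP ord0 k) => [i ->|->].
  have -> : (fun s : R => cons_row (cos s) (sin s *: y) 0 (lift ord0 i)) =
    (fun s => sin s * y 0 i) by apply/funext => s; rewrite cons_rowS mxE.
  rewrite cons_rowS mxE; apply: drv_eq (drvM (is_derive_sin th) (drvc _ _ _)) _.
  by rewrite mulr0 addr0.
have -> : (fun s : R => cons_row (cos s) (sin s *: y) 0 ord0) = @cos R.
  by apply/funext => s; rewrite cons_row0.
rewrite cons_row0; exact: is_derive_cos.
Qed.

Lemma sphere_int_polar_derive d (w : 'rV[R]_d.+2 -> R) (g : 'rV[R]_d.+3 -> R) (th : R) :
  continuous w -> smooth_fun g ->
  is_derive th 1
    (fun th => sphere_int (fun y => w y * g (cons_row (cos th) (sin th *: y))))
    (- sin th * sphere_int (fun y => w y * partial ord0 g (cons_row (cos th) (sin th *: y))) +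
     cos th * sphere_int (fun y => w y * \sum_i y 0 i *
       partial (lift ord0 i) g (cons_row (cos th) (sin th *: y)))).
Proof.
move=> cw sg.
have cg (h : 'rV[R]_d.+3 -> R) : smooth_fun h -> continuous (fun p : R * 'rV[R]_d.+2 =>
    h (cons_row (cos p.1) (sin p.1 *: p.2))).
  by move=> sh; exact: (cont_comp (smooth_cont sh) (@cont_polar2 R _)).
have cg1 (h : 'rV[R]_d.+3 -> R) : smooth_fun h -> continuous (fun y : 'rV[R]_d.+2 =>
    h (cons_row (cos th) (sin th *: y))).
  by move=> sh; exact: (cont_comp (smooth_cont sh) (@cont_polar _ _ _)).
pose F' (th : R) (y : 'rV[R]_d.+2) := w y *
  (- sin th * partial ord0 g (cons_row (cos th) (sin th *: y)) +
     cos th * \sum_i y 0 i * partial (lift ord0 i) g (cons_row (cos th) (sin th *: y))).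
have dF := @bdd_functional_derive R _ (@sphere_int R d)
  (fun th y => w y * g (cons_row (cos th) (sin th *: y))) F' th (@sphere_int_bounded R d).
apply: drv_eq (dF _ _ _) _.
- move=> t; apply: contM => //.
  exact: (cont_comp (smooth_cont sg) (@cont_polar _ _ _)).
- apply: contM; first by apply: (cont_comp cw); exact: cont_snd.
  apply: contD.
    by apply: contM; [apply: contN; apply: cont_sin; exact: cont_fst|apply: cg; exact: smooth_partial].
  apply: contM; first by apply: cont_cos; exact: cont_fst.
  apply: cont_sum => i _; apply: contM; first by apply: cont_coord; exact: cont_snd.
  by apply: cg; exact: smooth_partial.
- by move=> t y; apply: drvZ; exact: drv_polar.
have cA : continuous (fun y => w y * partial ord0 g (cons_row (cos th) (sin th *: y))).
  by apply: contM => //; apply: cg1; exact: smooth_partial.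
have cB : continuous (fun y => w y * \sum_i y 0 i *
       partial (lift ord0 i) g (cons_row (cos th) (sin th *: y))).
  apply: contM => //; apply: cont_sum => i _; apply: contM.
    by apply: cont_coord; exact: cont_id.
  by apply: cg1; exact: smooth_partial.
rewrite -(bdd_functionalZ _ (@sphere_int_bounded R d) cA).
rewrite -(bdd_functional_lin _ (@sphere_int_bounded R d) (contM (@cont_cst _ _ _) cA) cB).
by congr sphere_int; apply/funext => y; rewrite /F'; ring.
Qed.

(** On the unit sphere this is, up to sign, the surface divergence of g times the
    tangential part of the j-th coordinate field. *)
Definition sphere_div_integrand d (g : 'rV[R]_d.+2 -> R) j (y : 'rV[R]_d.+2) :=
  d.+1%:R * (y 0 j * g y) + y 0 j * (\sum_i y 0 i * partial i g y) - partial j g y.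

(** On the circle the integrand is the derivative of - cos t g or of sin t g,
    according to the coordinate. *)
Lemma sphere_div_circle (g : 'rV[R]_2 -> R) j : smooth_fun g ->
  sphere_int (sphere_div_integrand g j) = 0.
Proof.
move=> sg; set one : 'rV[R]_1 := const_mx 1.
have e (t : R) : const_mx (sin t) = sin t *: one :> 'rV[R]_1.
  by apply/rowP => i; rewrite !mxE mulr1.
have dg (t : R) := drv_polar one t sg.
have cc (h : 'rV[R]_2 -> R) : smooth_fun h ->
    continuous (fun t : R => h (cons_row (cos t) (sin t *: one))).
  move=> sh; apply: (cont_comp (smooth_cont sh)); apply: cont_cons_row; first exact: continuous_cos.
  by apply: contVZ; [exact: continuous_sin|exact: cont_cst].
have pi2 : 0 <= 2 * pi :> R by rewrite mulr_ge0// pi_ge0.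
have s2 : sin (2 * pi) = 0 :> R by rewrite mulrC mulr_natr sin2pi.
have c2 : cos (2 * pi) = 1 :> R by rewrite mulrC mulr_natr cos2pi.
have o0 : one 0 0 = 1 by rewrite mxE.
have rs (t : R) : (sin t *: one) 0 0 = sin t by rewrite !mxE mulr1.
pose W j (t : R) := sphere_div_integrand g j (cons_row (cos t) (sin t *: one)).
have -> : sphere_int (sphere_div_integrand g j) = itv_int 0 (2 * pi) (W j).
  by apply: eq_itv_int => t _; rewrite e.
have cr : continuous (fun t : R => cons_row (cos t) (sin t *: one)).
  apply: cont_cons_row; first exact: continuous_cos.
  by apply: contVZ; [exact: continuous_sin|exact: cont_cst].
have cW k : continuous (W k).
  apply: contD; last by apply: contN; apply: cc; exact: smooth_partial.
  apply: contD.
    apply: contM; first exact: cont_cst.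
    by apply: contM; [exact: cont_coord|exact: cc].
  apply: contM; first exact: cont_coord.
  apply: cont_sum => i _; apply: contM; first exact: cont_coord.
  by apply: cc; exact: smooth_partial.
have WE k t : W k t = cons_row (cos t) (sin t *: one) 0 k *
   (g (cons_row (cos t) (sin t *: one)) +
    cos t * partial ord0 g (cons_row (cos t) (sin t *: one)) +
    sin t * partial (lift ord0 ord0) g (cons_row (cos t) (sin t *: one))) -
   partial k g (cons_row (cos t) (sin t *: one)).
  rewrite /W /sphere_div_integrand big_ord_recl big_ord1 cons_row0 cons_rowS rs.
  by move: (g _) (partial _ g _) (partial _ g _) (partial _ g _) => *; ring.
case: (unliftP ord0 j) => [i ->|->].
  rewrite (ord1 i).
  have := @itv_int_FTC R 0 (2 * pi) (fun t => - (cos t * g (cons_row (cos t) (sin t *: one))))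
    (W (lift ord0 ord0)) pi2 (@cW _).
  rewrite c2 s2 cos0 sin0 subrr; apply => t _.
  apply: drv_eq (drvN (drvM (is_derive_cos t) (dg t))) _.
  rewrite WE cons_rowS rs big_ord1 o0.
  apply: (@trig_eq t (- partial (lift ord0 ord0) g (cons_row (cos t) (sin t *: one)))).
  by move: (g _) (partial _ g _) (partial _ g _) => *; ring.
have := @itv_int_FTC R 0 (2 * pi) (fun t => sin t * g (cons_row (cos t) (sin t *: one)))
  (W ord0) pi2 (@cW _).
rewrite c2 s2 cos0 sin0 !mul0r subrr; apply => t _.
apply: drv_eq (drvM (is_derive_sin t) (dg t)) _.
rewrite WE cons_row0 big_ord1 o0.
apply: (@trig_eq t (- partial ord0 g (cons_row (cos t) (sin t *: one)))).
by move: (g _) (partial _ g _) (partial _ g _) => *; ring.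
Qed.

(** After integration over the smaller sphere, the integrand is the th-derivative
    of a function that vanishes at 0 and pi. For the polar coordinate it is
    sin^(d+2) th times the integral of g; for the i-th of the other coordinates it
    is - cos th sin^(d+1) th times the integral of y_i g, where the theorem on the
    smaller sphere removes the partial derivative in that direction. *)
Lemma sphere_div_step d :
  (forall (g : 'rV[R]_d.+2 -> R) j, smooth_fun g -> sphere_int (sphere_div_integrand g j) = 0) ->
  forall (g : 'rV[R]_d.+3 -> R) j, smooth_fun g -> sphere_int (sphere_div_integrand g j) = 0.
Proof.
move=> IH g j sg.
have bL := @sphere_int_bounded R d.
have cc (h : 'rV[R]_d.+3 -> R) t : smooth_fun h -> continuous (fun y : 'rV[R]_d.+2 =>
    h (cons_row (cos t) (sin t *: y))).
  by move=> sh; exact: (cont_comp (smooth_cont sh) (@cont_polar _ _ _)).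
have ccs t : continuous (fun y : 'rV[R]_d.+2 => \sum_i y 0 i *
       partial (lift ord0 i) g (cons_row (cos t) (sin t *: y))).
  apply: cont_sum => i _; apply: contM; first by apply: cont_coord; exact: cont_id.
  by apply: cc; exact: smooth_partial.
have cco i : continuous (fun y : 'rV[R]_d.+2 => y 0 i).
  by apply: cont_coord; exact: cont_id.
pose W (t : R) := sin t ^+ d.+1 *
  sphere_int (fun y => sphere_div_integrand g j (cons_row (cos t) (sin t *: y))).
have -> : sphere_int (sphere_div_integrand g j) = itv_int 0 pi W by [].
have cdiv : continuous (sphere_div_integrand g j).
  have cj k : continuous (fun y : 'rV[R]_d.+3 => y 0 k).
    by apply: cont_coord; exact: cont_id.
  apply: contD; last by apply: contN; apply: smooth_cont; exact: smooth_partial.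
  apply: contD.
    by apply: contM; [exact: cont_cst|apply: contM; [exact: cj|exact: smooth_cont]].
  apply: contM; first exact: cj.
  by apply: cont_sum => i _; apply: contM; [exact: cj|apply: smooth_cont; exact: smooth_partial].
have cW : continuous W.
  apply: contM; first by apply: contX; exact: continuous_sin.
  apply: (@bdd_functional_cont R R _ _ (fun (t : R) (y : 'rV[R]_d.+2) =>
    sphere_div_integrand g j (cons_row (cos t) (sin t *: y))) bL).
  exact: (cont_comp cdiv (@cont_polar2 R _)).
have pi0 := pi_ge0 R.
have ds t := is_derive_sin (t : R); have dc t := is_derive_cos (t : R).
case: (unliftP ord0 j) => [i ej|ej].
  pose B t := sphere_int (fun y => y 0 i * g (cons_row (cos t) (sin t *: y))).
  pose B0 t := sphere_int (fun y => y 0 i * partial ord0 g (cons_row (cos t) (sin t *: y))).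
  pose B1 t := sphere_int (fun y => y 0 i * \sum_k y 0 k *
       partial (lift ord0 k) g (cons_row (cos t) (sin t *: y))).
  pose D t := sphere_int (fun y : 'rV[R]_d.+2 => partial (lift ord0 i) g (cons_row (cos t) (sin t *: y))).
  (* B0 and B1 are the parts of the derivative of B along the polar axis and
     along the smaller sphere; D is the term that does not come from B. *)
  have := @itv_int_FTC R 0 pi (fun t => - (cos t * sin t ^+ d.+1 * B t)) W pi0 cW.
  rewrite sinpi sin0 !expr0n /= !mulr0 !mul0r subrr; apply => t _.
  have dB : is_derive t 1 B (- sin t * B0 t + cos t * B1 t).
    by apply: sphere_int_polar_derive => //; exact: cco.
  apply: drv_eq (drvN (drvM (drvM (dc t) (drvX d.+1 (ds t))) dB)) _.
  have cA := contM (cco i) (cc g t sg).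
  have cA0 := contM (cco i) (cc _ t (smooth_partial ord0 sg)).
  have cA1 := contM (cco i) (ccs t).
  have cD := cc _ t (smooth_partial (lift ord0 i) sg).
  (* The theorem on the smaller sphere for y |-> g (cos t, sin t y). *)
  have E : d.+1%:R * B t + sin t * B1 t - sin t * D t = 0.
    have := IH (fun y => g (cons_row (cos t) (sin t *: y))) i
      (smooth_fun_affine_subst (@cons_row_line d.+2 (cos t) (sin t)) (@cont_polar _ _ _) sg).
    move=> <-; rewrite /B /B1 /D.
    rewrite -(bdd_functionalZ _ bL cA) -(bdd_functional_lin _ bL (contM (@cont_cst _ _ _) cA) cA1).
    rewrite -mulNr -(bdd_functional_lin _ bL (contD (contM (@cont_cst _ _ _) cA) (contM (@cont_cst _ _ _) cA1)) cD).
    congr sphere_int; apply/funext => y; rewrite /sphere_div_integrand.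
    have pE k : partial k (fun y => g (cons_row (cos t) (sin t *: y))) y =
      sin t * partial (lift ord0 k) g (cons_row (cos t) (sin t *: y)).
      have dd z := drv_affine_subst k z (@cons_row_line d.+2 (cos t) (sin t)) sg.
      by rewrite (partialE dd).
    rewrite pE; under [in RHS]eq_bigr do rewrite pE mulrCA.
    by rewrite -mulr_sumr; ring.
  have WE : W t = sin t ^+ d.+1 * (d.+2%:R * sin t * B t +
      sin t * cos t * B0 t + sin t ^+ 2 * B1 t - D t).
    congr (_ * _); rewrite /B /B0 /B1 /D.
    rewrite -(bdd_functionalZ _ bL cA) -(bdd_functional_lin _ bL (contM (@cont_cst _ _ _) cA) cA0).
    rewrite -(bdd_functional_lin _ bL (contD (contM (@cont_cst _ _ _) cA) (contM (@cont_cst _ _ _) cA0)) cA1).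
    rewrite -[in RHS]mulN1r -(bdd_functional_lin _ bL _ cD); last first.
      by do 2 (apply: contD; last by apply: contM => //; exact: cont_cst);
        apply: contM => //; exact: cont_cst.
    congr sphere_int; apply/funext => y; rewrite /sphere_div_integrand ej.
    rewrite big_ord_recl cons_rowS cons_row0 mxE.
    have -> : \sum_(i < d.+2) cons_row (cos t) (sin t *: y) 0 (lift ord0 i) *
        partial (lift ord0 i) g (cons_row (cos t) (sin t *: y)) =
      sin t * \sum_(i < d.+2) y 0 i * partial (lift ord0 i) g (cons_row (cos t) (sin t *: y)).
      by rewrite mulr_sumr; apply: eq_bigr => l _; rewrite cons_rowS mxE mulrA.
    by move: (bigop _ _ _) (g _) (partial _ g _) (partial _ g _) => *; ring.
  have E' : sin t * D t = d.+1%:R * B t + sin t * B1 t.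
    by apply/eqP; rewrite eq_sym -subr_eq0 E.
  have ED : sin t ^+ d.+1 * D t = sin t ^+ d * (sin t * D t).
    by rewrite exprSr mulrA.
  rewrite WE mulrBr ED E'.
  apply: (@trig_eq t (- (sin t ^+ d * (d.+1%:R * B t + sin t * B1 t)))) => /=.
  rewrite !exprS -(natr1 d.+1).
  by move: (B t) (B0 t) (B1 t) => *; ring.
pose one (y : 'rV[R]_d.+2) : R := 1.
have c1 : continuous one by exact: cont_cst.
pose B t := sphere_int (fun y => one y * g (cons_row (cos t) (sin t *: y))).
pose B0 t := sphere_int (fun y => one y * partial ord0 g (cons_row (cos t) (sin t *: y))).
pose B1 t := sphere_int (fun y => one y * \sum_k y 0 k *
     partial (lift ord0 k) g (cons_row (cos t) (sin t *: y))).
have := @itv_int_FTC R 0 pi (fun t => sin t ^+ d.+2 * B t) W pi0 cW.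
rewrite sinpi sin0 !expr0n /= !mul0r subrr; apply => t _.
have dB : is_derive t 1 B (- sin t * B0 t + cos t * B1 t) by exact: sphere_int_polar_derive.
apply: drv_eq (drvM (drvX d.+2 (ds t)) dB) _.
have cA := contM c1 (cc g t sg).
have cA0 := contM c1 (cc _ t (smooth_partial ord0 sg)).
have cA1 := contM c1 (ccs t).
have WE : W t = sin t ^+ d.+1 * (d.+2%:R * cos t * B t +
    (cos t ^+ 2 - 1) * B0 t + cos t * sin t * B1 t).
  congr (_ * _); rewrite /B /B0 /B1.
  rewrite -(bdd_functionalZ _ bL cA) -(bdd_functional_lin _ bL (contM (@cont_cst _ _ _) cA) cA0).
  rewrite -(bdd_functional_lin _ bL (contD (contM (@cont_cst _ _ _) cA) (contM (@cont_cst _ _ _) cA0)) cA1).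
  congr sphere_int; apply/funext => y; rewrite /sphere_div_integrand ej /one.
  rewrite big_ord_recl cons_row0.
  have -> : \sum_(i < d.+2) cons_row (cos t) (sin t *: y) 0 (lift ord0 i) *
      partial (lift ord0 i) g (cons_row (cos t) (sin t *: y)) =
    sin t * \sum_(i < d.+2) y 0 i * partial (lift ord0 i) g (cons_row (cos t) (sin t *: y)).
    by rewrite mulr_sumr; apply: eq_bigr => l _; rewrite cons_rowS mxE mulrA.
  by move: (bigop _ _ _) (g _) (partial _ g _) => *; ring.
rewrite WE; apply: (@trig_eq t (- (sin t ^+ d.+1 * B0 t))) => /=.
rewrite !exprS; move: (B t) (B0 t) (B1 t) => *; ring.
Qed.

(** The surface divergence of a tangential field integrates to zero over a closed
    sphere. *)
Lemma sphere_div d (g : 'rV[R]_d.+2 -> R) j :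
  smooth_fun g -> sphere_int (sphere_div_integrand g j) = 0.
Proof.
elim: d g j => [|d IH] g j sg; first exact: sphere_div_circle.
exact: sphere_div_step.
Qed.

(** Wallis's integrals. *)
Definition sin_int k : R := itv_int 0 pi (fun t => sin t ^+ k).

Lemma sin_int_rec k : k.+2%:R * sin_int k.+2 = k.+1%:R * sin_int k.
Proof.
have cs j : continuous (fun t : R => sin t ^+ j).
  by apply: contX; exact: continuous_sin.
have csc (c : R) j : continuous (fun t : R => c * sin t ^+ j).
  by apply: contM; [exact: cont_cst|exact: cs].
have := @itv_int_FTC R 0 pi (fun t => cos t * sin t ^+ k.+1)
  (fun t => k.+1%:R * sin t ^+ k + (- k.+2%:R) * sin t ^+ k.+2) (pi_ge0 R)
  (contD (csc _ _) (csc _ _)).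
rewrite sinpi sin0 !expr0n /= !mulr0 subrr => H.
rewrite (bdd_functional_lin _ (@itv_int_bounded R 0 pi) (csc _ _) (cs _)) in H.
rewrite (bdd_functionalZ _ (@itv_int_bounded R 0 pi) (cs _)) mulNr in H.
apply/eqP; rewrite eq_sym -subr_eq0; apply/eqP; apply: H.
move=> t _; apply: drv_eq (drvM (is_derive_cos t) (drvX k.+1 (is_derive_sin t))) _.
apply: (@trig_eq t (k.+1%:R * sin t ^+ k)) => /=.
by rewrite -!(natr1 k.+1) !exprS; ring.
Qed.

Lemma sin_int0 : sin_int 0 = pi.
Proof.
by rewrite /sin_int -[RHS]subr0 -[RHS]mul1r -(itv_int_cst _ (pi_ge0 R)).
Qed.

Lemma sin_int1 : sin_int 1 = 2.
Proof.
have c1 : continuous (fun t : R => sin t ^+ 1).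
  by apply: contX; exact: continuous_sin.
have := @itv_int_FTC R 0 pi (fun t => - cos t) (fun t => sin t ^+ 1) (pi_ge0 R) c1.
rewrite cospi cos0 opprK; apply => t _.
 apply: drv_eq (drvN (is_derive_cos t)) _.
by rewrite opprK expr1.
Qed.

(** Hence raising the dimension by two multiplies the area of the unit sphere by
    2 pi divided by an integer. *)
Lemma sin_int_prod k : k.+1%:R * (sin_int k.+1 * sin_int k) = 2 * pi.
Proof.
elim: k => [|k IH]; first by rewrite sin_int0 sin_int1 mul1r.
by rewrite mulrA sin_int_rec -IH; ring.
Qed.

Lemma sphere_int_cst d (c : R) : sphere_int (fun _ : 'rV[R]_d.+3 => c) =
  sin_int d.+1 * sphere_int (fun _ : 'rV[R]_d.+2 => c).
Proof.
rewrite /= /sin_int mulrC -(bdd_functionalZ _ (@itv_int_bounded R 0 pi)).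
  by congr itv_int; apply/funext => t; rewrite mulrC.
by apply: contX; exact: continuous_sin.
Qed.

(** The double factorial (2k+1)!!. *)
Fixpoint odd_fact (k : nat) : R := if k is k'.+1 then (2 * k + 1)%:R * odd_fact k' else 1.

Lemma odd_fact_gt0 k : 0 < odd_fact k.
Proof. by elim: k => //= k IH; rewrite mulr_gt0// ltr0n addn1. Qed.

(** The area of the unit sphere of R^(2 nu + 3); it explains the constant in the
    definition of the mean M_R, which has total mass 1/(2 nu + 1)!!. *)
Lemma sphere_int_mass nu : odd_fact nu * sphere_int (fun _ : 'rV[R]_(2 * nu + 1).+2 => 1) =
  2 * (2 * pi) ^+ nu.+1.
Proof.
elim: nu => [|nu IH].
  rewrite mul1r muln0 add0n sphere_int_cst sin_int1 /=.
  by rewrite itv_int_cst ?mulr_ge0 ?pi_ge0// subr0 mul1r expr1.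
have -> : (2 * nu.+1 + 1 = (2 * nu + 1).+2)%N by rewrite mulnS !addSn add0n.
rewrite !sphere_int_cst.
have := sin_int_prod (2 * nu + 1).+1.
rewrite [odd_fact _]/= (_ : (2 * nu.+1 + 1)%N = (2 * nu + 1).+2); last first.
  by rewrite mulnS !addSn add0n.
move=> E; transitivity ((2 * pi) * (2 * (2 * pi) ^+ nu.+1) : R); last first.
  by rewrite mulrCA -exprS.
by rewrite -IH -E; ring.
Qed.
End SphereDivergence.

(** * Hyperspherical coordinates and the area element *)

Section Hyperspherical.
Variable R : realType.

Definition hsphere d : 'rV[R]_d.+1 -> 'rV[R]_d.+2 := @hyperspherical R d.+2.

Lemma hsphere0 (s : R) (th : 'rV[R]_0) : hsphere (cons_row s th) = cons_row (cos s) (const_mx (sin s)).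
Proof.
apply/rowP => k; rewrite /hsphere mxE big_mkcond [X in _ * X]big_mkcond !big_ord1 /=.
rewrite -[0%R]/ord0 !cons_row0; case: (unliftP ord0 k) => [j ->|->].
  by rewrite cons_rowS mxE (ord1 j) /= mulr1.
by rewrite cons_row0 /= mul1r.
Qed.

Lemma hsphereS d (s : R) (th : 'rV[R]_d.+1) :
  hsphere (cons_row s th) = cons_row (cos s) (sin s *: hsphere th).
Proof.
apply/rowP => k; rewrite /hsphere mxE big_mkcond [X in _ * X]big_mkcond.
rewrite big_ord_recl [X in _ * X]big_ord_recl /= -[0%R]/ord0 !cons_row0.
case: (unliftP ord0 k) => [j ->|->].
  rewrite cons_rowS [RHS]mxE [X in _ = _ * X]mxE /= mul1r -mulrA; congr (_ * (_ * _)).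
    by rewrite [RHS]big_mkcond; apply: eq_bigr => i _; rewrite cons_rowS.
  by rewrite [RHS]big_mkcond; apply: eq_bigr => i _; rewrite cons_rowS.
by rewrite cons_row0 /= big1_eq !mul1r mulr1.
Qed.

Lemma cons_rowSZ d (c s : R) (y : 'rV[R]_d) j : cons_row c (s *: y) 0 (lift ord0 j) = s * y 0 j.
Proof. by rewrite cons_rowS mxE. Qed.

Lemma cons_row_eta d (y : 'rV[R]_d.+1) : y = cons_row (y 0 ord0) (\row_j y 0 (lift ord0 j)).
Proof.
apply/rowP => k; case: (unliftP ord0 k) => [j ->|->]; last by rewrite cons_row0.
by rewrite cons_rowS mxE.
Qed.

Lemma differentiable_prod (V : normedModType R) (I : Type) (r : seq I) (P : pred I)
    (f : I -> V -> R) (x : V) :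
  (forall i, differentiable (f i) x) ->
  differentiable (fun y => \prod_(i <- r | P i) f i y) x.
Proof.
move=> df; elim: r => [|i r IH].
  have -> : (fun y => \prod_(i <- [::] | P i) f i y) = cst 1.
    by apply/funext => y; rewrite big_nil.
  exact: differentiable_cst.
have -> : (fun y => \prod_(i <- i :: r | P i) f i y) =
    (fun y => (if P i then f i y else 1) * \prod_(i <- r | P i) f i y).
  by apply/funext => y; rewrite big_cons; case: ifP => //; rewrite mul1r.
apply: differentiableM => //.
by case: (P i); [exact: df|exact: differentiable_cst].
Qed.

Lemma differentiable_rowP n (V : normedModType R) (f : V -> 'rV[R]_n) (x : V) :
  (forall k, differentiable (fun y => f y 0 k) x) -> differentiable f x.
Proof.
move=> df; have -> : f = \sum_(k < n) (fun y => f y 0 k *: (delta_mx 0 k : 'rV[R]_n)).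
  by apply/funext => y; rewrite fct_sumE -row_sum_delta.
by apply: differentiable_sum => k; exact: differentiableZl.
Qed.

Lemma differentiable_hsphere d (th : 'rV[R]_d.+1) : differentiable (@hsphere d) th.
Proof.
apply: differentiable_rowP => k.
have -> : (fun th : 'rV[R]_d.+1 => hsphere th 0 k) = (fun th =>
   (\prod_(i < d.+1 | (i < k)%N) sin (th 0 i)) *
                (\prod_(i < d.+1 | i == k :> nat) cos (th 0 i))).
  by apply/funext => y; rewrite mxE.
apply: differentiableM; apply: differentiable_prod => i.
- apply: (@differentiable_comp _ _ _ _ (fun y : 'rV[R]_d.+1 => y 0 i) (@sin R)).
    exact: differentiable_coord.
  by apply/derivable1_diffP; exact: ex_derive.
- apply: (@differentiable_comp _ _ _ _ (fun y : 'rV[R]_d.+1 => y 0 i) (@cos R)).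
    exact: differentiable_coord.
  by apply/derivable1_diffP; exact: ex_derive.
Qed.

Lemma jacobianE m n (f : 'rV[R]_m -> 'rV[R]_n) (x : 'rV[R]_m) i k (c : R) :
  differentiable f x ->
  is_derive x (delta_mx 0 i) (fun y => f y 0 k) c -> 'J f x i k = c.
Proof.
move=> df [_ <-].
have H : 'D_(delta_mx 0 i) f x = row i ('J f x).
  by rewrite (deriveEjacobian _ df) rowE.
transitivity (row i ('J f x) 0 k); first by rewrite [RHS]mxE.
rewrite -H derive_mx ?mxE//; exact: diff_derivable.
Qed.

Lemma jacobian_drv m n (f : 'rV[R]_m -> 'rV[R]_n) (x : 'rV[R]_m) i k :
  differentiable f x ->
  is_derive x (delta_mx 0 i) (fun y => f y 0 k) ('J f x i k).
Proof.
move=> df; have d : derivable (fun y => f y 0 k) x (delta_mx 0 i).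
  have H : derivable f x (delta_mx 0 i) by exact: diff_derivable.
  exact: ((derivable_mxP f x _).1 H 0 k).
by split => //; symmetry; apply: jacobianE => //; exact: derivableP.
Qed.

Lemma cons_row_line0 d (s t : R) (th : 'rV[R]_d) :
  cons_row s th + t *: delta_mx 0 ord0 = cons_row (s + t) th.
Proof.
apply/rowP => k; rewrite [X in X = _]mxE [X in _ + X = _]mxE.
case: (unliftP ord0 k) => [j ->|->]; last by rewrite !cons_row0 mxE mulr1.
by rewrite !cons_rowS mxE /= mulr0 addr0.
Qed.

Lemma cons_row_lineS d (s t : R) (th : 'rV[R]_d) i :
  cons_row s th + t *: delta_mx 0 (lift ord0 i) = cons_row s (th + t *: delta_mx 0 i).
Proof. by have := cons_row_line s 1 th i t; rewrite !scale1r mul1r => ->. Qed.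

Lemma jacobian_hsphere_row0 d (s : R) (th : 'rV[R]_d.+1) k :
  'J (@hsphere d.+1) (cons_row s th) ord0 k = cons_row (- sin s) (cos s *: hsphere th) 0 k.
Proof.
apply: jacobianE; first exact: differentiable_hsphere.
apply: drv_line0; have -> : (fun t : R => hsphere (cons_row s th + t *: delta_mx 0 ord0) 0 k) =
  (fun t => cons_row (cos (s + t)) (sin (s + t) *: hsphere th) 0 k).
  by apply/funext => t; rewrite cons_row_line0 hsphereS.
have ds : is_derive (0 : R) 1 (fun t : R => s + t) 1.
  by apply: drv_eq (drvD (drvc _ _ s) (drvid _)) _; rewrite add0r.
case: (unliftP ord0 k) => [j ->|->].
  have -> : (fun t : R => cons_row (cos (s + t)) (sin (s + t) *: hsphere th) 0 (lift ord0 j)) =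
    (fun t => sin (s + t) * hsphere th 0 j) by apply/funext => t; rewrite cons_rowSZ.
  rewrite cons_rowSZ.
  have dsin : is_derive (0 : R) 1 (fun t : R => sin (s + t)) (cos (s + 0) * 1).
    by apply: drv_comp ds; exact: is_derive_sin.
  apply: drv_eq (drvM dsin (drvc _ _ (hsphere th 0 j))) _.
  by rewrite mulr0 !addr0 mulr1.
have -> : (fun t : R => cons_row (cos (s + t)) (sin (s + t) *: hsphere th) 0 ord0) =
  (fun t => cos (s + t)) by apply/funext => t; rewrite cons_row0.
have dcos : is_derive (0 : R) 1 (fun t : R => cos (s + t)) (- sin (s + 0) * 1).
  by apply: drv_comp ds; exact: is_derive_cos.
by apply: drv_eq dcos _; rewrite cons_row0 addr0 mulr1.
Qed.

Lemma jacobian_hsphere_rowS d (s : R) (th : 'rV[R]_d.+1) i k :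
  'J (@hsphere d.+1) (cons_row s th) (lift ord0 i) k = cons_row 0 (sin s *: row i ('J (@hsphere d) th)) 0 k.
Proof.
apply: jacobianE; first exact: differentiable_hsphere.
apply: drv_line0.
have -> : (fun t : R => hsphere (cons_row s th + t *: delta_mx 0 (lift ord0 i)) 0 k) =
  (fun t => cons_row (cos s) (sin s *: hsphere (th + t *: delta_mx 0 i)) 0 k).
  by apply/funext => t; rewrite cons_row_lineS hsphereS.
case: (unliftP ord0 k) => [j ->|->].
  have -> : (fun t : R => cons_row (cos s) (sin s *: hsphere (th + t *: delta_mx 0 i)) 0 (lift ord0 j)) =
    (fun t => sin s * hsphere (th + t *: delta_mx 0 i) 0 j) by apply/funext => t; rewrite cons_rowSZ.
  rewrite cons_rowSZ [row _ _ _ _]mxE; apply: drvZ.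
  apply/(@drv_line _ _ (fun th => hsphere th 0 j) th (delta_mx 0 i) 0).
  by rewrite scale0r addr0; apply: jacobian_drv; exact: differentiable_hsphere.
have -> : (fun t : R => cons_row (cos s) (sin s *: hsphere (th + t *: delta_mx 0 i)) 0 ord0) =
  (fun t => cos s) by apply/funext => t; rewrite cons_row0.
by rewrite cons_row0; exact: drvc.
Qed.

Lemma hsphere_norm d (th : 'rV[R]_d.+1) : \sum_k hsphere th 0 k * hsphere th 0 k = 1.
Proof.
elim: d th => [|d IH] th; rewrite (cons_row_eta th) big_ord_recl.
  by rewrite big_ord1 hsphere0 cons_row0 cons_rowS mxE -!expr2 cos2Dsin2.
rewrite hsphereS cons_row0.
under eq_bigr do rewrite cons_rowSZ mulrACA.
by rewrite -mulr_sumr IH mulr1 -!expr2 cos2Dsin2.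
Qed.

(** Points of the unit sphere are orthogonal to tangent vectors: differentiate
    [hsphere_norm]. *)
Lemma hsphere_orth d (th : 'rV[R]_d.+1) i :
  \sum_k hsphere th 0 k * 'J (@hsphere d) th i k = 0.
Proof.
have H : is_derive th (delta_mx 0 i) (fun th => \sum_k hsphere th 0 k * hsphere th 0 k)
    (\sum_k ('J (@hsphere d) th i k * hsphere th 0 k + hsphere th 0 k * 'J (@hsphere d) th i k)).
  by apply: drv_sum => k _; apply: drvM; apply: jacobian_drv; exact: differentiable_hsphere.
have H0 : is_derive th (delta_mx 0 i)
  (fun th : 'rV[R]_d.+1 => \sum_k hsphere th 0 k * hsphere th 0 k) 0.
  have -> : (fun th : 'rV[R]_d.+1 => \sum_k hsphere th 0 k * hsphere th 0 k) = (fun _ => 1).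
    by apply/funext => y; rewrite hsphere_norm.
  exact: drvc.
have : \sum_k ('J (@hsphere d) th i k * hsphere th 0 k + hsphere th 0 k * 'J (@hsphere d) th i k) = 0.
  by case: H => _ <-; case: H0.
under eq_bigr do rewrite mulrC -mulr2n.
by rewrite sumrMnl => /eqP; rewrite mulrn_eq0 /= => /eqP.
Qed.

Definition gram d (th : 'rV[R]_d.+1) : 'M[R]_d.+1 :=
  'J (@hsphere d) th *m ('J (@hsphere d) th)^T.

Lemma gramE d (th : 'rV[R]_d.+1) i k :
  gram th i k = \sum_l 'J (@hsphere d) th i l * 'J (@hsphere d) th k l.
Proof. by rewrite mxE; apply: eq_bigr => l _; rewrite [X in _ * X]mxE. Qed.

(** The first row of the Jacobian is the unit vector (- sin s, cos s y), the other
    ones are (0, sin s v) with v tangent at y. By [hsphere_norm] and [hsphere_orth]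
    the Gram matrix is block diagonal with blocks 1 and sin^2 s times the Gram
    matrix of the smaller sphere. *)
Lemma det_gramS d (s : R) (th : 'rV[R]_d.+1) :
  \det (gram (cons_row s th)) = (sin s ^+ 2) ^+ d.+1 * \det (gram th).
Proof.
have G00 : gram (cons_row s th) ord0 ord0 = 1.
  rewrite gramE; under eq_bigr do rewrite !jacobian_hsphere_row0.
  rewrite big_ord_recl cons_row0; under eq_bigr do rewrite cons_rowSZ mulrACA.
  by rewrite -mulr_sumr hsphere_norm mulr1 mulrNN -!expr2 addrC cos2Dsin2.
have G0S i : gram (cons_row s th) ord0 (lift ord0 i) = 0.
  rewrite gramE; under eq_bigr do rewrite jacobian_hsphere_row0 jacobian_hsphere_rowS.
  rewrite big_ord_recl !cons_row0 mulr0 add0r.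
  under eq_bigr do rewrite !cons_rowSZ [row _ _ _ _]mxE mulrACA.
  by rewrite -mulr_sumr hsphere_orth mulr0.
have GSS i j : gram (cons_row s th) (lift ord0 i) (lift ord0 j) = sin s ^+ 2 * gram th i j.
  rewrite gramE; under eq_bigr do rewrite !jacobian_hsphere_rowS.
  rewrite big_ord_recl !cons_row0 mulr0 add0r.
  under eq_bigr do rewrite !cons_rowSZ ![row _ _ _ _]mxE mulrACA.
  by rewrite -mulr_sumr gramE expr2.
rewrite (expand_det_row _ ord0) big_ord_recl G00 mul1r big1 ?addr0; last first.
  by move=> i _; rewrite G0S mul0r.
rewrite /cofactor /= expr0 mul1r -detZ; congr (\det _).
by apply/matrixP => i j; rewrite [LHS]mxE [LHS]mxE [RHS]mxE -GSS.
Qed.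
End Hyperspherical.

(** * Surface integrals and spherical means *)

Section SphereMean.
Variable R : realType.

Definition area_elt d (th : 'rV[R]_d.+1) : R := Num.sqrt (\det (gram th)).

Lemma area_elt0 (s : R) (th : 'rV[R]_0) : area_elt (cons_row s th) = 1.
Proof.
rewrite /area_elt det_mx11 gramE big_ord_recl big_ord1.
have J0 : 'J (@hsphere R 0) (cons_row s th) 0 ord0 = - sin s.
  apply: jacobianE; first exact: differentiable_hsphere.
  apply: drv_line0.
  have -> : (fun t : R => hsphere (cons_row s th + t *: delta_mx 0 0) 0 ord0) =
    (fun t => cos (s + t)) by apply/funext => t; rewrite cons_row_line0 hsphere0 cons_row0.
  have dcos : is_derive (0 : R) 1 (fun t : R => cos (s + t)) (- sin (s + 0) * (0 + 1)).
    by apply: drv_comp (drvD (drvc _ _ s) (drvid _)); exact: is_derive_cos.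
  by apply: drv_eq dcos _; rewrite addr0 add0r mulr1.
have J1 : 'J (@hsphere R 0) (cons_row s th) 0 (lift ord0 ord0) = cos s.
  apply: jacobianE; first exact: differentiable_hsphere.
  apply: drv_line0.
  have -> : (fun t : R => hsphere (cons_row s th + t *: delta_mx 0 0) 0 (lift ord0 ord0)) =
    (fun t => sin (s + t)) by apply/funext => t; rewrite cons_row_line0 hsphere0 cons_rowS mxE.
  have dsin : is_derive (0 : R) 1 (fun t : R => sin (s + t)) (cos (s + 0) * (0 + 1)).
    by apply: drv_comp (drvD (drvc _ _ s) (drvid _)); exact: is_derive_sin.
  by apply: drv_eq dsin _; rewrite addr0 add0r mulr1.
by rewrite J0 J1 mulrNN -!expr2 addrC cos2Dsin2 sqrtr1.
Qed.

(** The absolute value goes away on [0, pi], where the polar angles live. *)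
Lemma area_eltS d (s : R) (th : 'rV[R]_d.+1) : area_elt (cons_row s th) = `|sin s| ^+ d.+1 * area_elt th.
Proof.
rewrite /area_elt det_gramS sqrtrM; last by rewrite exprn_ge0// sqr_ge0.
by rewrite exprAC sqrtr_sqr normrX.
Qed.

Lemma box_integralS d (lo hi : 'rV[R]_d.+1) (F : 'rV[R]_d.+1 -> R) :
  box_integral lo hi F = itv_int (lo 0 0) (hi 0 0) (fun s =>
    box_integral (col' 0 lo) (col' 0 hi) (fun th => F (cons_row s th))).
Proof. by []. Qed.

Lemma angle_max_head d : angle_max R d.+3 0 0 = pi.
Proof. by rewrite mxE. Qed.

Lemma angle_max_tail d : col' 0 (angle_max R d.+3) = angle_max R d.+2.
Proof. by apply/rowP => i; rewrite !mxE. Qed.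

Lemma box_integral_hsphere d (F : 'rV[R]_d.+2 -> R) : continuous F ->
  box_integral 0 (angle_max R d.+2) (fun th => F (hsphere th) * area_elt th) = sphere_int F.
Proof.
elim: d F => [|d IH] F cF; rewrite box_integralS mxE.
  have -> : angle_max R 2 0 0 = 2 * pi by rewrite mxE.
  by apply: eq_itv_int => s _ /=; rewrite hsphere0 area_elt0 mulr1.
rewrite angle_max_head angle_max_tail.
have -> : col' 0 (0 : 'rV[R]_d.+2) = 0 by apply/rowP => i; rewrite !mxE.
apply: eq_itv_int => s hs01.
have cs : continuous (fun y : 'rV[R]_d.+2 => F (cons_row (cos s) (sin s *: y))).
  exact: (cont_comp cF (@cont_polar _ _ _ _)).
transitivity (sin s ^+ d.+1 * sphere_int (fun y => F (cons_row (cos s) (sin s *: y)))); last by [].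
rewrite -(bdd_functionalZ _ (@sphere_int_bounded R d) cs) -(IH _ (contM (@cont_cst _ _ _) cs)).
congr box_integral; apply/funext => th.
by rewrite hsphereS area_eltS ger0_norm ?sin_ge0_pi// mulrCA mulrA.
Qed.

(** Scaling the parametrisation by r multiplies each of the d+1 rows of the
    Jacobian by r. *)
Lemma sphere_integralE d (x : 'rV[R]_d.+2) (r : R) g : 0 <= r -> continuous g ->
  sphere_integral x r g = r ^+ d.+1 * sphere_int (fun y => g (x + r *: y)).
Proof.
move=> r0 cg; have cgx : continuous (fun y : 'rV[R]_d.+2 => g (x + r *: y)).
  apply: (cont_comp cg); apply: contVD; first exact: cont_cst.
  by apply: contVZ; [exact: cont_cst|exact: cont_id].
rewrite -(bdd_functionalZ _ (@sphere_int_bounded R d) cgx) -(box_integral_hsphere (contM (@cont_cst _ _ _) cgx)).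
apply: (f_equal (box_integral 0 (angle_max R d.+2))); apply/funext => th.
rewrite -[hyperspherical th]/(hsphere th).
rewrite [RHS]mulrAC [RHS]mulrC; congr (_ * _).
set f := (fun th => x + r *: hyperspherical th).
have df : differentiable f th.
  apply: differentiableD; first exact: differentiable_cst.
  by apply: differentiableZ; exact: differentiable_hsphere.
have -> : 'J f th = r *: 'J (@hsphere R d) th.
  apply/matrixP => i k; apply: jacobianE => //.
  have -> : (fun y => f y 0 k) = (fun y => x 0 k + r * hsphere y 0 k).
    by apply/funext => y; rewrite mxE [X in _ + X]mxE.
  rewrite mxE; apply: drv_eq (drvD (drvc _ _ _) (drvZ r _)) (add0r _).
  by apply: jacobian_drv; exact: differentiable_hsphere.
rewrite linearZ /= -scalemxAl -scalemxAr scalerA -expr2 detZ.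
rewrite sqrtrM; last by rewrite exprn_ge0// sqr_ge0.
by rewrite exprAC sqrtr_sqr ger0_norm ?exprn_ge0.
Qed.

Definition mean_const nu : R := (2 * (2 * pi) ^+ nu.+1)^-1.

Lemma sphere_meanE nu (x : 'rV[R]_(2 * nu + 1).+2) (r : R) g : 0 < r ->
  continuous g ->
  sphere_mean nu r g x = mean_const nu * sphere_int (fun y => g (x + r *: y)).
Proof.
move=> r0 cg; rewrite /sphere_mean sphere_integralE ?ltW//= /mean_const mulrA.
by rewrite invfM -!mulrA mulKf// expf_neq0// gt_eqF.
Qed.

Lemma mean_const_mass nu :
  mean_const nu * sphere_int (fun _ : 'rV[R]_(2 * nu + 1).+2 => 1) = (odd_fact R nu)^-1.
Proof.
have o0 : odd_fact R nu != 0 by rewrite gt_eqF// odd_fact_gt0.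
apply: (mulfI o0); rewrite mulrCA sphere_int_mass /mean_const mulfV// mulVf//.
by rewrite mulf_neq0// expf_neq0// mulf_neq0// gt_eqF// pi_gt0.
Qed.

End SphereMean.

(** * Evolution operators and Darboux's equation *)

Section Operators.
Variables (R : realType) (n : nat).
Implicit Types (g : 'rV[R]_n -> R) (F : R -> 'rV[R]_n -> R) (x : 'rV[R]_n).

Definition op := ('rV[R]_n -> R) -> 'rV[R]_n -> R -> R.
Implicit Types S T : op.

(** Joint continuity is asked along smooth families of data, because in Duhamel's
    integral the data vary with the time of integration. *)
Definition op_cont S := forall F, smooth_family F ->
  continuous (fun p : R * ('rV[R]_n * R) => S (F p.1) p.2.1 p.2.2).

Definition op_partial S := forall g k x t, smooth_fun g ->
  is_derive x (delta_mx 0 k) (fun y => S g y t) (S (partial k g) x t).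

Definition op_add S := forall g h x t, smooth_fun g -> smooth_fun h ->
  S (fun y => g y + h y) x t = S g x t + S h x t.

(** Translation invariance in infinitesimal form, with continuity and additivity.
    It makes the operator commute with the Laplacian ([lap_op]) and preserve
    smoothness ([smooth_fun_op]). *)
Definition regular_op S := [/\ op_cont S, op_partial S & op_add S].

Lemma partialD k g h : smooth_fun g -> smooth_fun h ->
  partial k (fun y => g y + h y) = (fun y => partial k g y + partial k h y).
Proof. by move=> sg sh; apply: partialE => x; apply: drvD; exact: smooth_drv. Qed.

Lemma lapD g h : smooth_fun g -> smooth_fun h ->
  laplacian (fun y => g y + h y) = (fun y => laplacian g y + laplacian h y).
Proof.
move=> sg sh; apply/funext => x; rewrite !laplacianE -big_split /=.
by apply: eq_bigr => k _; rewrite (partialD k sg sh) (partialD k (smooth_partial k sg) (smooth_partial k sh)).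
Qed.

Lemma iter_lapD q g h : smooth_fun g -> smooth_fun h ->
  iter q (@laplacian R n) (fun y => g y + h y) =
  (fun y => iter q (@laplacian R n) g y + iter q (@laplacian R n) h y).
Proof.
move=> sg sh; elim: q => [//|q IH].
by rewrite iterS IH (lapD (smooth_fun_iter_lap q sg) (smooth_fun_iter_lap q sh)).
Qed.

Definition time_derivative S T := forall g x (t : R), smooth_fun g -> is_derive t 1 (S g x) (T g x t).

Lemma regular_lin S T (a b : R -> R) : continuous a -> continuous b ->
  regular_op S -> regular_op T -> regular_op (fun g x t => a t * S g x t + b t * T g x t).
Proof.
move=> ca cb [cS dS aS] [cT dT aT]; split.
  have ct2 : continuous (fun p : R * ('rV[R]_n * R) => p.2.2).
    by apply: (cont_comp (@cont_snd _ _)); exact: cont_snd.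
  move=> F sF; apply: contD; apply: contM.
  - exact: (cont_comp ca ct2).
  - exact: cS.
  - exact: (cont_comp cb ct2).
  - exact: cT.
  by move=> g k x t sg; apply: drvD; apply: drvZ; [exact: dS|exact: dT].
by move=> g h x t sg sh; rewrite aS// aT//; ring.
Qed.

Lemma regular_scale S (a : R -> R) : continuous a -> regular_op S ->
  regular_op (fun g x t => a t * S g x t).
Proof.
move=> ca gS; have := regular_lin ca (@cont_cst _ _ 0) gS gS.
rewrite (_ : (fun g x t => a t * S g x t + 0 * S g x t) = (fun g x t => a t * S g x t))//.
by apply/funext => g; apply/funext => x; apply/funext => t; rewrite mul0r addr0.
Qed.

Lemma regular_sum (I : Type) (r : seq I) (S : I -> op) :
  (forall i, regular_op (S i)) -> regular_op (fun g x t => \sum_(i <- r) S i g x t).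
Proof.
move=> H; split.
- by move=> F sF; apply: cont_sum => i _; case: (H i) => c _ _; exact: c.
- move=> g k x t sg.
  apply: (@drv_sum R _ x (delta_mx 0 k) I r xpredT (fun i y => S i g y t)
    (fun i => S i (partial k g) x t)) => i _.
  by case: (H i) => _ d _; exact: d.
- move=> g h x t sg sh; rewrite -big_split /=; apply: eq_bigr => i _.
  by case: (H i) => _ _ a; exact: a.
Qed.

Lemma regular_lap S q : regular_op S ->
  regular_op (fun g x t => S (iter q (@laplacian R n) g) x t).
Proof.
move=> [cS dS aS]; split.
- by move=> F sF; exact: (cS _ (smooth_family_iter_lap q sF)).
- by move=> g k x t sg; rewrite -(partial_iter_lap q k sg); apply: dS; exact: smooth_fun_iter_lap.
- move=> g h x t sg sh; rewrite (iter_lapD q sg sh).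
  exact: (aS _ _ _ _ (smooth_fun_iter_lap q sg) (smooth_fun_iter_lap q sh)).
Qed.

Lemma regular_partial S k : regular_op S -> regular_op (fun g x t => S (partial k g) x t).
Proof.
move=> [cS dS aS]; split; first by move=> F sF; exact: (cS _ (smooth_family_partial k sF)).
  by move=> g l x t sg; rewrite (partialC k l sg); apply: dS; exact: smooth_partial.
by move=> g h x t sg sh; rewrite (partialD k sg sh) (aS _ _ _ _ (smooth_partial k sg) (smooth_partial k sh)).
Qed.

Lemma op_cont_t S g x : regular_op S -> smooth_fun g -> continuous (S g x).
Proof.
move=> [cS _ _] sg; apply: (@cont_comp _ _ _ (fun t : R => (0 : R, (x, t))) _ (cS _ sg)).
apply: cont_pair; first exact: cont_cst.
by apply: cont_pair; [exact: cont_cst|exact: cont_id].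
Qed.

Lemma op0 S x t : regular_op S -> S (fun=> 0) x t = 0.
Proof.
move=> [_ _ aS]; have := aS _ _ x t (@smooth_family0 R n) (@smooth_family0 R n).
rewrite (_ : (fun y : 'rV[R]_n => 0 + 0) = (fun _ => 0 : R)); last first.
  by apply/funext => y; rewrite addr0.
by move=> /eqP; rewrite -subr_eq0 opprD addNKr oppr_eq0 => /eqP.
Qed.

Lemma op_sum (I : Type) (r : seq I) S (G : I -> 'rV[R]_n -> R) x t : regular_op S ->
  (forall i, smooth_fun (G i)) ->
  S (fun y => \sum_(i <- r) G i y) x t = \sum_(i <- r) S (G i) x t.
Proof.
move=> gS sG; elim: r => [|i r IH].
  rewrite big_nil (_ : (fun y => _) = (fun=> 0)) ?op0//.
  by apply/funext => y; rewrite big_nil.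
rewrite big_cons -IH (_ : (fun y => _) = (fun y => G i y + \sum_(i <- r) G i y)).
  by case: gS => _ _ aS; apply: aS; [exact: sG|exact: (smooth_family_sum r sG)].
by apply/funext => y; rewrite big_cons.
Qed.

Lemma partial_op S g k t : regular_op S -> smooth_fun g ->
  partial k (fun y => S g y t) = (fun y => S (partial k g) y t).
Proof. by move=> [_ dS _] sg; apply: partialE => x; exact: dS. Qed.

Lemma smooth_fun_op S g t : regular_op S -> smooth_fun g -> smooth_fun (fun y => S g y t).
Proof.
move=> gS sg; apply: (@smooth_family_coind _ _ (fun F => exists2 g, smooth_fun g &
  F = (fun _ y => S g y t))); last by exists g.
move=> _ [h sh ->]; split.
- case: gS => cS _ _; have cp : continuous (fun p : R * 'rV[R]_n => (p.1, (p.2, t))).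
    apply: cont_pair; first exact: cont_fst.
    by apply: cont_pair; [exact: cont_snd|exact: cont_cst].
  exact: (cont_comp (cS _ sh) cp).
- by move=> k _ x; case: gS => _ dS _; have [] := dS h k x t sh.
- move=> k; exists (partial k h); first exact: smooth_partial.
  by apply/funext => _; exact: partial_op.
Qed.

Lemma lap_op S g t : regular_op S -> smooth_fun g ->
  laplacian (fun y => S g y t) = (fun y => S (laplacian g) y t).
Proof.
move=> gS sg; apply/funext => x.
rewrite [RHS](op_sum (index_enum 'I_n) x t gS (fun k => smooth_partial k (smooth_partial k sg))).
rewrite laplacianE; apply: eq_bigr => k _.
by rewrite (partial_op k t gS sg) (partial_op k t gS (smooth_partial k sg)).
Qed.

Lemma iter_lap_op S g t q : regular_op S -> smooth_fun g ->
  iter q (@laplacian R n) (fun y => S g y t) =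
  (fun y => S (iter q (@laplacian R n) g) y t).
Proof.
move=> gS sg; elim: q => [//|q IH].
by rewrite iterS IH (lap_op t gS (smooth_fun_iter_lap q sg)).
Qed.

(** Darboux's equation t S'' + p S' = t c^2 S Delta with S(0) = rho. Multiplying by
    t avoids the singular coefficient p / t at t = 0. *)
Definition darboux (c p rho : R) S S1 := [/\ regular_op S, regular_op S1, time_derivative S S1,
  exists S2, time_derivative S1 S2 /\ forall g x t, smooth_fun g ->
    t * S2 g x t + p * S1 g x t = t * c ^+ 2 * S (laplacian g) x t &
  forall g x, smooth_fun g -> S g x 0 = rho * g x].

(** With T = t S' + (p - 1) S the equation reads T' = t c^2 S Delta; a second
    derivative, together with the definition of T, is Darboux's equation for T with
    coefficient p - 2. *)
Lemma darboux_step c p rho S S1 : darboux c p rho S S1 ->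
  darboux c (p - 2) ((p - 1) * rho)
    (fun g x t => t * S1 g x t + (p - 1) * S g x t)
    (fun g x t => t * c ^+ 2 * S (laplacian g) x t).
Proof.
move=> [gS gS1 dS [S2 [dS1 eS]] S0].
have ct : continuous (fun t : R => t * c ^+ 2) by apply: contM; [exact: cont_id|exact: cont_cst].
split.
- exact: (regular_lin (@cont_id _) (@cont_cst _ _ (p - 1)) gS1 gS).
- exact: (regular_scale ct (regular_lap 1 gS)).
- move=> g x t sg.
  apply: drv_eq (drvD (drvM (drvid t) (dS1 g x t sg)) (drvZ _ (dS g x t sg))) _.
  by rewrite mul1r -eS//; ring.
- exists (fun g x t => c ^+ 2 * (S (laplacian g) x t + t * S1 (laplacian g) x t)); split.
    move=> g x t sg; have sl := smooth_fun_lap sg.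
    have d1 : is_derive t 1 (fun s : R => s * c ^+ 2) (c ^+ 2).
      by apply: drv_eq (drvM (drvid t) (drvc _ _ _)) _; rewrite mul1r mulr0 addr0.
    by apply: drv_eq (drvM d1 (dS _ x t sl)) _; ring.
  by move=> g x t sg; ring.
- by move=> g x sg; rewrite mul0r add0r S0// mulrA.
Qed.

Definition wave_solution c S S1 := [/\ regular_op S, regular_op S1, time_derivative S S1,
  time_derivative S1 (fun g x t => c ^+ 2 * S (laplacian g) x t) &
  forall g x, smooth_fun g -> S g x 0 = 0 /\ S1 g x 0 = g x].

(** (t S)'' = t S'' + 2 S'. *)
Lemma darboux_wave c S S1 : darboux c 2 1 S S1 ->
  wave_solution c (fun g x t => t * S g x t) (fun g x t => S g x t + t * S1 g x t).
Proof.
move=> [gS gS1 dS [S2 [dS1 eS]] S0]; split.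
- exact: (regular_scale (@cont_id _) gS).
- have := regular_lin (@cont_cst R R 1) (@cont_id _) gS gS1.
  rewrite (_ : (fun g x t => 1 * S g x t + t * S1 g x t) =
    (fun g x t => S g x t + t * S1 g x t))//.
  by apply/funext => g; apply/funext => x; apply/funext => t; rewrite mul1r.
- move=> g x t sg; apply: drv_eq (drvM (drvid t) (dS g x t sg)) _.
  by rewrite mul1r.
- move=> g x t sg.
  apply: drv_eq (drvD (dS g x t sg) (drvM (drvid t) (dS1 g x t sg))) _.
  by rewrite mulrA [c ^+ 2 * t]mulrC -eS//; ring.
- by move=> g x sg; rewrite !mul0r S0// addr0 mul1r.
Qed.

End Operators.

(** * Darboux's equation for spherical means *)

Section Averages.
Variables (R : realType) (d : nat).
Notation n := d.+2.
Implicit Types (g : 'rV[R]_n -> R) (w : 'rV[R]_n -> R).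

Definition sphere_avg (c : R) w : op R n := fun g x t =>
  sphere_int (fun y => w y * g (x + (c * t) *: y)).

Lemma sphere_avg_partial c w : continuous w -> op_partial (sphere_avg c w).
Proof.
move=> cw g k x t sg; apply: drv_line0.
have := @bdd_functional_derive R _ (@sphere_int R d)
  (fun s y => w y * g (x + s *: delta_mx 0 k + (c * t) *: y))
  (fun s y => w y * partial k g (x + s *: delta_mx 0 k + (c * t) *: y)) 0 (@sphere_int_bounded R d).
rewrite /sphere_avg scale0r addr0; apply.
- move=> s; apply: contM => //; apply: (cont_comp (smooth_cont sg)).
  by apply: contVD; [exact: cont_cst|apply: contVZ; [exact: cont_cst|exact: cont_id]].
- apply: contM; first exact: (cont_comp cw (@cont_snd _ _)).
  apply: (cont_comp (smooth_cont (smooth_partial k sg))).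
  apply: contVD; last by apply: contVZ; [exact: cont_cst|exact: cont_snd].
  by apply: contVD; [exact: cont_cst|apply: contVZ; [exact: cont_fst|exact: cont_cst]].
- move=> s y; apply: drvZ; rewrite addrAC.
  have -> : (fun s : R => g (x + s *: delta_mx 0 k + (c * t) *: y)) =
    (fun s => g ((x + (c * t) *: y) + s *: delta_mx 0 k)).
    by apply/funext => u; rewrite addrAC.
  exact: (drv_lineE _ s (fun z => smooth_drv k z sg)).
Qed.

Lemma regular_sphere_avg c w : continuous w -> regular_op (sphere_avg c w).
Proof.
move=> cw; split; first last.
- move=> g h x t sg sh; rewrite -(bdd_functionalD (@sphere_int_bounded R d)).
  + by congr sphere_int; apply/funext => y; rewrite mulrDr.
  + apply: contM => //; apply: (cont_comp (smooth_cont sg)).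
    by apply: contVD; [exact: cont_cst|apply: contVZ; [exact: cont_cst|exact: cont_id]].
  + apply: contM => //; apply: (cont_comp (smooth_cont sh)).
    by apply: contVD; [exact: cont_cst|apply: contVZ; [exact: cont_cst|exact: cont_id]].
- exact: sphere_avg_partial.
- move=> F sF.
  apply: (@bdd_functional_cont R (R * ('rV[R]_n * R))%type _ (@sphere_int R d)
    (fun p y => w y * F p.1 (p.2.1 + (c * p.2.2) *: y)) (@sphere_int_bounded R d)).
  apply: contM; first exact: (cont_comp cw (@cont_snd _ _)).
  have c1 : continuous (fun p : R * ('rV[R]_n * R) * 'rV[R]_n => p.1.2).
    exact: (cont_comp (@cont_snd _ _) (@cont_fst _ _)).
  apply: (cont_comp2 (smooth_family_cont sF)).
    exact: (cont_comp (@cont_fst _ _) (@cont_fst _ _)).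
  apply: contVD; first exact: (cont_comp (@cont_fst _ _) c1).
  apply: contVZ; last exact: cont_snd.
  by apply: contM; [exact: cont_cst|exact: (cont_comp (@cont_snd _ _) c1)].
Qed.

Lemma sphere_avg_dt c w : continuous w ->
  time_derivative (sphere_avg c w) (fun g x t => c * \sum_i sphere_avg c (fun y => w y * y 0 i) (partial i g) x t).
Proof.
move=> cw g x t sg.
have cc (h : 'rV[R]_n -> R) s : smooth_fun h -> continuous (fun y : 'rV[R]_n => h (x + (c * s) *: y)).
  move=> sh; apply: (cont_comp (smooth_cont sh)).
  by apply: contVD; [exact: cont_cst|apply: contVZ; [exact: cont_cst|exact: cont_id]].
have cco i : continuous (fun y : 'rV[R]_n => y 0 i).
  by apply: cont_coord; exact: cont_id.
pose F' (s : R) (y : 'rV[R]_n) := w y * (c * \sum_i y 0 i * partial i g (x + (c * s) *: y)).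
have dF := @bdd_functional_derive R _ (@sphere_int R d)
  (fun s y => w y * g (x + (c * s) *: y)) F' t (@sphere_int_bounded R d).
apply: drv_eq (dF _ _ _) _.
- by move=> s; apply: contM => //; exact: cc.
- apply: contM; first exact: (cont_comp cw (@cont_snd _ _)).
  apply: contM; first exact: cont_cst.
  apply: cont_sum => i _; apply: contM; first exact: (cont_comp (cco i) (@cont_snd _ _)).
  apply: (cont_comp (smooth_cont (smooth_partial i sg))); apply: contVD; first exact: cont_cst.
  apply: contVZ; last exact: cont_snd.
  by apply: contM; [exact: cont_cst|exact: cont_fst].
- move=> s y; apply: drvZ.
  have := @drv_scale R c s (fun u => g (x + u *: y)) _ (drv_lineE x _ (fun z => drv_along y z sg)).
  by [].
rewrite -(bdd_functional_sum _ (@sphere_int_bounded R d)); last first.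
  move=> i; apply: contM; last by apply: cc; exact: smooth_partial.
  exact: contM.
rewrite -(bdd_functionalZ _ (@sphere_int_bounded R d)); last first.
  apply: cont_sum => i _; apply: contM; last by apply: cc; exact: smooth_partial.
  exact: contM.
congr sphere_int; apply/funext => y; rewrite /F' mulrCA; congr (_ * _).
by rewrite mulr_sumr; apply: eq_bigr => i _; rewrite mulrA.
Qed.

Definition unit_weight (y : 'rV[R]_n) : R := 1.
Definition mean_op (c kap : R) : op R n := fun g x t => kap * sphere_avg c unit_weight g x t.
Definition mean_op_dt (c kap : R) : op R n := fun g x t =>
  kap * (c * \sum_i sphere_avg c (fun y => unit_weight y * y 0 i) (partial i g) x t).

(** The time derivatives of the mean are averages of first and second derivatives
    of g weighted by y_i and y_i y_j. Applying [sphere_div] to the i-th partial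
    derivative of g, restricted to the sphere of radius c t, and summing over i
    gives the equation. *)
Lemma darboux_mean (c kap : R) : darboux c d.+1%:R (kap * sphere_int unit_weight) (mean_op c kap) (mean_op_dt c kap).
Proof.
have c1 : continuous unit_weight by exact: cont_cst.
have cco i : continuous (fun y : 'rV[R]_n => y 0 i).
  by apply: cont_coord; exact: cont_id.
split.
- exact: (regular_scale (@cont_cst _ _ kap) (regular_sphere_avg c c1)).
- apply: (regular_scale (@cont_cst _ _ kap)); apply: (regular_scale (@cont_cst _ _ c)).
  by apply: regular_sum => i; apply: regular_partial; apply: regular_sphere_avg; exact: contM.
- by move=> g x t sg; apply: drvZ; exact: sphere_avg_dt.
- exists (fun g x t => kap * (c * \sum_i c * \sum_j
    sphere_avg c (fun y => unit_weight y * y 0 i * y 0 j) (partial j (partial i g)) x t)); split.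
    move=> g x t sg; do 2 apply: drvZ.
    apply: (@drv_sum R _ _ _ _ _ xpredT (fun i => sphere_avg c (fun y => unit_weight y * y 0 i) (partial i g) x)) => i _.
    by apply: sphere_avg_dt; [exact: contM|exact: smooth_partial].
  move=> g x t sg.
  have cc (h : 'rV[R]_n -> R) : smooth_fun h -> continuous (fun y : 'rV[R]_n => h (x + (c * t) *: y)).
    move=> sh; apply: (cont_comp (smooth_cont sh)).
    by apply: contVD; [exact: cont_cst|apply: contVZ; [exact: cont_cst|exact: cont_id]].
  have bL := @sphere_int_bounded R d.
  have aff (y : 'rV[R]_n) k (u : R) : x + (c * t) *: (y + u *: delta_mx 0 k) =
      (x + (c * t) *: y) + (c * t * u) *: delta_mx 0 k.
    by rewrite scalerDr addrA scalerA.
  have D i : d.+1%:R * sphere_avg c (fun y => unit_weight y * y 0 i) (partial i g) x t +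
     (c * t) * \sum_j sphere_avg c (fun y => unit_weight y * y 0 i * y 0 j) (partial j (partial i g)) x t -
     (c * t) * sphere_avg c unit_weight (partial i (partial i g)) x t = 0.
    have si := smooth_partial i sg.
    have sh : smooth_fun (fun y : 'rV[R]_n => partial i g (x + (c * t) *: y)).
      apply: (smooth_fun_affine_subst (idx := fun k => k) aff _ si).
      by apply: contVD; [exact: cont_cst|apply: contVZ; [exact: cont_cst|exact: cont_id]].
    apply: (etrans _ (sphere_div i sh)).
    have cA : continuous (fun y : 'rV[R]_n => unit_weight y * y 0 i * partial i g (x + (c * t) *: y)).
      by apply: contM; [exact: contM|exact: cc].
    have cB j : continuous (fun y : 'rV[R]_n => unit_weight y * y 0 i * y 0 j *
        partial j (partial i g) (x + (c * t) *: y)).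
      by apply: contM; [apply: contM => //; exact: contM|apply: cc; exact: smooth_partial].
    have cC : continuous (fun y : 'rV[R]_n => unit_weight y * partial i (partial i g) (x + (c * t) *: y)).
      by apply: contM => //; apply: cc; exact: smooth_partial.
    have cBs : continuous (fun y : 'rV[R]_n => \sum_j unit_weight y * y 0 i * y 0 j *
        partial j (partial i g) (x + (c * t) *: y)) by apply: cont_sum => j _; exact: cB.
    have E1 : \sum_j sphere_avg c (fun y => unit_weight y * y 0 i * y 0 j) (partial j (partial i g)) x t =
        sphere_int (fun y : 'rV[R]_n => \sum_j unit_weight y * y 0 i * y 0 j *
        partial j (partial i g) (x + (c * t) *: y)) by symmetry; exact: (bdd_functional_sum _ bL cB).
    rewrite E1 /sphere_avg -(bdd_functionalZ _ bL cA) -mulNr.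
    rewrite -(bdd_functional_lin _ bL (contM (@cont_cst _ _ _) cA) cBs).
    rewrite -(bdd_functional_lin _ bL (contD (contM (@cont_cst _ _ _) cA) (contM (@cont_cst _ _ _) cBs)) cC).
    congr sphere_int; apply/funext => y; rewrite /sphere_div_integrand /unit_weight.
    have pE k : partial k (fun y => partial i g (x + (c * t) *: y)) y =
        c * t * partial k (partial i g) (x + (c * t) *: y).
      by rewrite (partialE (fun z => drv_affine_subst (idx := fun k => k) k z aff si)).
    have SE : y 0 i * (\sum_j y 0 j * partial j (fun y => partial i g (x + (c * t) *: y)) y) =
        c * t * \sum_j 1 * y 0 i * y 0 j * partial j (partial i g) (x + (c * t) *: y).
      rewrite !mulr_sumr; apply: eq_bigr => j _; rewrite pE.
      by move: (partial _ _ _) => u; ring.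
    rewrite SE pE; set u := bigop _ _ _; set v := partial i (partial i g) _.
    set w := partial i g _; ring.
  have L : sphere_avg c unit_weight (laplacian g) x t = \sum_i sphere_avg c unit_weight (partial i (partial i g)) x t.
    have cC i : continuous (fun y : 'rV[R]_n => unit_weight y * partial i (partial i g) (x + (c * t) *: y)).
      by apply: contM => //; apply: cc; do 2 apply: smooth_partial.
    have E1 : \sum_i sphere_avg c unit_weight (partial i (partial i g)) x t = sphere_int (fun y : 'rV[R]_n =>
        \sum_i unit_weight y * partial i (partial i g) (x + (c * t) *: y)).
      by symmetry; exact: (bdd_functional_sum _ bL cC).
    rewrite E1 /sphere_avg; congr sphere_int; apply/funext => y.
    by rewrite laplacianE mulr_sumr.
  rewrite /mean_op /mean_op_dt L; apply/eqP; rewrite -subr_eq0; apply/eqP.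
  transitivity (kap * c * \sum_i (d.+1%:R * sphere_avg c (fun y => unit_weight y * y 0 i) (partial i g) x t +
     (c * t) * (\sum_j sphere_avg c (fun y => unit_weight y * y 0 i * y 0 j) (partial j (partial i g)) x t) -
     (c * t) * sphere_avg c unit_weight (partial i (partial i g)) x t)).
    rewrite big_split /= big_split /= sumrN -!mulr_sumr.
    by move: (bigop _ _ _) (bigop _ _ _) (bigop _ _ _) => *; ring.
  by rewrite big1 ?mulr0.
- move=> g x sg; rewrite /mean_op /sphere_avg mulr0 -mulrA; congr (_ * _).
  rewrite mulrC -(bdd_functionalZ _ (@sphere_int_bounded R d) c1); congr sphere_int; apply/funext => y.
  by rewrite scale0r addr0 mulrC.
Qed.

End Averages.

(** * The operator J and the wave equation *)

Section JOperator.
Variable R : realType.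

(** The weight s hides the value at s = 0, where a mean over a sphere of radius 0
    is meaningless. *)
Lemma opJ_ext (h1 h2 : R -> R) : (forall s : R, 0 < s -> h1 s = h2 s) ->
  forall t, opJ h1 t = opJ h2 t.
Proof.
move=> H t; apply: (@eq_itv_int _ 0 t) => s /andP[]; rewrite le_eqVlt => /predU1P[<- _|s0 _].
  by rewrite !mulr0.
by rewrite H.
Qed.

Lemma iter_opJ_ext k (h1 h2 : R -> R) : (forall s : R, 0 < s -> h1 s = h2 s) ->
  forall t : R, 0 < t -> iter k (@opJ R) h1 t = iter k (@opJ R) h2 t.
Proof.
move=> H; case: k => [|k] t t0; first exact: H.
elim: k t {t0} => [|k IH] t; first exact: opJ_ext.
by apply: opJ_ext => s _; exact: IH.
Qed.

Lemma opJ_FTC (h P w : R -> R) (t : R) : 0 <= t -> continuous w ->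
  (forall s : R, 0 < s -> h s * s = w s) -> w 0 = 0 ->
  (forall s : R, is_derive s 1 P (w s)) -> opJ h t = P t - P 0.
Proof.
move=> t0 cw hw w0 dP; rewrite -(@itv_int_FTC R 0 t P w t0 cw (fun s _ => dP s)).
apply: (@eq_itv_int _ 0 t) => s /andP[]; rewrite le_eqVlt => /predU1P[<- _|s0 _].
  by rewrite mulr0 w0.
exact: hw.
Qed.

Variable nu : nat.
Notation n := (2 * nu + 1).+2.
Implicit Types (g : 'rV[R]_n -> R) (x : 'rV[R]_n) (c : R).
Notation odd_fact := (odd_fact R).

Definition darboux_coef k : R := (2 * (nu - k) + 2)%:R.
Definition darboux_init k : R := (odd_fact (nu - k))^-1.

(** The operators obtained from the spherical mean by k steps of [darboux_step],
    with their time derivatives. *)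
Fixpoint darboux_chain c (k : nat) : op R n * op R n :=
  if k is k'.+1 then
    (fun g x t => t * (darboux_chain c k').2 g x t + (darboux_coef k' - 1) * (darboux_chain c k').1 g x t,
     fun g x t => t * c ^+ 2 * (darboux_chain c k').1 (laplacian g) x t)
  else (mean_op c (mean_const R nu), mean_op_dt c (mean_const R nu)).

Lemma darboux_initS k : (k < nu)%N -> (darboux_coef k - 1) * darboux_init k = darboux_init k.+1.
Proof.
move=> kn; rewrite /darboux_init /darboux_coef; have -> : (nu - k = (nu - k.+1).+1)%N.
  by rewrite subnSK.
set q := (nu - k.+1)%N.
have -> : (2 * q.+1 + 2)%:R - 1 = (2 * q.+1 + 1)%:R :> R by rewrite addnS -natr1 addrK.
by rewrite /= invfM mulrA mulfV ?mul1r// pnatr_eq0 addn1.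
Qed.

Lemma darboux_chain_correct c k : (k <= nu)%N -> darboux c (darboux_coef k) (darboux_init k) (darboux_chain c k).1 (darboux_chain c k).2.
Proof.
elim: k => [|k IH] kn.
  have := @darboux_mean R (2 * nu + 1)%N c (mean_const R nu).
  have e : darboux_coef 0 = (2 * nu + 1).+1%:R by rewrite /darboux_coef subn0 addnS.
  by rewrite mean_const_mass e /darboux_init subn0.
have := darboux_step (IH (ltnW kn)).
rewrite darboux_initS//= (_ : darboux_coef k - 2 = darboux_coef k.+1)//.
rewrite /darboux_coef; have -> : (nu - k = (nu - k.+1).+1)%N by rewrite subnSK.
by rewrite mulnS -addnA natrD addrC addKr.
Qed.

(** Each application of J divides the coefficient of t^(2l) by 2l + 2 and moves it
    to t^(2l+2) ([J_coefS]), while a new constant term, the initial value of the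
    next operator of the chain, appears at the front ([J_coef0]). *)
Definition J_coef k l : R := (odd_fact (nu - k + l) * (2 ^ l * l`!)%:R)^-1.

Lemma J_coef0 k : J_coef k 0 = darboux_init k.
Proof. by rewrite /J_coef /darboux_init addn0 mulr1. Qed.

Lemma J_coefS k l : (k < nu)%N -> J_coef k l / (2 * l + 2)%:R = J_coef k.+1 l.+1.
Proof.
move=> kn; rewrite /J_coef -invfM; congr (_^-1).
have -> : (nu - k + l = nu - k.+1 + l.+1)%N by rewrite addnS -addSn subnSK.
rewrite -mulrA -natrM; congr (_ * _%:R).
by rewrite factS expnS -[(2 * l + 2)%N]/(2 * l + 2 * 1)%N -mulnDr addn1; lia.
Qed.

Definition J_poly c k g x (t : R) : R :=
  \sum_(0 <= l < k) J_coef k l * (c * t) ^+ (2 * l) * iter l (@laplacian R n) g x.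

(** By induction on k: J integrates s times the left-hand side, and s c^2 times the
    k-th operator applied to Delta g is the derivative of the next operator. The
    lower limit 0 of the integral contributes the initial value, which becomes the
    term l = 0 of the polynomial. *)
Lemma iter_opJ_mean c k (a : R) g x t : smooth_fun g -> (k <= nu)%N -> 0 < t ->
  iter k (@opJ R) (fun s => a * c ^+ (2 * k) * (darboux_chain c 0).1 (iter k (@laplacian R n) g) x s) t
  = a * ((darboux_chain c k).1 g x t - J_poly c k g x t).
Proof.
elim: k a g t => [|k IH] a g t sg kn t0.
  by rewrite /J_poly big_geq// subr0 muln0 expr0 mulr1.
have sl := smooth_fun_lap sg.
have [gR gR1 dR [_ _] R0] := darboux_chain_correct c (ltnW kn).
have [gS _ dS _ S0] := darboux_chain_correct c kn.
(* w is s times the k-fold integral given by the induction hypothesis for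
   Delta g, and P is its primitive. *)
pose w (s : R) := a * (s * c ^+ 2 * (darboux_chain c k).1 (laplacian g) x s -
   \sum_(0 <= l < k) J_coef k l * c ^+ (2 * l.+1) * iter l.+1 (@laplacian R n) g x * s ^+ (2 * l + 1)).
pose P (s : R) := a * ((darboux_chain c k.+1).1 g x s -
   \sum_(0 <= l < k) J_coef k l * c ^+ (2 * l.+1) * iter l.+1 (@laplacian R n) g x *
     ((2 * l + 2)%:R^-1 * s ^+ (2 * l + 2))).
have dP (s : R) : is_derive s 1 P (w s).
  apply: drvZ; apply: drvB; first exact: dS.
  apply: drv_sum => l _; apply: drvZ.
  apply: drv_eq (drvZ _ (drvX (2 * l + 2) (drvid s))) _.
  by rewrite mulr1 mulKf ?addn2 ?addn1// pnatr_eq0.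
have cw : continuous w.
  apply: contM; first exact: cont_cst.
  apply: contD.
    apply: contM; last exact: op_cont_t.
    by apply: contM; [exact: cont_id|exact: cont_cst].
  apply: contN; apply: cont_sum => l _; apply: contM; first exact: cont_cst.
  by apply: contX; exact: cont_id.
have w0 : w 0 = 0.
  rewrite /w big1 ?subr0 ?mul0r ?mulr0// => l _.
  by rewrite (addn1 (2 * l)) expr0n /= mulr0.
have hw (s : R) : 0 < s -> iter k (@opJ R) (fun s => a * c ^+ (2 * k.+1) *
    (darboux_chain c 0).1 (iter k.+1 (@laplacian R n) g) x s) s * s = w s.
  move=> s0; have := IH (a * c ^+ 2) (laplacian g) s sl (ltnW kn) s0.
  have -> : (fun s => a * c ^+ 2 * c ^+ (2 * k) *
      (darboux_chain c 0).1 (iter k (@laplacian R n) (laplacian g)) x s) =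
    (fun s => a * c ^+ (2 * k.+1) * (darboux_chain c 0).1 (iter k.+1 (@laplacian R n) g) x s).
    by apply/funext => u; rewrite -iterSr mulnS exprD mulrA.
  move=> ->; rewrite /w.
  have -> : \sum_(0 <= l < k) J_coef k l * c ^+ (2 * l.+1) *
      iter l.+1 (@laplacian R n) g x * s ^+ (2 * l + 1) =
      c ^+ 2 * s * J_poly c k (laplacian g) x s.
    rewrite /J_poly mulr_sumr; apply: eq_bigr => l _; rewrite -iterSr.
    rewrite (mulnS 2 l) (addn1 (2 * l)) exprMn exprD [s ^+ (2 * l).+1]exprS.
    by move: (iter _ _ _ _) => u; ring.
  by move: (J_poly _ _ _ _ _) ((darboux_chain c k).1 _ _ _) => u v; ring.
have := @opJ_FTC _ P w t (ltW t0) cw hw w0 dP.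
rewrite -[opJ _ t]/(iter k.+1 (@opJ R) (fun s => a * c ^+ (2 * k.+1) *
    (darboux_chain c 0).1 (iter k.+1 (@laplacian R n) g) x s) t) => ->.
rewrite /P -mulrBr S0// [X in darboux_init _ * _ - X]big1 ?subr0; last first.
  by move=> l _; rewrite (addn2 (2 * l)) expr0n /= !mulr0.
congr (_ * _); rewrite /J_poly big_nat_recl// muln0 expr0 mulr1 J_coef0 /=.
rewrite -addrA -opprD; congr (_ - _); rewrite addrC; congr (_ + _).
apply: eq_bigr => l _; rewrite -J_coefS// exprMn (mulnS 2 l) [(2 + 2 * l)%N]addnC.
by move: (laplacian _ _) => u; ring.
Qed.

Lemma fact_odd_fact l : (2 * l + 1)`!%:R = odd_fact l * (2 ^ l * l`!)%:R :> R.
Proof.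
elim: l => [|l IH]; first by rewrite mulr1.
have -> : (2 * l.+1 + 1 = (2 * l + 1).+2)%N by lia.
rewrite (factS (2 * l + 1).+1) (factS (2 * l + 1)) (factS l) expnS !natrM IH /= !natrM.
have -> : (2 * l + 1).+2%:R = (2 * l.+1 + 1)%:R :> R by congr (_%:R); lia.
have -> : (2 * l + 1).+1%:R = 2%:R * l.+1%:R :> R by rewrite -natrM; congr (_%:R); lia.
by ring.
Qed.

Lemma iter_clap (c : R) k g : smooth_fun g ->
  iter k (fun (h : 'rV[R]_n -> R) y => c ^+ 2 * laplacian h y) g =
  (fun y => c ^+ (2 * k) * iter k (@laplacian R n) g y).
Proof.
move=> sg; elim: k => [|k IH].
  by apply/funext => y; rewrite muln0 expr0 mul1r.
rewrite iterS IH; apply/funext => y; rewrite mulnS exprD -mulrA; congr (_ * _).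
have := smooth_fun_iter_lap k sg; set h := iter k _ g => sh.
rewrite !laplacianE mulr_sumr; apply: eq_bigr => i _.
have e (u : 'rV[R]_n -> R) : smooth_fun u ->
    partial i (fun y => c ^+ (2 * k) * u y) = (fun y => c ^+ (2 * k) * partial i u y).
  by move=> su; apply: partialE => z; apply: drvZ; exact: smooth_drv.
by rewrite (e _ sh) (e _ (smooth_partial i sh)).
Qed.

Definition wave_op c : op R n := fun g x t => t * (darboux_chain c nu).1 g x t.
Definition wave_op_dt c : op R n := fun g x t => (darboux_chain c nu).1 g x t + t * (darboux_chain c nu).2 g x t.

Lemma wave_op_correct c : wave_solution c (wave_op c) (wave_op_dt c).
Proof.
apply: darboux_wave; have := darboux_chain_correct c (leqnn nu).
by rewrite /darboux_coef /darboux_init subnn invr1.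
Qed.

Lemma J_meanE c g x t : 0 < c -> smooth_fun g -> 0 <= t ->
  t * J_mean nu c g x t = wave_op c g x t -
    \sum_(0 <= l < nu) c ^+ (2 * l) * t ^+ (2 * l + 1) / ((2 * l + 1)`!)%:R
      * iter l (@laplacian R n) g x.
Proof.
move=> c0 sg; rewrite le_eqVlt => /predU1P[<-|t0].
  rewrite /wave_op !mul0r big1 ?subr0// => l _.
  by rewrite (addn1 (2 * l)) expr0n /= mulr0 !mul0r.
have [gM _ _ _ _] := darboux_chain_correct c (leq0n nu).
have -> : J_mean nu c g x t = iter nu (@opJ R) (fun s => 1 * c ^+ (2 * nu) *
    (darboux_chain c 0).1 (iter nu (@laplacian R n) g) x s) t.
  apply: iter_opJ_ext t0 => s s0; rewrite mul1r.
  have -> : sphere_mean nu (c * s) g = (fun y => (darboux_chain c 0).1 g y s).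
    apply/funext => y; rewrite sphere_meanE ?mulr_gt0//; last exact: smooth_cont.
    rewrite /= /mean_op /sphere_avg; congr (_ * _); congr sphere_int; apply/funext => z.
    by rewrite mul1r.
  rewrite (iter_clap c nu (smooth_fun_op s gM sg)).
  by rewrite (iter_lap_op s nu gM sg).
rewrite (iter_opJ_mean c 1 x sg (leqnn nu) t0) mul1r mulrBr; congr (_ - _).
rewrite /J_poly mulr_sumr; apply: eq_bigr => l _.
rewrite /J_coef subnn add0n -fact_odd_fact exprMn (addn1 (2 * l)) [t ^+ (2 * l).+1]exprS.
by move: (iter _ _ _ _) => u; ring.
Qed.

End JOperator.

(** * Iterated integration as convolution with a power *)

Section PowerConvolution.
Variable R : realType.
Implicit Types (w : R -> R) (t : R).

(** q-fold integration from 0, in the form of a single integral. *)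
Definition pow_conv q w t : R :=
  if q is q'.+1 then or_int t (fun s => (t - s) ^+ q' / (q'`!)%:R * w s) else w t.

Lemma cont_pow_sub (T : topologicalType) (f g : T -> R) q : continuous f -> continuous g ->
  continuous (fun p => (f p - g p) ^+ q / (q`!)%:R).
Proof.
move=> cf cg; apply: contM; last exact: cont_cst.
by apply: contX; apply: contD => //; exact: contN.
Qed.

Lemma pow_conv_derive q w t : continuous w ->
  is_derive t 1 (fun t => pow_conv q.+1 w t) (pow_conv q w t).
Proof.
move=> cw; have cws : continuous (fun p : R * R => w p.2) by exact: (cont_comp cw (@cont_snd _ _)).
pose K q' (t s : R) := (t - s) ^+ q' / (q'`!)%:R * w s.
have cK q' : continuous (fun p : R * R => K q' p.1 p.2).
  by apply: contM => //; apply: cont_pow_sub; [exact: cont_fst|exact: cont_snd].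
have := @or_int_leibniz R t (K q) (if q is q'.+1 then K q' else fun _ _ => 0) (cK q).
(* For q = 0 the kernel is constant and the derivative is the boundary term;
   for q > 0 the boundary term vanishes. *)
case: q => [|q] H.
  have -> : pow_conv 0 w t = K 0%N t t + or_int t (fun _ : R => 0 : R).
    have -> : or_int t (fun _ : R => 0 : R) = 0.
      by rewrite /or_int (eq_itv_int (G := fun=> 0)) ?itv_int_cst ?mul0r// => s _; rewrite mulr0.
    by rewrite /K /= expr0 fact0 divr1 mul1r addr0.
  apply: H; first exact: cont_cst.
  move=> u s; rewrite (_ : K 0%N ^~ s = fun _ => w s); first exact: drvc.
  by apply/funext => z; rewrite /K expr0 fact0 divr1 mul1r.
have -> : pow_conv q.+1 w t = K q.+1 t t + or_int t (K q t).
  by rewrite /K subrr expr0n /= !mul0r add0r.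
apply: H; first exact: cK.
move=> u s; have d : is_derive u 1 (fun u : R => u - s) 1.
  by apply: drv_eq (drvB (drvid u) (drvc _ _ s)) _; rewrite subr0.
apply: drv_eq (drvM (drvM (drvX q.+1 d) (drvc _ _ _)) (drvc _ _ (w s))) _.
rewrite /K /= !mulr0 !addr0 mulr1 factS natrM invfM.
have q0 : q.+1%:R != 0 :> R by rewrite pnatr_eq0.
by congr (_ * _); rewrite mulrA; congr (_ / _); rewrite mulrAC mulfV// mul1r.
Qed.

Lemma pow_conv_at0 q w : pow_conv q.+1 w 0 = 0.
Proof. exact: or_int_at0. Qed.

Lemma pow_conv_lin q (w1 w2 : R -> R) (c : R) t : continuous w1 -> continuous w2 ->
  pow_conv q (fun s => w1 s + c * w2 s) t = pow_conv q w1 t + c * pow_conv q w2 t.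
Proof.
move=> c1 c2; case: q => [//|q] /=; rewrite -or_int_lin.
- by congr or_int; apply/funext => s; ring.
- by apply: contM => //; apply: cont_pow_sub; [exact: cont_cst|exact: cont_id].
- by apply: contM => //; apply: cont_pow_sub; [exact: cont_cst|exact: cont_id].
Qed.

Lemma cont_monomial (p : nat) : continuous (fun s : R => s ^+ p / (p`!)%:R).
Proof. by apply: contM; [apply: contX; exact: cont_id|exact: cont_cst]. Qed.

Lemma drv_monomial (p : nat) (s : R) :
  is_derive s 1 (fun s : R => s ^+ p.+1 / (p.+1`!)%:R) (s ^+ p / (p`!)%:R).
Proof.
apply: drv_eq (drvM (drvX p.+1 (drvid s)) (drvc _ _ _)) _.
have p0 : p.+1%:R != 0 :> R by rewrite pnatr_eq0.
rewrite /= mulr0 addr0 mulr1 factS natrM invfM mulrA; congr (_ / _).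
by rewrite mulrAC mulfV// mul1r.
Qed.

Lemma pow_conv_monomial q p t :
  pow_conv q (fun s => s ^+ p / (p`!)%:R) t = t ^+ (p + q) / ((p + q)`!)%:R.
Proof.
suff -> : pow_conv q (fun s => s ^+ p / (p`!)%:R) =
  (fun t => t ^+ (p + q) / ((p + q)`!)%:R) by [].
elim: q => [|q IH]; first by rewrite addn0.
apply: (eq_from_deriv (d := fun t => t ^+ (p + q) / ((p + q)`!)%:R)).
- by move=> s; have dY := pow_conv_derive q s (@cont_monomial p); rewrite IH in dY.
- by move=> s; rewrite addnS; exact: drv_monomial.
- by rewrite pow_conv_at0 addnS expr0n /= mul0r.
Qed.

Lemma conv_powerE m (h w : R -> R) t : (0 < m)%N -> continuous w -> 0 <= t ->
  (forall s, 0 <= s <= t -> h s = w s) -> conv_power m h t = pow_conv (2 * m - 2) w t.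
Proof.
case: m => [//|[|m]] _ cw t0 hw; rewrite /conv_power /=.
  by rewrite hw// t0 lexx.
have -> : (2 * m.+2 - 2 = (2 * m.+2 - 3).+1)%N by lia.
rewrite /= or_int_itv_int//; last first.
  by apply: contM => //; apply: cont_pow_sub; [exact: cont_cst|exact: cont_id].
by apply: eq_itv_int => s hs; rewrite hw.
Qed.

End PowerConvolution.

(** * Integrated wave operators *)

Section GreenOperators.
Variables (R : realType) (n : nat).
Implicit Types (g : 'rV[R]_n -> R) (x : 'rV[R]_n) (c : R).

Definition pow_conv_op q (S : op R n) : op R n := fun g x t => pow_conv q (S g x) t.

Lemma regular_pow_conv_op q S : regular_op S -> regular_op (pow_conv_op q S).
Proof.
move=> gS; case: q => [//|q]; split.
- move=> F sF; have [cS _ _] := gS.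
  apply: (@or_int_cont R (R * ('rV[R]_n * R))%type
    (fun p s => (p.2.2 - s) ^+ q / (q`!)%:R * S (F p.1) p.2.1 s) (fun p => p.2.2)).
    have c1 : continuous (fun p : R * ('rV[R]_n * R) * R => p.1.2).
      exact: (cont_comp (@cont_snd _ _) (@cont_fst _ _)).
    apply: contM.
      by apply: cont_pow_sub; [exact: (cont_comp (@cont_snd _ _) c1)|exact: cont_snd].
    have cq : continuous (fun p : R * ('rV[R]_n * R) * R => (p.1.1, (p.1.2.1, p.2))).
      apply: cont_pair; first exact: (cont_comp (@cont_fst _ _) (@cont_fst _ _)).
      by apply: cont_pair; [exact: (cont_comp (@cont_fst _ _) c1)|exact: cont_snd].
    exact: (cont_comp (cS _ sF) cq).
  exact: (cont_comp (@cont_snd _ _) (@cont_snd _ _)).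
- move=> g k x t sg; have [cS dS _] := gS; apply: drv_line0.
  have := @or_int_param_derive R 0 t
    (fun u s => (t - s) ^+ q / (q`!)%:R * S g (x + u *: delta_mx 0 k) s)
    (fun u s => (t - s) ^+ q / (q`!)%:R * S (partial k g) (x + u *: delta_mx 0 k) s).
  rewrite /= scale0r addr0; apply.
  + move=> u; apply: contM; first by apply: cont_pow_sub; [exact: cont_cst|exact: cont_id].
    exact: (@op_cont_t _ _ S g (x + u *: delta_mx 0 k) gS sg).
  + apply: contM; first by apply: cont_pow_sub; [exact: cont_cst|exact: cont_snd].
    have cq : continuous (fun p : R * R => (0 : R, (x + p.1 *: delta_mx 0 k, p.2))).
      apply: cont_pair; first exact: cont_cst.
      apply: cont_pair; last exact: cont_snd.
      by apply: contVD; [exact: cont_cst|apply: contVZ; [exact: cont_fst|exact: cont_cst]].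
    exact: (cont_comp (cS _ (smooth_partial k sg)) cq).
  + move=> u s; apply: drvZ.
    exact: (drv_lineE x u (fun z => dS g k z s sg)).
- move=> g h x t sg sh; have [_ _ aS] := gS.
  rewrite -[pow_conv_op q.+1 S h x t]mul1r -(pow_conv_lin q.+1 1 t (@op_cont_t _ _ S g x gS sg) (@op_cont_t _ _ S h x gS sh)).
  by congr pow_conv; apply/funext => s; rewrite mul1r aS.
Qed.

Lemma pow_conv_op_dt q S : regular_op S -> time_derivative (pow_conv_op q.+1 S) (pow_conv_op q S).
Proof. by move=> gS g x t sg; apply: pow_conv_derive; exact: op_cont_t. Qed.

Variables (c : R) (W W1 : op R n).
Hypothesis wW : wave_solution c W W1.

Lemma wave_pow_conv1 g x t : smooth_fun g ->
  W1 g x t = c ^+ 2 * pow_conv_op 1 W (laplacian g) x t + g x.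
Proof.
move=> sg; have [gW gW1 dW dW1 W0] := wW.
suff H : W1 g x = (fun t => c ^+ 2 * pow_conv_op 1 W (laplacian g) x t + g x) by rewrite H.
apply: (eq_from_deriv (d := fun t => c ^+ 2 * W (laplacian g) x t)).
- by move=> s; exact: dW1.
- move=> s; have dY := drvZ (c ^+ 2) (pow_conv_op_dt 0 gW x s (smooth_fun_lap sg)).
  by apply: drv_eq (drvD dY (drvc _ _ (g x))) _; rewrite addr0.
- by rewrite /pow_conv_op pow_conv_at0 mulr0 add0r; have [_ ->] := W0 g x sg.
Qed.

(** Integrate w_tt = c^2 Delta w two more times than the left-hand side is
    integrated; the initial velocity contributes the power of t. *)
Lemma wave_pow_conv q g x t : smooth_fun g -> pow_conv_op q W g x t =
  c ^+ 2 * pow_conv_op q.+2 W (laplacian g) x t + t ^+ q.+1 / (q.+1`!)%:R * g x.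
Proof.
move=> sg; have [gW gW1 dW dW1 W0] := wW; have sl := smooth_fun_lap sg.
suff H : pow_conv_op q W g x = (fun t => c ^+ 2 * pow_conv_op q.+2 W (laplacian g) x t +
   t ^+ q.+1 / (q.+1`!)%:R * g x) by rewrite H.
have dr q' (s : R) : is_derive s 1 (fun t => c ^+ 2 * pow_conv_op q'.+2 W (laplacian g) x t +
   t ^+ q'.+1 / (q'.+1`!)%:R * g x)
   (c ^+ 2 * pow_conv_op q'.+1 W (laplacian g) x s + s ^+ q' / (q'`!)%:R * g x).
  apply: drvD; first by apply: drvZ; exact: (pow_conv_op_dt q'.+1 gW x s sl).
  by apply: drv_eq (drvM (drv_monomial q' s) (drvc _ _ _)) _; rewrite mulr0 addr0.
elim: q => [|q IH].
  apply: (eq_from_deriv (d := W1 g x)).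
  - by move=> s; exact: dW.
  - by move=> s; rewrite (wave_pow_conv1 x s sg); apply: drv_eq (dr 0%N s) _;
      rewrite expr0 fact0 divr1 mul1r.
  - rewrite /pow_conv_op pow_conv_at0 mulr0 add0r expr1 !mul0r /=.
    by have [-> _] := W0 g x sg.
apply: (eq_from_deriv (d := pow_conv_op q W g x)).
- by move=> s; exact: pow_conv_op_dt.
- by move=> s; apply: drv_eq (dr q.+1 s) _; rewrite IH.
- by rewrite /pow_conv_op !pow_conv_at0 mulr0 add0r expr0n /= !mul0r.
Qed.

(** The r-th time derivative of W, in which each pair of time derivatives is traded
    for c^2 Delta. *)
Definition wave_time_derivs r : op R n := fun g x t =>
  c ^+ (2 * r./2) * (if odd r then W1 else W) (iter r./2 (@laplacian R n) g) x t.

(** The i-th time derivative of the M-fold time integral of W: derivatives undo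
    integrations as long as there are any, and then fall on W. Defining the whole
    ladder at once gives every derivative a closed expression that is regular up
    to t = 0. *)
Fixpoint branch M i : op R n :=
  match M, i with
  | 0, r => wave_time_derivs r
  | M'.+1, 0 => pow_conv_op M'.+1 W
  | M'.+1, i'.+1 => branch M' i'
  end.

(** The error in the wave equation for the M-fold integral, differentiated i times:
    for M > 0 the i-th derivative of t^(M-1)/(M-1)!. It does not involve the speed c. *)
Definition branch_defect M i (t : R) : R :=
  if (i < M)%N then t ^+ (M - i.+1) / ((M - i.+1)`!)%:R else 0.

Lemma regular_branch M i : regular_op (branch M i).
Proof.
have [gW gW1 _ _ _] := wW.
elim: M i => [|M IH] [|i] /=; try exact: IH; last exact: regular_pow_conv_op.
  by apply: (regular_scale (@cont_cst R R _)); apply: regular_lap; exact: gW.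
apply: (regular_scale (@cont_cst R R _)); apply: regular_lap.
by case: (odd _).
Qed.

Lemma branch0 M g x t : branch M 0 g x t = pow_conv_op M W g x t.
Proof. by case: M => //=; rewrite /wave_time_derivs muln0 expr0 mul1r. Qed.

Lemma wave_time_derivs_even q : wave_time_derivs q.*2 = fun g x t => c ^+ (2 * q) * W (iter q (@laplacian R n) g) x t.
Proof. by rewrite /wave_time_derivs doubleK odd_double. Qed.

Lemma wave_time_derivs_odd q :
  wave_time_derivs q.*2.+1 = fun g x t => c ^+ (2 * q) * W1 (iter q (@laplacian R n) g) x t.
Proof. by rewrite /wave_time_derivs /= uphalf_double odd_double. Qed.

Lemma wave_time_derivs_dt r : time_derivative (wave_time_derivs r) (wave_time_derivs r.+1).
Proof.
have [gW gW1 dW dW1 _] := wW.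
rewrite -(odd_double_half r); case: (odd r); rewrite ?add1n ?add0n => g x t sg;
  have sl := smooth_fun_iter_lap r./2 sg; last first.
  by rewrite wave_time_derivs_odd wave_time_derivs_even; apply: drvZ; exact: (dW _ x t sl).
rewrite wave_time_derivs_odd -doubleS wave_time_derivs_even.
apply: drv_eq (drvZ (c ^+ (2 * r./2)) (dW1 _ x t sl)) _.
by rewrite (mulnS 2) exprD mulrCA mulrA.
Qed.

Lemma branch_dt M i : time_derivative (branch M i) (branch M i.+1).
Proof.
have [gW gW1 dW dW1 _] := wW.
elim: M i => [|M IH] [|i]; try exact: wave_time_derivs_dt; try exact: IH.
move=> g x t sg; apply: drv_eq (pow_conv_op_dt M gW x t sg) _.
by rewrite -[branch M.+1 1]/(branch M 0) branch0.
Qed.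

Lemma branch_recurrence M i g x t : smooth_fun g -> branch M i.+2 g x t =
  c ^+ 2 * branch M i (laplacian g) x t + branch_defect M i t * g x.
Proof.
move=> sg; elim: M i => [|M IH] [|i].
- by rewrite /= /wave_time_derivs /= /branch_defect /= mul0r addr0 muln0 expr0 mul1r.
- rewrite /= /wave_time_derivs /branch_defect /= mul0r addr0 negbK (mulnS 2) exprD -mulrA.
  by rewrite -iterSr.
- rewrite /branch_defect /=; case: M {IH} => [|M] /=.
    rewrite /wave_time_derivs /= muln0 expr0 mul1r (wave_pow_conv1 _ _ sg).
    by congr (_ + _); rewrite subnn expr0 fact0 divr1 mul1r.
  by rewrite branch0 (wave_pow_conv _ _ _ sg) subn1.
- rewrite -[LHS]/(branch M i.+2 g x t) IH; congr (_ + _).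
Qed.

Lemma branch_at0 M i g x : smooth_fun g -> (i <= M.+1)%N ->
  branch M i g x 0 = if i == M.+1 then g x else 0.
Proof.
move=> sg; have [_ _ _ _ W0] := wW.
elim: M i => [|M IH] [|i] //=.
- by rewrite /wave_time_derivs /= muln0 expr0 mul1r; have [-> _] := W0 g x sg.
- case: i => [|i] // _; rewrite /wave_time_derivs /= muln0 expr0 mul1r.
  by have [_ ->] := W0 g x sg.
- by move=> _; exact: or_int_at0.
- by rewrite ltnS => /IH ->.
Qed.

(** q steps of [branch_recurrence] trade 2q time derivatives for (c^2 Delta)^q; the
    defect of step l still undergoes the q - l - 1 later steps. *)
Lemma branch_recurrence_iter M i k q g x t : smooth_fun g -> branch M (2 * (k + q) + i) g x t =
  c ^+ (2 * q) * branch M (2 * k + i) (iter q (@laplacian R n) g) x t +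
  \sum_(l < q) c ^+ (2 * (q - l.+1)) * (branch_defect M (2 * (k + l) + i) t *
     iter (q - l.+1) (@laplacian R n) g x).
Proof.
move=> sg; elim: q => [|q IH] in g sg *.
  by rewrite big_ord0 addr0 muln0 expr0 mul1r addn0.
have -> : (2 * (k + q.+1) + i = (2 * (k + q) + i).+2)%N by lia.
rewrite (branch_recurrence _ _ _ _ sg) (IH _ (smooth_fun_lap sg)) mulrDr big_ord_recr /=.
rewrite subnn muln0 expr0 mul1r /= -iterSr mulrA -exprD addrA.
have -> : (2 + 2 * q = 2 * q.+1)%N by lia.
congr (_ + _ + _); rewrite mulr_sumr; apply: eq_bigr => l _.
have -> : (q.+1 - l.+1 = (q - l.+1).+1)%N by have := ltn_ord l; lia.
by rewrite iterSr (mulnS 2) exprD mulrA.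
Qed.

End GreenOperators.

(** * Lagrange's identities for power sums *)

Section Lagrange.
Variables (R : realType) (m : nat) (c : 'I_m -> R).
Hypothesis cinj : injective c.

Lemma lagrange_den j : \prod_(i < m | i != j) (c j - c i) != 0.
Proof.
by apply/prodf_neq0 => i ij; rewrite subr_eq0 (inj_eq cinj) eq_sym.
Qed.

Definition lagrange_num j : {poly R} := \prod_(i < m | i != j) ('X - (c i)%:P).

Lemma lagrange_num_monic j : lagrange_num j \is monic.
Proof. by apply: monic_prod => i _; exact: monicXsubC. Qed.

Lemma size_lagrange_num j : size (lagrange_num j) = m.
Proof.
rewrite /lagrange_num -big_filter size_prod_XsubC.
have -> : size [seq i <- index_enum 'I_m | i != j] = #|[pred i | i != j]|.
  by rewrite cardE /enum_mem.
by rewrite cardC1 card_ord prednK// (leq_ltn_trans _ (ltn_ord j)).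
Qed.

(** The Lagrange interpolation of X^p at m > p points is X^p itself; compare the
    coefficients of X^(m-1). *)
Lemma lagrange_power_sum p : (p < m)%N ->
  \sum_(j < m) c j ^+ p / \prod_(i < m | i != j) (c j - c i) = (p == m.-1)%:R.
Proof.
move=> pm; have m0 : (0 < m)%N by exact: leq_ltn_trans pm.
pose co j := c j ^+ p / \prod_(i < m | i != j) (c j - c i).
pose Q := \sum_(j < m) co j *: lagrange_num j.
(* Q interpolates X^p at the m nodes, and both have degree below m. *)
have QX : Q - 'X^p = 0.
  apply: (@roots_geq_poly_eq0 _ _ [seq c i | i <- enum 'I_m]).
  - apply/allP => _ /mapP[l _ ->]; rewrite rootE !hornerE horner_sum subr_eq0.
    rewrite (bigD1 l)//= big1 ?addr0 => [|j jl].
      rewrite hornerZ horner_prod /co.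
      rewrite [X in _ * X == _](eq_bigr (fun i => c l - c i)); last by move=> i _; rewrite ?hornerE.
      by rewrite -mulrA mulVf ?mulr1//; exact: lagrange_den.
    rewrite hornerZ horner_prod (bigD1 l) ?[l == j]eq_sym//=.
    by rewrite hornerXsubC subrr mul0r mulr0.
  - by rewrite map_inj_uniq// enum_uniq.
  - rewrite size_map size_enum_ord (leq_trans (size_polyD _ _))// geq_max.
    rewrite size_polyN size_polyXn pm andbT.
    apply: (leq_trans (size_sum _ _ _)); apply/bigmax_leqP => j _.
    by rewrite (leq_trans (size_scale_leq _ _))// size_lagrange_num.
have := congr1 (fun P : {poly R} => P`_m.-1) QX.
rewrite coefB coefXn coef0 coef_sum => /eqP; rewrite subr_eq0 eq_sym => /eqP.
rewrite [m.-1 == p]eq_sym => ->; apply: eq_bigr => j _.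
rewrite coefZ; have := lagrange_num_monic j.
by rewrite monicE lead_coefE size_lagrange_num => /eqP ->; rewrite mulr1.
Qed.

End Lagrange.

(** * The characteristic polynomial *)

Section Coefficients.
Variables (R : realType) (m : nat) (a : 'I_m -> R) (b : nat -> R).
Hypothesis hb : \sum_(0 <= k < m.+1) b (2 * k)%N *: 'X^(2 * k)
          = \prod_(i < m) ('X^2 - (a i ^+ 2)%:P).

Lemma char_root j : \sum_(0 <= k < m.+1) b (2 * k)%N * a j ^+ (2 * k) = 0.
Proof.
have := congr1 (fun P : {poly R} => P.[a j]) hb.
rewrite horner_sum horner_prod (bigD1 j)//= !hornerE subrr mul0r => H.
by rewrite -[RHS]H; apply: eq_bigr => k _; rewrite !hornerE.
Qed.

(** The polynomial is monic of degree 2m, so that P has leading part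
    (d/dt)^(2m). *)
Lemma char_lead : b (2 * m)%N = 1.
Proof.
have sz (i : 'I_m) : size ('X^2 - (a i ^+ 2)%:P) = 3.
  by rewrite size_XnsubC.
have mo (i : 'I_m) : 'X^2 - (a i ^+ 2)%:P \is monic.
  by rewrite monicE lead_coefE sz !coefE /= subr0.
have szp : size (\prod_(i < m) ('X^2 - (a i ^+ 2)%:P)) = (2 * m).+1.
  rewrite size_prod => [|i _]; last by rewrite monic_neq0.
  by rewrite (eq_bigr (fun=> 3%N)) ?sum_nat_const ?card_ord//; lia.
have : (\prod_(i < m) ('X^2 - (a i ^+ 2)%:P))`_(2 * m) = 1.
  have /monicP : \prod_(i < m) ('X^2 - (a i ^+ 2)%:P) \is monic by apply: monic_prod.
  by rewrite lead_coefE szp.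
rewrite -hb coef_sum => <-; rewrite big_nat_recr//= big_nat big1 ?add0r => [|k /andP[_ km]].
  by rewrite coefZ coefXn eqxx mulr1.
by rewrite coefZ coefXn gtn_eqF ?mulr0//; lia.
Qed.

End Coefficients.

(** * The fundamental solution *)

Section Green.
Variables (R : realType) (n m : nat) (a : 'I_m -> R) (b : nat -> R).
Hypothesis hm : (1 <= m)%N.
Hypothesis ainj : injective a.
Hypothesis apos : forall i, 0 < a i.
Hypothesis hb : \sum_(0 <= k < m.+1) b (2 * k)%N *: 'X^(2 * k)
          = \prod_(i < m) ('X^2 - (a i ^+ 2)%:P).
Variables W W1 : 'I_m -> op R n.
Hypothesis wW : forall j, wave_solution (a j) (W j) (W1 j).
Implicit Types (g : 'rV[R]_n -> R) (x : 'rV[R]_n).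

Lemma sqr_inj : injective (fun i => a i ^+ 2).
Proof. by move=> i j /eqP; rewrite eqrXn2 ?ltW// => /eqP; exact: ainj. Qed.

(** This brings A_j a_j^(-2p) into the form of [lagrange_power_sum] with nodes
    a_i^2 and exponent m - 1 - p. *)
Lemma coefA_pow j p : (p < m)%N ->
  coefA a j / a j ^+ (2 * p) =
  (a j ^+ 2) ^+ (m.-1 - p) / \prod_(i < m | i != j) (a j ^+ 2 - a i ^+ 2).
Proof.
move=> pm; rewrite /coefA mulrAC; congr (_ / _).
have a0 : a j != 0 by rewrite gt_eqF.
have -> : (2 * m - 2 = 2 * (m.-1 - p) + 2 * p)%N by lia.
by rewrite exprD mulfK ?expf_neq0// exprM.
Qed.

Lemma sum_coefA : \sum_j coefA a j = 1.
Proof.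
have mm : (m.-1 < m)%N by rewrite prednK.
have := lagrange_power_sum sqr_inj mm; rewrite eqxx => H; apply: etrans H.
apply: eq_bigr => j _; have := @coefA_pow j 0 hm.
by rewrite muln0 expr0 divr1 subn0.
Qed.

(** The i-th time derivative of the fundamental solution. *)
Definition green_op i : op R n := fun g x t =>
  \sum_j coefA a j * branch (a j) (W j) (W1 j) (2 * m - 2) i g x t.

Lemma regular_green_op i : regular_op (green_op i).
Proof.
by apply: regular_sum => j; apply: (regular_scale (@cont_cst R R _)); exact: (regular_branch (wW j)).
Qed.

Lemma green_op_dt i : time_derivative (green_op i) (green_op i.+1).
Proof.
move=> g x t sg; apply: (@drv_sum R _ _ _ _ _ xpredT
  (fun j s => coefA a j * branch (a j) (W j) (W1 j) (2 * m - 2) i g x s)) => j _.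
by apply: drvZ; exact: (branch_dt (wW j)).
Qed.

Lemma green_op_at0 i g x : smooth_fun g -> (i < 2 * m)%N ->
  green_op i g x 0 = if i == (2 * m - 1)%N then g x else 0.
Proof.
move=> sg im; rewrite /green_op.
rewrite (eq_bigr (fun j => coefA a j * (if i == (2 * m - 1)%N then g x else 0))).
  by rewrite -mulr_suml sum_coefA mul1r.
move=> j _; rewrite (branch_at0 (wW j))//; last by lia.
by have -> : ((2 * m - 2).+1 = 2 * m - 1)%N by lia.
Qed.

(** Read from right to left, [branch_recurrence_iter] expresses the time derivative
    of order 2k + i at Delta^(m-k) g by the one of order 2m + i at g, with factor
    a_j^(-2(m-k)), up to defects with factors a_j^(-2(l+1)). Where l + 1 >= m the
    defect itself is zero; elsewhere the sum over j cancels it. What remains of the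
    j-th summand contains the factor sum_k b_{2k} a_j^{2k}, which is zero. *)
Lemma green_op_annihilated i g x t : smooth_fun g ->
  \sum_(0 <= k < m.+1) b (2 * k)%N *
     green_op (2 * k + i) (iter (m - k) (@laplacian R n) g) x t = 0.
Proof.
move=> sg; set M := (2 * m - 2)%N.
pose D j q h := branch (a j) (W j) (W1 j) M q h x t.
have E k : (k <= m)%N -> green_op (2 * k + i) (iter (m - k) (@laplacian R n) g) x t =
    \sum_j coefA a j / a j ^+ (2 * (m - k)) * D j (2 * m + i)%N g.
  move=> km.
  have Dj j : D j (2 * k + i)%N (iter (m - k) (@laplacian R n) g) =
    (a j ^+ (2 * (m - k)))^-1 * D j (2 * m + i)%N g -
    \sum_(l < m - k) (a j ^+ (2 * l.+1))^-1 * (branch_defect M (2 * (k + l) + i) t *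
       iter (m - k - l.+1) (@laplacian R n) g x).
    have aj0 q : a j ^+ q != 0 by rewrite expf_neq0// gt_eqF.
    have := @branch_recurrence_iter _ _ _ _ _ (wW j) M i k (m - k) g x t sg.
    rewrite subnKC// -/(D j (2 * m + i)%N g) => ->.
    rewrite mulrDr mulKf// mulr_sumr -addrA -sumrB big1 ?addr0// => l _.
    have -> : (2 * (m - k) = 2 * (m - k - l.+1) + 2 * l.+1)%N.
      by have := ltn_ord l; lia.
    have a1 := aj0 (2 * (m - k - l.+1))%N; have a2 := aj0 (2 * l.+1)%N.
    rewrite exprD; move: (branch_defect _ _ _ * _) a1 a2 => X a1 a2.
    by field; apply/andP.
  rewrite /green_op (eq_bigr (fun j => coefA a j / a j ^+ (2 * (m - k)) * D j (2 * m + i)%N g -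
    \sum_(l < m - k) coefA a j / a j ^+ (2 * l.+1) * (branch_defect M (2 * (k + l) + i) t *
       iter (m - k - l.+1) (@laplacian R n) g x))); last first.
    move=> j _; rewrite -/(D j _ _) Dj mulrBr mulrA; congr (_ - _).
    rewrite mulr_sumr; apply: eq_bigr => l _; exact: mulrA.
  rewrite sumrB exchange_big /= [X in _ - X]big1 ?subr0// => l _.
  rewrite -mulr_suml /branch_defect; case: ifPn => [lt|_]; last by rewrite mul0r mulr0.
  (* A defect of order below M = 2m - 2 forces l + 1 < m, the range of
     Lagrange's identities. *)
  have lm : (l.+1 < m)%N by move: lt; rewrite /M; lia.
  rewrite (eq_bigr _ (fun j _ => @coefA_pow j l.+1 lm)).
  rewrite (lagrange_power_sum sqr_inj); last by lia.
  by rewrite ltn_eqF ?mul0r//; lia.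
rewrite big_nat (eq_bigr (fun k => \sum_j coefA a j / a j ^+ (2 * m) * D j (2 * m + i)%N g *
    (b (2 * k)%N * a j ^+ (2 * k)))); last first.
  move=> k; rewrite ltnS => km; rewrite E// mulr_sumr; apply: eq_bigr => j _.
  have a0 : a j != 0 by rewrite gt_eqF.
  have -> : (2 * m = 2 * k + 2 * (m - k))%N by lia.
  rewrite exprD invfM.
  have ak : a j ^+ (2 * k) != 0 by rewrite expf_neq0.
  have amk : a j ^+ (2 * (m - k)) != 0 by rewrite expf_neq0.
  by move: (D _ _ _) (coefA _ _) (b _) => *; field; apply/andP.
rewrite -big_nat exchange_big /= big1// => j _.
by rewrite -mulr_sumr (char_root hb) mulr0.
Qed.

End Green.

(** * Solution of the initial value problem *)

Section Solution.
Variables (R : realType) (n m : nat) (a : 'I_m -> R) (b : nat -> R).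
Hypothesis hm : (1 <= m)%N.
Hypothesis ainj : injective a.
Hypothesis apos : forall i, 0 < a i.
Hypothesis hb : \sum_(0 <= k < m.+1) b (2 * k)%N *: 'X^(2 * k)
          = \prod_(i < m) ('X^2 - (a i ^+ 2)%:P).
Variables W W1 : 'I_m -> op R n.
Hypothesis wW : forall j, wave_solution (a j) (W j) (W1 j).
Implicit Types (g : 'rV[R]_n -> R) (x : 'rV[R]_n) (F : R -> 'rV[R]_n -> R)
  (phi : nat -> 'rV[R]_n -> R) (t : R).
Notation G := (green_op a W W1).
Notation lap q := (iter q (@laplacian R n)).

Let green_regular i : regular_op (G i) := regular_green_op wW i.

(** The i-th time derivative of Duhamel's integral for i <= 2m. The boundary terms
    of the differentiation vanish up to order 2m - 1; the step to order 2m produces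
    F itself. *)
Definition duhamel i F x t : R :=
  or_int t (fun tau => G i (F tau) x (t - tau)) + (if i == (2 * m)%N then F t x else 0).

(** The i-th time derivative of the part of the solution that carries the initial
    values phi. *)
Definition cauchy i phi x t : R :=
  \sum_(0 <= k < m.+1) b (2 * k)%N *
    \sum_(0 <= r < 2 * k) G (2 * k - 1 - r + i) (lap (m - k) (phi r)) x t.

Definition sol i F phi x t : R := duhamel i F x t + cauchy i phi x t.

Lemma cont_duhamel_kernel (T : topologicalType) i F (x : T -> 'rV[R]_n) (t s : T -> R) :
  smooth_family F -> continuous x -> continuous t -> continuous s ->
  continuous (fun p => G i (F (s p)) (x p) (t p - s p)).
Proof.
move=> sF cx ct cs; have [cG _ _] := green_regular i.
have cp : continuous (fun p => (s p, (x p, t p - s p))).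
  apply: cont_pair => //; apply: cont_pair => //.
  by apply: contD => //; exact: contN.
exact: (cont_comp (cG _ sF) cp).
Qed.

Lemma duhamel_cont i F : smooth_family F ->
  continuous (fun z : 'rV[R]_n * R => duhamel i F z.1 z.2).
Proof.
move=> sF; apply: contD.
  apply: (@or_int_cont R ('rV[R]_n * R)%type
    (fun z tau => G i (F tau) z.1 (z.2 - tau)) (fun z => z.2)); last exact: cont_snd.
  apply: cont_duhamel_kernel => //.
  - exact: (cont_comp (@cont_fst _ _) (@cont_fst _ _)).
  - exact: (cont_comp (@cont_snd _ _) (@cont_fst _ _)).
  - exact: cont_snd.
case: (i == _); last exact: cont_cst.
by apply: (cont_comp2 (smooth_family_cont sF)); [exact: cont_snd|exact: cont_fst].
Qed.

Lemma duhamel_dx i F k x t : smooth_family F ->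
  is_derive x (delta_mx 0 k) (fun y => duhamel i F y t)
    (duhamel i (fun tau => partial k (F tau)) x t).
Proof.
move=> sF; apply: drvD; last first.
  by case: (i == _); [exact: smooth_family_drv|exact: drvc].
apply: drv_line0.
have := @or_int_param_derive R 0 t
  (fun u s => G i (F s) (x + u *: delta_mx 0 k) (t - s))
  (fun u s => G i (partial k (F s)) (x + u *: delta_mx 0 k) (t - s)).
rewrite /= scale0r addr0; apply.
- move=> u; apply: cont_duhamel_kernel => //; [exact: cont_cst|exact: cont_cst|exact: cont_id].
- apply: (@cont_duhamel_kernel (R * R)%type i (fun s => partial k (F s))
    (fun p => x + p.1 *: delta_mx 0 k) (fun p => t) (fun p => p.2) (smooth_family_partial k sF)).
  + by apply: contVD; [exact: cont_cst|apply: contVZ; [exact: cont_fst|exact: cont_cst]].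
  + exact: cont_cst.
  + exact: cont_snd.
- move=> u s; have [_ dG _] := green_regular i.
  exact: (drv_lineE x u (fun z => dG (F s) k z (t - s) (smooth_family_slice s sF))).
Qed.

Lemma duhamel_dt i F x t : smooth_family F -> (i < 2 * m)%N ->
  is_derive t 1 (duhamel i F x) (duhamel i.+1 F x t).
Proof.
move=> sF im.
have -> : duhamel i F x = fun t => or_int t (fun tau => G i (F tau) x (t - tau)).
  by apply/funext => s; rewrite /duhamel ltn_eqF// addr0.
have := @or_int_leibniz R t (fun u s => G i (F s) x (u - s))
  (fun u s => G i.+1 (F s) x (u - s)).
move=> H; apply: drv_eq (H _ _ _) _.
- by apply: cont_duhamel_kernel => //; [exact: cont_cst|exact: cont_fst|exact: cont_snd].
- by apply: cont_duhamel_kernel => //; [exact: cont_cst|exact: cont_fst|exact: cont_snd].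
- move=> u s; have du : is_derive u 1 (fun u : R => u - s) 1.
    by apply: drv_eq (drvB (drvid u) (drvc _ _ s)) _; rewrite subr0.
  have dG := green_op_dt wW i x (u - s) (smooth_family_slice s sF).
  have dc := @drv_comp R (G i (F s) x) (fun u : R => u - s) u _ _ dG du.
  by apply: drv_eq dc _; rewrite mulr1.
(* The boundary term G i (F t) x 0 is F t x when i = 2m - 1 and 0 before. *)
rewrite subrr (green_op_at0 hm ainj apos wW x (smooth_family_slice t sF) im) addrC /duhamel.
congr (_ + _); have -> : (i.+1 == 2 * m)%N = (i == 2 * m - 1)%N by lia.
by [].
Qed.

Lemma cauchy_cont i phi : (forall r, smooth_fun (phi r)) ->
  continuous (fun z : 'rV[R]_n * R => cauchy i phi z.1 z.2).
Proof.
move=> sphi; apply: cont_sum => k _; apply: contM; first exact: cont_cst.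
apply: cont_sum => r _; have [cG _ _] := green_regular (2 * k - 1 - r + i).
have cp : continuous (fun z : 'rV[R]_n * R => (0 : R, (z.1, z.2))).
  by apply: cont_pair; [exact: cont_cst|apply: cont_pair; [exact: cont_fst|exact: cont_snd]].
exact: (cont_comp (cG _ (smooth_fun_iter_lap (m - k) (sphi r))) cp).
Qed.

Lemma cauchy_dx i phi k x t : (forall r, smooth_fun (phi r)) ->
  is_derive x (delta_mx 0 k) (fun y => cauchy i phi y t)
    (cauchy i (fun r => partial k (phi r)) x t).
Proof.
move=> sphi.
apply: (@drv_sum R _ _ _ _ _ xpredT (fun k y => b (2 * k)%N *
    \sum_(0 <= r < 2 * k) G (2 * k - 1 - r + i) (lap (m - k) (phi r)) y t)) => l _.
apply: drvZ; apply: (@drv_sum R _ _ _ _ _ xpredT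
  (fun r y => G (2 * l - 1 - r + i) (lap (m - l) (phi r)) y t)) => r _.
rewrite -(partial_iter_lap (m - l) k (sphi r)).
by have [_ dG _] := green_regular (2 * l - 1 - r + i); apply: dG; exact: smooth_fun_iter_lap.
Qed.

Lemma cauchy_dt i phi x t : (forall r, smooth_fun (phi r)) ->
  is_derive t 1 (cauchy i phi x) (cauchy i.+1 phi x t).
Proof.
move=> sphi.
apply: (@drv_sum R _ _ _ _ _ xpredT (fun k t => b (2 * k)%N *
    \sum_(0 <= r < 2 * k) G (2 * k - 1 - r + i) (lap (m - k) (phi r)) x t)) => l _.
apply: drvZ; apply: (@drv_sum R _ _ _ _ _ xpredT
  (fun r t => G (2 * l - 1 - r + i) (lap (m - l) (phi r)) x t)) => r _.
by rewrite addnS; apply: (green_op_dt wW); exact: smooth_fun_iter_lap.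
Qed.

Lemma sol_cont i F phi : smooth_family F -> (forall r, smooth_fun (phi r)) ->
  continuous (fun z : 'rV[R]_n * R => sol i F phi z.1 z.2).
Proof. by move=> sF sphi; apply: contD; [exact: duhamel_cont|exact: cauchy_cont]. Qed.

Lemma sol_dx i F phi k x t : smooth_family F -> (forall r, smooth_fun (phi r)) ->
  is_derive x (delta_mx 0 k) (fun y => sol i F phi y t)
    (sol i (fun tau => partial k (F tau)) (fun r => partial k (phi r)) x t).
Proof. by move=> sF sphi; apply: drvD; [exact: duhamel_dx|exact: cauchy_dx]. Qed.

Lemma sol_dt i F phi x t : smooth_family F -> (forall r, smooth_fun (phi r)) -> (i < 2 * m)%N ->
  is_derive t 1 (sol i F phi x) (sol i.+1 F phi x t).
Proof. by move=> sF sphi im; apply: drvD; [exact: duhamel_dt|exact: cauchy_dt]. Qed.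

(** Induction over the order, in the stronger form with i time derivatives already
    taken: an x-derivative changes the data, a time derivative raises i. *)
Lemma sol_Ck_half N i F phi : smooth_family F -> (forall r, smooth_fun (phi r)) ->
  (N + i <= 2 * m)%N -> Ck_half N (sol i F phi).
Proof.
elim: N i F phi => [|N IH] i F phi sF sphi Ni; split => //.
- by apply: continuous_subspaceT; exact: sol_cont.
- by apply: continuous_subspaceT; exact: sol_cont.
move=> [k|].
  split; first by move=> x t _; have [] := sol_dx i k x t sF sphi.
  exists (sol i (fun tau => partial k (F tau)) (fun r => partial k (phi r))).
    by move=> x t _; have [_ <-] := sol_dx i k x t sF sphi.
  apply: IH; [exact: smooth_family_partial|by move=> r; apply: smooth_partial; exact: sphi|by lia].
have im : (i < 2 * m)%N by lia.
split; first by move=> x t _; have [] := sol_dt x t sF sphi im.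
exists (sol i.+1 F phi); last by apply: IH => //; lia.
by move=> x t _; rewrite /= derive1E; have [_ <-] := sol_dt x t sF sphi im.
Qed.

Lemma sol_derive1n i F phi x : smooth_family F -> (forall r, smooth_fun (phi r)) -> (i <= 2 * m)%N ->
  derive1n i (sol 0 F phi x) = sol i F phi x.
Proof.
move=> sF sphi; elim: i => [//|i IH] im; rewrite derive1nS IH; last by lia.
apply/funext => t; rewrite derive1E.
by have [_ <-] := sol_dt x t sF sphi im.
Qed.

Lemma or_intD t (w1 w2 : R -> R) : continuous w1 -> continuous w2 ->
  or_int t (fun s => w1 s + w2 s) = or_int t w1 + or_int t w2.
Proof.
move=> c1 c2; rewrite -[or_int t w2]mul1r -or_int_lin//.
by congr or_int; apply/funext => s; rewrite mul1r.
Qed.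

Lemma or_int_zero t : or_int t (fun _ : R => 0 : R) = 0.
Proof.
by rewrite /or_int (eq_itv_int (G := fun=> 0)) ?itv_int_cst ?mul0r// => s _; rewrite mulr0.
Qed.

Lemma or_int_sum t (I : Type) (r : seq I) (w : I -> R -> R) (e : I -> R) :
  (forall i, continuous (w i)) ->
  or_int t (fun s => \sum_(i <- r) e i * w i s) = \sum_(i <- r) e i * or_int t (w i).
Proof.
move=> cw; elim: r => [|i r IH].
  rewrite big_nil -[RHS](or_int_zero t); congr or_int.
  by apply/funext => s; rewrite big_nil.
rewrite big_cons -IH addrC -or_int_lin//; last first.
  by apply: cont_sum => j _; apply: contM => //; exact: cont_cst.
by congr or_int; apply/funext => s; rewrite big_cons addrC.
Qed.

Lemma sol_add i F1 F2 phi1 phi2 x t : smooth_family F1 -> smooth_family F2 ->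
  (forall r, smooth_fun (phi1 r)) -> (forall r, smooth_fun (phi2 r)) ->
  sol i (fun tau y => F1 tau y + F2 tau y) (fun r y => phi1 r y + phi2 r y) x t =
  sol i F1 phi1 x t + sol i F2 phi2 x t.
Proof.
move=> s1 s2 p1 p2; rewrite /sol addrACA; congr (_ + _).
  rewrite /duhamel addrACA -or_intD; first last.
  - by apply: cont_duhamel_kernel => //; [exact: cont_cst|exact: cont_cst|exact: cont_id].
  - by apply: cont_duhamel_kernel => //; [exact: cont_cst|exact: cont_cst|exact: cont_id].
  congr (_ + _); last by case: (_ == _); rewrite ?addr0.
  congr or_int; apply/funext => s; have [_ _ aG] := green_regular i.
  exact: (aG _ _ _ _ (smooth_family_slice s s1) (smooth_family_slice s s2)).
rewrite /cauchy -big_split /=; apply: eq_bigr => k _.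
rewrite -mulrDr -big_split /=; congr (_ * _); apply: eq_bigr => r _.
have [_ _ aG] := green_regular (2 * k - 1 - r + i).
rewrite (iter_lapD (m - k) (p1 r) (p2 r)).
exact: (aG _ _ _ _ (smooth_fun_iter_lap (m - k) (p1 r)) (smooth_fun_iter_lap (m - k) (p2 r))).
Qed.

Lemma sol_zero i x t : sol i (fun _ _ => 0) (fun _ _ => 0) x t = 0.
Proof.
have s0 := @smooth_family0 R n; have := @sol_add i _ _ _ _ x t s0 s0 (fun=> s0) (fun=> s0).
rewrite (_ : (fun _ _ => 0 + 0) = (fun _ _ => 0)); last first.
  by apply/funext => u; apply/funext => y; rewrite addr0.
rewrite (_ : (fun (_ : nat) _ => 0 + 0) = (fun _ _ => 0)); last first.
  by apply/funext => u; apply/funext => y; rewrite addr0.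
by move=> /eqP; rewrite -subr_eq0 opprD addNKr oppr_eq0 => /eqP.
Qed.

Lemma sol_sum i (I : Type) (s : seq I) (F : I -> R -> 'rV[R]_n -> R)
    (phi : I -> nat -> 'rV[R]_n -> R) x t :
  (forall k, smooth_family (F k)) -> (forall k r, smooth_fun (phi k r)) ->
  sol i (fun tau y => \sum_(k <- s) F k tau y) (fun r y => \sum_(k <- s) phi k r y) x t
  = \sum_(k <- s) sol i (F k) (phi k) x t.
Proof.
move=> sF sphi; elim: s => [|k s IH].
  have eF : (fun tau y => \sum_(k <- [::]) F k tau y) = (fun _ _ => 0).
    by apply/funext => u; apply/funext => y; rewrite big_nil.
  have ephi : (fun r y => \sum_(k <- [::]) phi k r y) = (fun _ _ => 0).
    by apply/funext => u; apply/funext => y; rewrite big_nil.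
  by rewrite eF ephi [RHS]big_nil; exact: sol_zero.
have eF : (fun tau y => \sum_(k <- k :: s) F k tau y) =
    (fun tau y => F k tau y + \sum_(k <- s) F k tau y).
  by apply/funext => u; apply/funext => y; rewrite big_cons.
have ephi : (fun r y => \sum_(k <- k :: s) phi k r y) =
    (fun r y => phi k r y + \sum_(k <- s) phi k r y).
  by apply/funext => u; apply/funext => y; rewrite big_cons.
rewrite eF ephi [RHS]big_cons -[X in _ = _ + X]IH.
exact: (sol_add i x t (sF k) (smooth_family_sum s sF) (sphi k)
  (fun r => smooth_family_sum s (fun k => sphi k r))).
Qed.

Lemma sol_lap i F phi t : smooth_family F -> (forall r, smooth_fun (phi r)) ->
  laplacian (fun y => sol i F phi y t) =
  (fun y => sol i (fun tau => laplacian (F tau)) (fun r => laplacian (phi r)) y t).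
Proof.
move=> sF sphi; apply/funext => x.
have -> := sol_sum i (index_enum 'I_n) x t (fun k => smooth_family_partial k (smooth_family_partial k sF))
  (fun k r => smooth_partial k (smooth_partial k (sphi r))).
rewrite laplacianE; apply: eq_bigr => k _.
have -> : partial k (fun y => sol i F phi y t) =
  (fun y => sol i (fun tau => partial k (F tau)) (fun r => partial k (phi r)) y t).
  by apply: partialE => y; exact: sol_dx.
rewrite (partialE (fun y => sol_dx i k y t (smooth_family_partial k sF) (fun r => smooth_partial k (sphi r)))).
by [].
Qed.

Lemma sol_iter_lap q i F phi t : smooth_family F -> (forall r, smooth_fun (phi r)) ->
  lap q (fun y => sol i F phi y t) =
  (fun y => sol i (fun tau => lap q (F tau)) (fun r => lap q (phi r)) y t).
Proof.
move=> sF sphi; elim: q => [//|q IH].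
by rewrite iterS IH (sol_lap _ _ (smooth_family_iter_lap q sF) (fun r => smooth_fun_iter_lap q (sphi r))).
Qed.

(** For each pair (l, r) of the initial-value part the sum over the terms of P is
    an instance of [green_op_annihilated]. *)
Lemma cauchy_pde phi x t : (forall r, smooth_fun (phi r)) ->
  \sum_(0 <= k < m.+1) b (2 * k)%N *
    cauchy (2 * k) (fun r => lap (m - k) (phi r)) x t = 0.
Proof.
move=> sphi; rewrite /cauchy.
under eq_bigr do rewrite mulr_sumr.
rewrite exchange_big big1// => l _.
rewrite (eq_bigr (fun k => b (2 * l)%N * \sum_(0 <= r < 2 * l)
   b (2 * k)%N * G (2 * k + (2 * l - 1 - r)) (lap (m - k) (lap (m - l) (phi r))) x t)).
  rewrite -mulr_sumr exchange_big /= big1 ?mulr0// => r _.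
  exact: (green_op_annihilated hm ainj apos hb wW _ _ _ (smooth_fun_iter_lap (m - l) (sphi r))).
move=> k _; rewrite mulrCA; congr (_ * _); rewrite mulr_sumr; apply: eq_bigr => r _.
by rewrite addnC -!iterD [(m - l + _)%N]addnC.
Qed.

(** Under the integral P annihilates the fundamental solution, and the extra term of
    order 2m is the source because P is monic in d/dt. *)
Lemma duhamel_pde F x t : smooth_family F ->
  \sum_(0 <= k < m.+1) b (2 * k)%N *
    duhamel (2 * k) (fun tau => lap (m - k) (F tau)) x t = F t x.
Proof.
move=> sF; rewrite /duhamel.
under eq_bigr do rewrite mulrDr.
rewrite big_split /= -or_int_sum; last first.
  move=> k; exact: (@cont_duhamel_kernel R (2 * k) (fun tau => lap (m - k) (F tau))
    (fun=> x) (fun=> t) (fun s => s) (smooth_family_iter_lap (m - k) sF)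
    (@cont_cst _ _ _) (@cont_cst _ _ _) (@cont_id _)).
rewrite (_ : (fun s => _) = fun=> 0); last first.
  apply/funext => s.
  have H := green_op_annihilated hm ainj apos hb wW 0 x (t - s) (smooth_family_slice s sF).
  by apply: etrans H; apply: eq_bigr => k _; rewrite addn0.
rewrite or_int_zero add0r big_nat_recr//= big_nat big1 ?add0r => [|k /andP[_ km]].
  by rewrite eqxx (char_lead hb) mul1r subnn.
by rewrite eqn_pmul2l// ltn_eqF// mulr0.
Qed.

Lemma sol_pde F phi x t : smooth_family F -> (forall r, smooth_fun (phi r)) ->
  \sum_(0 <= k < m.+1) b (2 * k)%N *
    lap (m - k) (fun y => sol (2 * k) F phi y t) x = F t x.
Proof.
move=> sF sphi; rewrite -[RHS]addr0 -[X in _ = X + _](duhamel_pde x t sF).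
rewrite -[X in _ = _ + X](cauchy_pde x t sphi) -big_split /=; apply: eq_bigr => k _.
by rewrite (sol_iter_lap _ _ _ sF sphi) /sol mulrDr.
Qed.

(** Collect the terms with data phi_r. For r > i all time orders are below 2m - 1,
    so everything vanishes at t = 0. For r = i only k = m reaches the order 2m - 1.
    For r < i the restriction r < 2k may be dropped, since for 2k <= r the order
    2k + i - 1 - r is below 2m - 1 as well, and the full sum over k is an instance
    of [green_op_annihilated]. *)
Lemma cauchy_at0 i phi x : (forall r, smooth_fun (phi r)) -> (i < 2 * m)%N ->
  cauchy i phi x 0 = phi i x.
Proof.
move=> sphi im.
pose g k r := G (2 * k - 1 - r + i) (lap (m - k) (phi r)) x 0.
have -> : cauchy i phi x 0 = \sum_(0 <= r < 2 * m) \sum_(0 <= k < m.+1)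
    b (2 * k)%N * (if (r < 2 * k)%N then g k r else 0).
  rewrite [RHS]exchange_big /= /cauchy; apply: eq_big_nat => k /andP[_ km].
  rewrite -mulr_sumr; congr (_ * _).
  rewrite (big_nat_widen 0 (2 * k) (2 * m)); last by lia.
  by rewrite big_mkcond.
have at0 q h : smooth_fun h -> (q < 2 * m - 1)%N -> G q h x 0 = 0.
  move=> sh qm; rewrite (green_op_at0 hm ainj apos wW x sh); last by lia.
  by rewrite ltn_eqF.
have Z r : (r < 2 * m)%N -> \sum_(0 <= k < m.+1)
    b (2 * k)%N * (if (r < 2 * k)%N then g k r else 0) = if r == i then phi i x else 0.
  move=> rm; case: (ltngtP r i) => [ri|ir|->].
  - have := green_op_annihilated hm ainj apos hb wW (i - 1 - r) x 0 (sphi r) => H.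
    apply: etrans H; apply: eq_bigr => k _; congr (_ * _).
    case: ltnP => rk.
      by rewrite /g; congr (green_op _ _ _ _ _ _ _); lia.
    by rewrite at0//; [exact: smooth_fun_iter_lap|lia].
  - rewrite big_nat big1// => k /andP[_ km]; case: ltnP => rk; last by rewrite mulr0.
    by rewrite /g at0 ?mulr0//; [exact: smooth_fun_iter_lap|lia].
  - rewrite big_nat_recr//= im big_nat big1 ?add0r => [|k /andP[_ km]].
      rewrite /g (char_lead hb) mul1r subnn (green_op_at0 hm ainj apos wW x (sphi i)); last by lia.
      by have -> : (2 * m - 1 - i + i == 2 * m - 1)%N by lia.
    case: ltnP => rk; last by rewrite mulr0.
    by rewrite /g at0 ?mulr0//; [exact: smooth_fun_iter_lap|lia].
rewrite big_nat (eq_bigr (fun r => if r == i then phi i x else 0)); last first.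
  by move=> r /andP[_ rm]; exact: Z.
rewrite -big_nat big_mkord (bigD1 (Ordinal im))//= eqxx big1 ?addr0// => r.
by rewrite -val_eqE /= => /negPf ->.
Qed.

Lemma sol_at0 i F phi x : smooth_family F -> (forall r, smooth_fun (phi r)) -> (i < 2 * m)%N ->
  sol i F phi x 0 = phi i x.
Proof.
move=> sF sphi im; rewrite /sol cauchy_at0// /duhamel or_int_at0 ltn_eqF//.
by rewrite addr0 add0r.
Qed.

Lemma sol_ivp F phi : smooth_family F -> (forall r, smooth_fun (phi r)) ->
  ivp_solution m b (fun x t => F t x) phi (sol 0 F phi).
Proof.
move=> sF sphi; split.
- by apply: sol_Ck_half => //; rewrite addn0.
- move=> x t t0; rewrite -(sol_pde x t sF sphi) /opP.
  apply: eq_big_nat => k /andP[_ km].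
  congr (_ * iter _ _ _ x); apply/funext => y.
  by rewrite sol_derive1n//; lia.
- move=> r x rm; rewrite sol_derive1n//; last exact: ltnW.
  rewrite -(sol_at0 x sF sphi rm); apply: cvg_at_right_filter.
  have c := @sol_cont r F phi sF sphi.
  have cp : continuous (fun t : R => (x, t)) by apply: cont_pair; [exact: cont_cst|exact: cont_id].
  exact: (cont_comp c cp).
Qed.

End Solution.

(** * The explicit formula *)

Section Formula.
Variables (R : realType) (nu m : nat) (a : 'I_m -> R) (b : nat -> R).
Notation n := (2 * nu + 1).+2.
Hypothesis hm : (1 <= m)%N.
Hypothesis ainj : injective a.
Hypothesis apos : forall i, 0 < a i.
Hypothesis hb : \sum_(0 <= k < m.+1) b (2 * k)%N *: 'X^(2 * k)
          = \prod_(i < m) ('X^2 - (a i ^+ 2)%:P).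
Implicit Types (g : 'rV[R]_n -> R) (x : 'rV[R]_n) (F : R -> 'rV[R]_n -> R)
  (phi : nat -> 'rV[R]_n -> R) (t : R).
Notation lap q := (iter q (@laplacian R n)).

Let W j : op R n := @wave_op R nu (a j).
Let W1 j : op R n := @wave_op_dt R nu (a j).
Let wW j : wave_solution (a j) (W j) (W1 j) := @wave_op_correct R nu (a j).
Notation G := (green_op a W W1).

(** The i-th time derivative of the polynomial by which the mean-value expression
    differs from the fundamental solution, for i <= 2m - 1. *)
Definition poly_part i : op R n := fun g x t =>
  \sum_(j < m) coefA a j * \sum_(0 <= l < nu)
     a j ^+ (2 * l) * t ^+ (2 * l + 2 * m - 1 - i)
       / ((2 * l + 2 * m - 1 - i)`!)%:R * lap l g x.

Lemma regular_id : regular_op (fun g x t => g x).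
Proof.
split; first last.
- by [].
- by move=> g k x t sg; exact: smooth_drv.
- move=> F sF.
  apply: (cont_comp2 (smooth_family_cont sF) (@cont_fst _ _)).
  exact: (cont_comp (@cont_fst _ _) (@cont_snd _ _)).
Qed.

Lemma regular_poly_part i : regular_op (poly_part i).
Proof.
apply: regular_sum => j; apply: (regular_scale (@cont_cst R R (coefA a j))).
apply: regular_sum => l.
apply: (regular_scale (a := fun t => a j ^+ (2 * l) * t ^+ (2 * l + 2 * m - 1 - i)
       / ((2 * l + 2 * m - 1 - i)`!)%:R)).
  apply: contM; last exact: cont_cst.
  by apply: contM; [exact: cont_cst|apply: contX; exact: cont_id].
exact: (regular_lap l regular_id).
Qed.

Lemma poly_part_dt i g x t : (i < 2 * m - 1)%N ->
  is_derive t 1 (poly_part i g x) (poly_part i.+1 g x t).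
Proof.
move=> im.
apply: (@drv_sum R _ _ _ _ _ xpredT (fun j t => coefA a j * \sum_(0 <= l < nu)
     a j ^+ (2 * l) * t ^+ (2 * l + 2 * m - 1 - i)
       / ((2 * l + 2 * m - 1 - i)`!)%:R * lap l g x)) => j _.
apply: drvZ; apply: (@drv_sum R _ _ _ _ _ xpredT (fun l t =>
     a j ^+ (2 * l) * t ^+ (2 * l + 2 * m - 1 - i)
       / ((2 * l + 2 * m - 1 - i)`!)%:R * lap l g x)) => l _.
have -> : (2 * l + 2 * m - 1 - i = (2 * l + 2 * m - 1 - i.+1).+1)%N by lia.
set q := (2 * l + 2 * m - 1 - i.+1)%N.
have H := drvZ (a j ^+ (2 * l)) (drvM (drv_monomial q t) (drvc _ _ (lap l g x))).
rewrite (_ : (fun t => a j ^+ (2 * l) * t ^+ q.+1 / (q.+1`!)%:R * lap l g x) =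
  (fun t => a j ^+ (2 * l) * (t ^+ q.+1 / (q.+1`!)%:R * lap l g x))); last first.
  by apply/funext => s; rewrite !mulrA.
by apply: drv_eq H _; rewrite mulr0 addr0 !mulrA.
Qed.

Lemma pow_conv_sum q t (I : Type) (r : seq I) (e : I -> R) (w : I -> R -> R) :
  (forall i, continuous (w i)) ->
  pow_conv q (fun s => \sum_(i <- r) e i * w i s) t = \sum_(i <- r) e i * pow_conv q (w i) t.
Proof.
move=> cw; case: q => [//|q] /=; rewrite -or_int_sum.
  congr or_int; apply/funext => s; rewrite mulr_sumr.
  by apply: eq_bigr => i _; rewrite mulrCA.
by move=> i; apply: contM => //; apply: cont_pow_sub; [exact: cont_cst|exact: cont_id].
Qed.

Definition mean_kernel g x tau : R :=
  \sum_(j < m) coefA a j * tau * J_mean nu (a j) g x tau.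

Lemma conv_mean g x t : smooth_fun g -> 0 <= t ->
  conv_power m (mean_kernel g x) t = G 0 g x t - poly_part 0 g x t.
Proof.
move=> sg t0.
(* The polynomial of [J_meanE], in terms of normalised powers. *)
pose pw j (s : R) := \sum_(0 <= l < nu) (a j ^+ (2 * l) * lap l g x) *
  (s ^+ (2 * l + 1) / ((2 * l + 1)`!)%:R).
have cpw j : continuous (pw j).
  by apply: cont_sum => l _; apply: contM; [exact: cont_cst|exact: cont_monomial].
have cW j : continuous (W j g x).
  by apply: op_cont_t sg; have [] := wW j.
have cd j : continuous (fun s => W j g x s + -1 * pw j s).
  by apply: contD => //; apply: contM => //; exact: cont_cst.
rewrite (@conv_powerE R m _ (fun s => \sum_j coefA a j * (W j g x s + -1 * pw j s)))//.
- rewrite pow_conv_sum// /green_op /poly_part -sumrB; apply: eq_bigr => j _.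
  rewrite -mulrBr; congr (_ * _); rewrite pow_conv_lin// mulN1r; congr (_ - _).
    by rewrite branch0.
  rewrite /pw (pow_conv_sum _ _ _ _ (fun l => @cont_monomial R (2 * l + 1))).
  apply: eq_bigr => l _; rewrite pow_conv_monomial.
  have -> : (2 * l + 1 + (2 * m - 2) = 2 * l + 2 * m - 1 - 0)%N by lia.
  by rewrite mulrAC !mulrA.
- by apply: cont_sum => j _; apply: contM => //; exact: cont_cst.
- move=> s /andP[s0 _]; rewrite /mean_kernel; apply: eq_bigr => j _.
  rewrite -mulrA (@J_meanE R nu _ _ x _ (apos j) sg s0) mulN1r; congr (_ * (_ - _)).
  by apply: eq_bigr => l _; rewrite [RHS]mulrAC !mulrA.
Qed.

(** Iterated derivatives at positive times of a function that is known there only: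
    J and the convolution are defined by integrals from 0 and have no useful values
    at negative times. *)
Lemma derive1n_pos (f : R -> R) (D : nat -> R -> R) N :
  (forall s : R, 0 < s -> f s = D 0%N s) ->
  (forall i (s : R), (i < N)%N -> is_derive s 1 (D i) (D i.+1 s)) ->
  forall i (s : R), (i <= N)%N -> 0 < s -> derive1n i f s = D i s.
Proof.
move=> f0 dD; elim=> [|i IH] s iN s0; first exact: f0.
rewrite derive1nS derive1E.
have ne : \near s, derive1n i f s = D i s.
  by near=> u; apply: IH; [exact: ltnW|near: u; exact: lt_nbhsr].
by rewrite (near_eq_derive _ ne); have [_ ->] := dD i s iN.
Unshelve. all: by end_near. Qed.

Lemma conv_mean_derive1n i g x t : smooth_fun g -> 0 < t -> (i < 2 * m)%N ->
  derive1n i (conv_power m (mean_kernel g x)) t = G i g x t - poly_part i g x t.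
Proof.
move=> sg t0 im.
apply: (@derive1n_pos _ (fun i t => G i g x t - poly_part i g x t) (2 * m - 1)) => //.
- by move=> s s0; apply: conv_mean => //; exact: ltW.
- move=> k s km; apply: drvB; last exact: poly_part_dt.
  exact: (green_op_dt wW k x s sg).
- by lia.
Qed.

Lemma duhamel_formula F x t : smooth_family F -> 0 <= t ->
  itv_int 0 t (fun tau => conv_power m (mean_kernel (F tau) x) (t - tau)) +
  itv_int 0 t (fun tau => poly_part 0 (F tau) x (t - tau)) =
  duhamel a W W1 0 F x t.
Proof.
move=> sF t0.
have cG : continuous (fun tau => G 0 (F tau) x (t - tau)).
  exact: (@cont_duhamel_kernel R n m a W W1 wW R 0 F (fun=> x) (fun=> t) (fun s => s) sF
    (@cont_cst _ _ _) (@cont_cst _ _ _) (@cont_id _)).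
have cP : continuous (fun tau => poly_part 0 (F tau) x (t - tau)).
  have [cp _ _] := regular_poly_part 0.
  have ct : continuous (fun tau : R => (tau, (x, t - tau))).
    apply: cont_pair; first exact: cont_id.
    apply: cont_pair; first exact: cont_cst.
    by apply: contD; [exact: cont_cst|apply: contN; exact: cont_id].
  exact: (cont_comp (cp _ sF) ct).
rewrite /duhamel (_ : (0 == 2 * m)%N = false); last by lia.
rewrite addr0 (or_int_itv_int cG t0).
rewrite (@eq_itv_int _ 0 t _ (fun tau => G 0 (F tau) x (t - tau) +
    -1 * poly_part 0 (F tau) x (t - tau))); last first.
  move=> tau /andP[_ taut]; have st := smooth_family_slice tau sF.
  by rewrite (conv_mean x st) ?subr_ge0// mulN1r.
by rewrite itv_int_lin// mulN1r subrK.
Qed.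

Lemma smooth_fun_sum (I : Type) (r : seq I) (g : I -> 'rV[R]_n -> R) :
  (forall i, smooth_fun (g i)) -> smooth_fun (fun y => \sum_(i <- r) g i y).
Proof. by move=> sg; exact: (smooth_family_sum r sg). Qed.

Lemma iter_lap_sum q (I : Type) (r : seq I) (g : I -> 'rV[R]_n -> R) :
  (forall i, smooth_fun (g i)) ->
  lap q (fun y => \sum_(i <- r) g i y) = (fun y => \sum_(i <- r) lap q (g i) y).
Proof.
move=> sg; apply/funext => x.
exact: (op_sum r x 0 (regular_lap q regular_id) sg).
Qed.

(** The Laplacian is applied to the mean-value expression and to the polynomial
    separately; since both are smooth in x, the two may be joined before the
    polynomial cancels. *)
Lemma cauchy_term k phi x t : (forall r, smooth_fun (phi r)) -> 0 < t -> (k <= m)%N ->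
  lap (m - k) (fun y => \sum_(0 <= r < 2 * k)
     derive1n (2 * k - 1 - r) (conv_power m (mean_kernel (phi r) y)) t) x +
  lap (m - k) (fun y => \sum_(0 <= r < 2 * k) poly_part (2 * k - 1 - r) (phi r) y t) x =
  \sum_(0 <= r < 2 * k) G (2 * k - 1 - r) (lap (m - k) (phi r)) x t.
Proof.
move=> sphi t0 km.
pose A r y := G (2 * k - 1 - r) (phi r) y t.
pose B r y := poly_part (2 * k - 1 - r) (phi r) y t.
have sA r : smooth_fun (A r) by apply: smooth_fun_op; [exact: regular_green_op|exact: sphi].
have sB r : smooth_fun (B r) by apply: smooth_fun_op; [exact: regular_poly_part|exact: sphi].
have sAB r : smooth_fun (fun y => A r y + -1 * B r y) by exact: (smooth_family_lin (-1) (sA r) (sB r)).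
have -> : (fun y => \sum_(0 <= r < 2 * k)
     derive1n (2 * k - 1 - r) (conv_power m (mean_kernel (phi r) y)) t) =
  (fun y => \sum_(0 <= r < 2 * k) (A r y + -1 * B r y)).
  apply/funext => y; apply: eq_big_nat => r /andP[_ rk].
  rewrite conv_mean_derive1n//; last by lia.
  by rewrite mulN1r.
pose r0 := index_iota 0 (2 * k).
transitivity (lap (m - k) (fun y => \sum_(r <- r0) (A r y + -1 * B r y) +
    \sum_(r <- r0) B r y) x).
  by rewrite (iter_lapD (m - k) (smooth_fun_sum r0 sAB) (smooth_fun_sum r0 sB)).
have -> : (fun y => \sum_(r <- r0) (A r y + -1 * B r y) + \sum_(r <- r0) B r y) =
    (fun y => \sum_(r <- r0) A r y).
  apply/funext => y; rewrite -big_split /=; apply: eq_bigr => r _.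
  by rewrite mulN1r subrK.
rewrite (iter_lap_sum (m - k) r0 sA); apply: eq_bigr => r _.
by rewrite /A (iter_lap_op t (m - k) (regular_green_op wW (2 * k - 1 - r)) (sphi r)).
Qed.

Lemma cauchy_formula phi x t : (forall r, smooth_fun (phi r)) -> 0 < t ->
  \sum_(0 <= k < m.+1) b (2 * k)%N *
    lap (m - k) (fun y => \sum_(0 <= r < 2 * k)
     derive1n (2 * k - 1 - r) (conv_power m (mean_kernel (phi r) y)) t) x +
  \sum_(0 <= k < m.+1) b (2 * k)%N *
    lap (m - k) (fun y => \sum_(0 <= r < 2 * k)
      poly_part (2 * k - 1 - r) (phi r) y t) x =
  cauchy a b W W1 0 phi x t.
Proof.
move=> sphi t0; rewrite -big_split /=; apply: eq_big_nat => k /andP[_ km].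
rewrite -mulrDr (cauchy_term _ sphi t0); last by lia.
by congr (_ * _); apply: eq_bigr => r _; rewrite addn0.
Qed.

Lemma odd_dim_solution (f : 'rV[R]_n -> R -> R) phi : smooth_half f ->
  (forall r, (r < 2 * m)%N -> smooth (phi r)) ->
  exists2 u : 'rV[R]_n -> R -> R,
    ivp_solution m b f phi u &
    forall x t, 0 < t -> u x t =
      itv_int 0 t (fun tau => conv_power m (mean_kernel (f ^~ tau) x) (t - tau))
      + itv_int 0 t (fun tau => poly_part 0 (f ^~ tau) x (t - tau))
      + \sum_(0 <= k < m.+1) b (2 * k)%N *
          lap (m - k) (fun y => \sum_(0 <= r < 2 * k)
            derive1n (2 * k - 1 - r) (conv_power m (mean_kernel (phi r) y)) t) x
      + \sum_(0 <= k < m.+1) b (2 * k)%N *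
          lap (m - k) (fun y => \sum_(0 <= r < 2 * k)
            poly_part (2 * k - 1 - r) (phi r) y t) x.
Proof.
move=> sf sphi.
pose F (tau : R) y := f y (Num.max tau 0).
(* Initial data are given for r < 2m only; zero data make the family total. *)
pose psi r : 'rV[R]_n -> R := if (r < 2 * m)%N then phi r else fun=> 0.
have sF : smooth_family F := smooth_family_half_space sf.
have spsi r : smooth_fun (psi r).
  rewrite /psi; case: ifP => [rm|_]; last exact: smooth_family0.
  by apply: smooth_smooth_fun; exact: sphi.
have psiE r : (r < 2 * m)%N -> psi r = phi r by rewrite /psi => ->.
have FE tau : 0 <= tau -> F tau = f ^~ tau by move=> h; rewrite /F max_l.
have [cu Pu u0] := sol_ivp hm ainj apos hb wW sF spsi.
exists (sol a b W W1 0 F psi).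
  split => //.
  - by move=> x t t0; rewrite Pu// FE// ltW.
  - by move=> r x rm; rewrite -psiE//; exact: u0.
move=> x t t0; rewrite /sol -(duhamel_formula x sF (ltW t0)) -(cauchy_formula x spsi t0).
rewrite -[RHS]addrA; apply: (f_equal2 +%R); apply: (f_equal2 +%R).
- by apply: eq_itv_int => tau /andP[h _]; rewrite FE.
- by apply: eq_itv_int => tau /andP[h _]; rewrite FE.
- apply: eq_big_nat => k /andP[_ km]; apply: (f_equal (fun h => b (2 * k)%N * lap (m - k) h x)).
  by apply/funext => y; apply: eq_big_nat => r /andP[_ rk]; rewrite psiE//; lia.
- apply: eq_big_nat => k /andP[_ km]; apply: (f_equal (fun h => b (2 * k)%N * lap (m - k) h x)).
  by apply/funext => y; apply: eq_big_nat => r /andP[_ rk]; rewrite psiE//; lia.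
Qed.
End Formula.

Theorem theorem3p6 (R : realType) (m n nu : nat) (a : 'I_m -> R) (b : nat -> R)
    (f : 'rV[R]_n -> R -> R) (phi : nat -> 'rV[R]_n -> R)
    (hm : (1 <= m)%N) (hn : (n - 2 = 2 * nu + 1)%N)
    (ainj : injective a) (apos : forall i, 0 < a i)
    (hb : \sum_(0 <= k < m.+1) b (2 * k)%N *: 'X^(2 * k)
          = \prod_(i < m) ('X^2 - (a i ^+ 2)%:P))
    (hf : smooth_half f)
    (hphi : forall r, (r < 2 * m)%N -> smooth (phi r)) :
  exists2 u : 'rV[R]_n -> R -> R,
    ivp_solution m b f phi u &
    forall (x : 'rV[R]_n) (t : R), 0 < t -> u x t =
      \int[lebesgue_measure]_(tau in `[0, t])
        conv_power m (fun tau' => \sum_(j < m)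
          coefA a j * tau' * J_mean nu (a j) (f ^~ tau) x tau') (t - tau)
      + \int[lebesgue_measure]_(tau in `[0, t])
          (\sum_(j < m) coefA a j * \sum_(0 <= l < nu)
             a j ^+ (2 * l) * (t - tau) ^+ (2 * l + 2 * m - 1)
               / ((2 * l + 2 * m - 1)`!)%:R
             * iter l (@laplacian R n) (f ^~ tau) x)
      + \sum_(0 <= k < m.+1) b (2 * k)%N *
          iter (m - k) (@laplacian R n) (fun y =>
            \sum_(0 <= r < 2 * k)
              derive1n (2 * k - 1 - r)
                (conv_power m (fun tau => \sum_(j < m)
                   coefA a j * tau * J_mean nu (a j) (phi r) y tau)) t) x
      + \sum_(0 <= k < m.+1) b (2 * k)%N *
          iter (m - k) (@laplacian R n) (fun y =>
            \sum_(0 <= r < 2 * k) \sum_(j < m) coefA a j * \sum_(0 <= l < nu)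
              a j ^+ (2 * l) * t ^+ (2 * l + 2 * m + r - 2 * k)
                / ((2 * l + 2 * m + r - 2 * k)`!)%:R
              * iter l (@laplacian R n) (phi r) y) x.
Proof.
have en : n = (2 * nu + 1).+2 by lia.
subst n => {hn}.
have [u ivp uE] := odd_dim_solution hm ainj apos hb hf hphi.
exists u => // x t t0; rewrite uE//.
apply: (f_equal2 +%R); [apply: (f_equal2 +%R); [apply: (f_equal2 +%R)|]|] => //.
- apply: eq_itv_int => tau _; apply: eq_bigr => j _; congr (_ * _).
  by apply: eq_bigr => l _; rewrite subn0.
- apply: eq_big_nat => k /andP[_ km].
  apply: (f_equal (fun h => b (2 * k)%N * iter (m - k) (@laplacian R _) h x)).
  apply/funext => y; apply: eq_big_nat => r /andP[_ rk].
  apply: eq_bigr => j _; congr (_ * _); apply: eq_bigr => l _.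
  by have -> : (2 * l + 2 * m - 1 - (2 * k - 1 - r) = 2 * l + 2 * m + r - 2 * k)%N by lia.
Qed.
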